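(* Let $\Sigma$ be a closed hyperbolic manifold of dimension $n$, and let $X$ be any closed manifold of dimension $m \geq 2$. Set $V_0 = 2\cdot V_{\mathbb{R}^{n+m}}(1)$. Then for every $\varepsilon > 0$ there is a Riemannian metric $g$ on $\Sigma \times X$ such that the volumes of unit balls in the universal cover satisfy $$V_{(\widetilde{\Sigma \times X}, \widetilde{g})}(1) < V_0,$$ and simultaneously there is a submanifold of $\Sigma\times X$ isotopic to $\Sigma \times \ast$ with $n$-dimensional volume (with respect to $g$) less than $\varepsilon$.
   Context: For a Riemannian manifold $(M,g)$ and radius $r$, $V_{(M,g)}(r)$ denotes the supremum of the volumes of metric balls of radius $r$ in $(M,g)$; in particular $V_{\mathbb{R}^{n+m}}(1)$ is the volume of the unit ball in Euclidean space $\mathbb{R}^{n+m}$. $(\widetilde{\Sigma\times X},\widetilde{g})$ denotes the Riemannian universal cover of $(\Sigma\times X,g)$. $\Sigma\times\ast$ denotes a copy $\Sigma\times\{x\}$ with $x\in X$. *)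

(* Defs.v *)
From HB Require Import structures.
From mathcomp Require Import all_boot all_order all_algebra.
From mathcomp Require Import all_classical all_reals all_analysis.
Set Implicit Arguments.
Unset Strict Implicit.
Unset Printing Implicit Defensive.
Import Order.TTheory GRing.Theory Num.Theory.
Import numFieldNormedType.Exports.
Local Open Scope classical_set_scope.
Local Open Scope ring_scope.

Section SmoothMaps.
Context {R : realType} {V W : normedModType R}.

(* [U] is meant to be open: the derivatives at a point of [U] then only depend
   on the restriction of [f] to [U]. *)
Fixpoint Ck (k : nat) (U : set V) (f : V -> W) : Prop :=
  match k with
  | 0%N => forall x, U x -> {for x, continuous f}
  | k'.+1 => (forall x, U x -> differentiable f x) /\
             (forall v, Ck k' U (fun x => 'D_v f x))
  end.

Definition Cinfty (U : set V) (f : V -> W) : Prop := forall k, Ck k U f.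

End SmoothMaps.

(* [cmap] only matters on [cdom], and [cinv] only on the image [ccod]. *)
Record chart (R : realType) (M : Type) (n : nat) := Chart {
  cdom : set M;
  cmap : M -> 'rV[R]_n;
  cinv : 'rV[R]_n -> M }.

Definition ccod (R : realType) (M : Type) (n : nat) (c : chart R M n) :
  set 'rV[R]_n := cmap c @` cdom c.

Section Manifolds.
Context {R : realType}.

Definition is_chart (M : topologicalType) (n : nat) (c : chart R M n) : Prop :=
  [/\ open (cdom c), open (ccod c),
      forall x, cdom c x -> {for x, continuous (cmap c)},
      forall u, ccod c u -> {for u, continuous (cinv c)} &
      forall x, cdom c x -> cinv c (cmap c x) = x].

Definition transition (M : Type) (n : nat) (c d : chart R M n) :
  'rV[R]_n -> 'rV[R]_n := cmap d \o cinv c.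

Definition smooth_manifold (M : topologicalType) (n : nat)
    (A : set (chart R M n)) : Prop :=
  [/\ hausdorff_space M, @second_countable M,
      forall c, A c -> is_chart c,
      forall x, exists2 c, A c & cdom c x &
      forall c d, A c -> A d ->
        Cinfty (cmap c @` (cdom c `&` cdom d)) (transition c d)].

(* Charts take values in the whole of R^n, so there is no boundary; as usual,
   manifolds are nonempty and connected. *)
Definition closed_manifold (M : topologicalType) (n : nat)
    (A : set (chart R M n)) : Prop :=
  [/\ smooth_manifold A, compact [set: M], connected [set: M] &
      [set: M] !=set0].

Definition prod_chart (M N : Type) (m n : nat)
    (c : chart R M m) (d : chart R N n) : chart R (M * N)%type (m + n) :=
  Chart (cdom c `*` cdom d)
        (fun p => row_mx (cmap c p.1) (cmap d p.2))
        (fun u => (cinv c (lsubmx u), cinv d (rsubmx u))).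

Definition prod_atlas (M N : Type) (m n : nat)
    (A : set (chart R M m)) (B : set (chart R N n)) :
    set (chart R (M * N)%type (m + n)) :=
  [set e | exists c d, [/\ A c, B d & e = prod_chart c d]].

Definition euclidean_atlas (n : nat) : set (chart R 'rV[R]_n n) :=
  [set Chart setT id id].

Definition line_chart : chart R R 1 :=
  Chart setT (fun t => t%:M) (fun u => u ord0 ord0).

Definition line_atlas : set (chart R R 1) := [set line_chart].

Definition local_rep (M N : Type) (m n : nat) (f : M -> N)
    (a : chart R M m) (b : chart R N n) : 'rV[R]_m -> 'rV[R]_n :=
  cmap b \o f \o cinv a.

Definition smooth_on (M N : topologicalType) (m n : nat)
    (A : set (chart R M m)) (B : set (chart R N n))
    (U : set M) (f : M -> N) : Prop :=
  (forall x, U x -> {for x, continuous f}) /\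
  (forall a b, A a -> B b ->
     Cinfty (cmap a @` (cdom a `&` U `&` f @^-1` cdom b)) (local_rep f a b)).

Definition smooth_map (M N : topologicalType) (m n : nat)
    (A : set (chart R M m)) (B : set (chart R N n)) (f : M -> N) : Prop :=
  smooth_on A B setT f.

(* Tangent vectors are row vectors, so that the differential of [f] at [u]
   is [v |-> v *m 'J f u]. *)
Definition immersion (M N : Type) (m n : nat)
    (A : set (chart R M m)) (B : set (chart R N n)) (f : M -> N) : Prop :=
  forall a b x, A a -> B b -> cdom a x -> cdom b (f x) ->
    row_free ('J (local_rep f a b) (cmap a x)).

Definition embedding (M N : topologicalType) (m n : nat)
    (A : set (chart R M m)) (B : set (chart R N n)) (f : M -> N) : Prop :=
  [/\ smooth_map A B f, immersion A B f, injective f &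
      forall U : set M, open U ->
        exists2 W : set N, open W & f @` U = W `&` range f].

Definition isotopic (M N : topologicalType) (m n : nat)
    (A : set (chart R M m)) (B : set (chart R N n)) (e0 e1 : M -> N) : Prop :=
  exists F : M * R -> N,
    [/\ smooth_map (prod_atlas A line_atlas) B F,
        forall t : R, 0 <= t <= 1 -> embedding A B (fun x => F (x, t)),
        forall x, F (x, 0) = e0 x &
        forall x, F (x, 1) = e1 x].

End Manifolds.

(* A symmetric 2-tensor, given by its matrix in each chart, as a function of
   the coordinates in that chart. *)
Definition tensor2 (R : realType) (M : Type) (n : nat) : Type :=
  chart R M n -> 'rV[R]_n -> 'M[R]_n.

Section RiemannianMetrics.
Context {R : realType}.

Definition riemannian_metric (M : Type) (n : nat)
    (A : set (chart R M n)) (g : tensor2 R M n) : Prop :=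
  [/\ forall c, A c -> Cinfty (ccod c) (g c),
      forall c u, A c -> ccod c u -> (g c u)^T = g c u,
      forall c u (v : 'rV[R]_n), A c -> ccod c u -> v != 0 ->
        0 < (v *m g c u *m v^T) ord0 ord0 &
      forall c d x, A c -> A d -> cdom c x -> cdom d x ->
        g c (cmap c x) = 'J (transition c d) (cmap c x) *m g d (cmap d x)
                           *m ('J (transition c d) (cmap c x))^T].

(* When [g] is a metric and [f] is smooth, the matrix does not depend on the
   chart [b] of the target around the image point, so the set below is a
   singleton. *)
Definition pullback (M N : Type) (m n : nat) (B : set (chart R N n))
    (g : tensor2 R N n) (f : M -> N) : tensor2 R M m :=
  fun a u => xget 0 [set G | exists b,
    [/\ B b, cdom b (f (cinv a u)) &
        G = 'J (local_rep f a b) u *m g b (cmap b (f (cinv a u)))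
              *m ('J (local_rep f a b) u)^T]].

Definition euclidean_metric (n : nat) : tensor2 R 'rV[R]_n n :=
  fun _ _ => 1%:M.

Definition sqnorm (n : nat) (u : 'rV[R]_n) : R := (u *m u^T) ord0 ord0.

(* Hyperbolic space is the unit ball with the metric 4 |du|^2 / (1 - |u|^2)^2. *)
Definition poincare_metric (n : nat) : tensor2 R 'rV[R]_n n :=
  fun _ u => (4 / (1 - sqnorm u) ^+ 2)%:M.

Definition hyperbolic (M : topologicalType) (n : nat)
    (A : set (chart R M n)) (h : tensor2 R M n) : Prop :=
  riemannian_metric A h /\
  forall x : M, exists U (f : M -> 'rV[R]_n),
    [/\ open_nbhs x U, smooth_on A (@euclidean_atlas R n) U f,
        forall y, U y -> sqnorm (f y) < 1 &
        forall c y, A c -> U y -> cdom c y ->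
          pullback (@euclidean_atlas R n) (@poincare_metric n) f c (cmap c y)
          = h c (cmap c y)].

Definition speed (M : Type) (n : nat) (A : set (chart R M n))
    (g : tensor2 R M n) (gamma : R -> M) (t : R) : R :=
  Num.sqrt (pullback A g gamma line_chart t%:M ord0 ord0).

Definition length (M : Type) (n : nat) (A : set (chart R M n))
    (g : tensor2 R M n) (gamma : R -> M) : \bar R :=
  (\int[lebesgue_measure]_(t in `[0%R, 1%R]) (speed A g gamma t)%:E)%E.

(* [joined A g x y L]: some piecewise smooth path from [x] to [y] has
   length [L]; each piece is parametrized by [0, 1]. *)
Inductive joined (M : topologicalType) (n : nat) (A : set (chart R M n))
    (g : tensor2 R M n) (x : M) : M -> \bar R -> Prop :=
| joined_refl : joined A g x x 0%E
| joined_step (gamma : R -> M) (L : \bar R) :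
    joined A g x (gamma 0) L -> smooth_map line_atlas A gamma ->
    joined A g x (gamma 1) (L + length A g gamma)%E.

Definition rdist (M : topologicalType) (n : nat) (A : set (chart R M n))
    (g : tensor2 R M n) (x y : M) : \bar R :=
  ereal_inf [set L | joined A g x y L].

Definition rball (M : topologicalType) (n : nat) (A : set (chart R M n))
    (g : tensor2 R M n) (x : M) (r : R) : set M :=
  [set y | (rdist A g x y < r%:E)%E].

(* The Lebesgue integral over R^n of a nonnegative Borel function, as an
   iterated integral. *)
Fixpoint lebesgue_int (n : nat) : ('rV[R]_n -> \bar R) -> \bar R :=
  match n with
  | 0%N => fun F => F 0
  | n'.+1 => fun F =>
      (\int[lebesgue_measure]_x
         lebesgue_int (fun v : 'rV[R]_n' => F (row_mx (x%:M : 'rV[R]_1) v)))%E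
  end.

Definition chart_volume (M : Type) (n : nat) (g : tensor2 R M n)
    (c : chart R M n) (T : set M) : \bar R :=
  lebesgue_int (fun u =>
    (\1_(cmap c @` T) u * Num.sqrt (\det (g c u)))%:E).

Definition borel (M : topologicalType) (T : set M) : Prop :=
  (<<s (@open M) >>) T.

(* Riemannian volume of a Borel set [S]. Since countably many charts cover a
   manifold, [S] is a countable disjoint union of Borel sets each contained in
   a chart domain, so that the volume is the supremum below. *)
Definition volume (M : topologicalType) (n : nat) (A : set (chart R M n))
    (g : tensor2 R M n) (S : set M) : \bar R :=
  ereal_sup [set v | exists k (c : 'I_k -> chart R M n) (T : 'I_k -> set M),
    [/\ forall i, A (c i),
        forall i, borel (T i) /\ T i `<=` cdom (c i) `&` S,
        trivIset setT T &
        v = (\sum_(i < k) chart_volume g (c i) (T i))%E]].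

Definition max_ball_volume (M : topologicalType) (n : nat)
    (A : set (chart R M n)) (g : tensor2 R M n) (r : R) : \bar R :=
  ereal_sup [set volume A g (rball A g x r) | x in setT].

End RiemannianMetrics.

Section UniversalCover.
Context {R : realType}.

Definition simply_connected (M : topologicalType) : Prop :=
  [/\ [set: M] !=set0,
      forall x y : M, exists gamma : R -> M,
        [/\ {within `[0, 1], continuous gamma}, gamma 0 = x & gamma 1 = y] &
      forall gamma : R -> M, {within `[0, 1], continuous gamma} ->
        gamma 0 = gamma 1 ->
        exists H : R * R -> M,
          [/\ {within `[0, 1] `*` `[0, 1], continuous H},
              forall t, 0 <= t <= 1 -> H (0, t) = gamma t,
              forall t, 0 <= t <= 1 -> H (1, t) = gamma 0,
              forall s, 0 <= s <= 1 -> H (s, 0) = gamma 0 &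
              forall s, 0 <= s <= 1 -> H (s, 1) = gamma 0]].

(* Every point of the base has a neighbourhood [W] whose preimage is the
   disjoint union of open sheets, each mapped diffeomorphically onto [W];
   [s] is the inverse diffeomorphism. *)
Definition smooth_covering (E M : topologicalType) (k n : nat)
    (B : set (chart R E k)) (A : set (chart R M n)) (p : E -> M) : Prop :=
  [/\ smooth_map B A p, range p = setT &
      forall x : M, exists W (F : set (set E)),
        [/\ open_nbhs x W, trivIset F id, p @^-1` W = \bigcup_(V in F) V &
            forall V, F V -> open V /\
              exists s : M -> E,
                [/\ smooth_on A B W s, forall y, W y -> V (s y),
                    forall y, W y -> p (s y) = y &
                    forall z, V z -> s (p z) = z]]].

Definition universal_cover (E M : topologicalType) (n : nat)
    (B : set (chart R E n)) (A : set (chart R M n)) (p : E -> M) : Prop :=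
  [/\ smooth_manifold B, simply_connected E & smooth_covering B A p].

End UniversalCover.

(* Main.v *)
Require Import Defs.
From HB Require Import structures.
From mathcomp Require Import all_boot all_order all_algebra fingroup perm.
From mathcomp Require Import all_classical all_reals all_analysis.
From mathcomp Require Import measurable_realfun.
From mathcomp Require Import ring lra zify.
Set Implicit Arguments.
Unset Strict Implicit.
Unset Printing Implicit Defensive.
Import Order.TTheory GRing.Theory Num.Theory.
Import numFieldNormedType.Exports.
Local Open Scope classical_set_scope.
Local Open Scope ring_scope.

(* Embed [Sigma] by [fS] and [X] by [fX] into Euclidean spaces, let [F] be a tall and thin spike
   of radius [rho] around a point of [X], and take the metric [w dfS^2 + Lam^2 dfX^2 + dF^2],
   where [w] is [Lam^2] outside the top of the spike, where it drops to a tiny [del^2]. The slice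
   over the tip of the spike then has volume [O(del^n)].

   In a covering, a unit ball centered below the height [2] of the spike stays below the height
   [3], where the metric is at least [Lam^2 (dfS^2 + dfX^2)]. So it lies in a single sheet, over a
   set which [(fS, fX)] maps into a ball of radius [1 / Lam]. For [Lam] large the map is almost
   affine there, and the volume of the ball outside the spike is almost at most that of the
   Euclidean unit ball. A unit ball centered higher lies over the spike. Finally, lengths being at
   least [del] times those for [dfS^2 + dfX^2], a unit ball meets a number of sheets bounded
   independently of [rho]; in each of them the spike has volume [O(rho^(m-1))], because its density
   is [O(1 / rho)], and this tends to [0] with [rho] since [m >= 2]. *)

(** * Lebesgue measure on row vectors *)

(** The order of the choices matters. The dimension fixes a distortion [k], the embeddings then a
    Lebesgue number [lam] measured through [(fS, fX)]; [del] depends on [eps], and [Lam] is at least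
    [1 / lam]. The number of sheets that a unit ball can meet depends only on [del], [lam] and the
    size of the cover, so [rho] comes last and absorbs it.

    Weighted sums of squares are stable under pullback to coverings, slices and paths, and they
    reduce lengths to displacements in a Euclidean space: as long as the weights dominate constants,
    a path moves the coordinates by at most its length in the constant weighted norm. No geodesics
    are needed.

    Volumes in the covering are only bounded from above, up to factors close to [1]. A one-sided
    change of variables is enough for that, and it rests on one fact: a set shrinks little under a
    map whose inverse is Lipschitz with constant near [1]. The factor [2] of the theorem pays for
    these losses, which amount to [4/3 * 9/8 + 1/4 = 7/4]. *)

Section RowVectors.
Context {R : realType}.

Lemma rV_norm_ltP d (u : 'rV[R]_d) e : 0 < e ->
  `|u| < e <-> forall i, `|u 0 i| < e.
Proof.
move=> e0; rewrite [Num.norm u](_ : _ = mx_norm u)// mx_normrE; split=> [ue i|ue].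
  by apply: le_lt_trans ue; apply: (le_bigmax _ (fun ij : 'I_1 * 'I_d => `|u ij.1 ij.2|) (0, i)).
by apply/bigmax_ltP; split=> // -[i j] _ /=; rewrite (ord1 i).
Qed.

Lemma rV_norm_leP d (u : 'rV[R]_d) e : 0 <= e ->
  `|u| <= e <-> forall i, `|u 0 i| <= e.
Proof.
move=> e0; rewrite [Num.norm u](_ : _ = mx_norm u)// mx_normrE; split=> [ue i|ue].
  by apply: le_trans ue; apply: (le_bigmax _ (fun ij : 'I_1 * 'I_d => `|u ij.1 ij.2|) (0, i)).
by apply/bigmax_leP; split=> // -[i j] _ /=; rewrite (ord1 i).
Qed.

Lemma rV_coord_le d (u : 'rV[R]_d) i : `|u 0 i| <= `|u|.
Proof. by move: i; apply/rV_norm_leP. Qed.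

Lemma rV_open_ballP d (O : set 'rV[R]_d) u : open O -> O u ->
  exists2 e, 0 < e & forall v, `|u - v| < e -> O v.
Proof.
move=> oO Ou; have /nbhs_ballP[e e0 eO] : nbhs u O by exact: open_nbhs_nbhs.
by exists e => // v uv; apply: eO; rewrite mx_norm_ball.
Qed.

End RowVectors.

(** * Dyadic cubes, and Lebesgue measure as an iterated integral *)

Section DyadicCubes.
Context {R : realType}.

Definition borelV d := g_sigma_algebraType (@open 'rV[R]_d).

Definition cube_index d (k : nat) (u : 'rV[R]_d) : 'rV[int]_d :=
  \row_i Num.floor (u 0 i * 2 ^+ k).

(** Half-open, so that the cubes of side [2^-k] partition the space. Across levels they are nested
    or disjoint, so together with the empty set they form a countable pi-system generating the Borel
    sets. *)
Definition cube d (k : nat) (z : 'rV[int]_d) : set 'rV[R]_d :=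
  [set u | cube_index k u = z].

Lemma cubeE d k (z : 'rV[int]_d) :
  cube k z = [set u | forall i, (z 0 i)%:~R / 2 ^+ k <= u 0 i < (z 0 i + 1)%:~R / 2 ^+ k].
Proof.
have k0 : 0 < 2 ^+ k :> R by rewrite exprn_gt0.
apply/seteqP; split=> u /= => [/rowP uz i|uz].
  by move: (uz i); rewrite mxE => /eqP; rewrite floor_eq ler_pdivrMr// ltr_pdivlMr.
apply/rowP => i; rewrite mxE; apply/eqP; rewrite floor_eq.
by have := uz i; rewrite ler_pdivrMr// ltr_pdivlMr.
Qed.

Lemma cube_dist d k z (u v : 'rV[R]_d) :
  cube k z u -> cube k z v -> `|u - v| <= (2 ^+ k)^-1.
Proof.
have k0 : 0 < 2 ^+ k :> R by rewrite exprn_gt0.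
rewrite cubeE => zu zv; apply/rV_norm_leP => [|i]; first by rewrite invr_ge0 ltW.
have := zu i; have := zv i; rewrite intrD mulrDl mul1r !mxE => /andP[v1 v2] /andP[u1 u2].
by rewrite ler_norml; apply/andP; split; lra.
Qed.

(** Binary digits: [floor (2 * a)] is [2 * floor a] or [2 * floor a + 1], hence determines
    [floor a]. *)
Lemma cube_nested d k l (u v : 'rV[R]_d) : (k <= l)%N ->
  cube_index l u = cube_index l v -> cube_index k u = cube_index k v.
Proof.
move=> /subnKC <-; elim: (l - k)%N => [|j IH]; rewrite ?addn0// addnS => uv.
apply: IH; apply/rowP => i; move/rowP/(_ i): uv; rewrite !mxE exprS => uv.
set t := (k + j)%N in uv *; set a := u 0 i * _; set b := v 0 i * _.
have {}uv : Num.floor (2 * a) = Num.floor (2 * b) by rewrite /a /b !mulrA ![2 * _]mulrC -!mulrA.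
apply/esym/eqP; rewrite floor_eq.
have /andP[a1 a2] := floor_itv a; have /andP[b1 b2] := floor_itv b.
have /andP[a3 a4] := floor_itv (2 * a); have /andP[b3 b4] := floor_itv (2 * b).
rewrite -uv in b3 b4.
have h1 : (2 * Num.floor a <= Num.floor (2 * a)).
  by rewrite floor_ge_int intrM ler_pM2l.
have h2 : (Num.floor (2 * a) < 2 * Num.floor a + 2).
  by rewrite floor_lt_int intrD intrM; move: a2; rewrite intrD; lra.
have h3 : (Num.floor (2 * a) + 1 <= 2 * Num.floor a + 2) by rewrite lezD1.
have h4 : (Num.floor (2 * a))%:~R >= (2 * Num.floor a)%:~R :> R by rewrite ler_int.
have h5 : (Num.floor (2 * a) + 1)%:~R <= (2 * Num.floor a + 2)%:~R :> R by rewrite ler_int.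
rewrite intrM in h4; rewrite !intrD intrM in h5; rewrite intrD in b4 *.
by apply/andP; split; lra.
Qed.

Lemma open_cube d (O : set 'rV[R]_d) u : open O -> O u ->
  exists k0, forall k, (k0 <= k)%N -> cube k (cube_index k u) `<=` O.
Proof.
move=> oO Ou; have [e e0 eO] := rV_open_ballP oO Ou.
have [k ke] : exists k, (2 ^+ k)^-1 < e.
  have := @near_infty_natSinv_expn_lt R (PosNum e0).
  by move=> [k _ /(_ k)/= /(_ (leqnn _))]; rewrite div1r => ?; exists k.
exists k => l kl v uv; apply: eO; apply: le_lt_trans ke.
apply: le_trans (cube_dist _ uv) _ => //.
by rewrite lef_pV2 ?posrE ?exprn_gt0// ler_weXn2l// ler1n.
Qed.

Lemma measurable_coord d (i : 'I_d) :
  measurable_fun setT (fun u : borelV d => u 0 i : R).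
Proof.
apply: (measurability _ (measurable_realfun.RGenOpens.measurableE R)).
move=> _ [_ [a [b ->] <-]]; rewrite setTI; apply: sub_sigma_algebra.
by apply: open_comp => [u _|]; [exact: coord_continuous|exact: interval_open].
Qed.

Lemma measurable_box d (a b : 'I_d -> R) :
  measurable ([set u : 'rV[R]_d | forall i, a i <= u 0 i < b i] : set (borelV d)).
Proof.
rewrite (_ : mkset _ = \bigcap_(i in [set: 'I_d])
  ((fun u : borelV d => u 0 i : R) @^-1` `[a i, b i[)).
  apply: fin_bigcap_measurable => // i _; rewrite -[X in measurable X]setTI.
  by apply: measurable_coord => //; exact: measurable_itv.
by apply/seteqP; split=> u /= uz i => [_|]; have := uz i; rewrite /= in_itv/=; apply.
Qed.

Lemma measurable_cube d k z : measurable (cube k z : set (borelV d)).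
Proof. by rewrite cubeE; exact: measurable_box. Qed.

Lemma open_bigcup_cubes d (O : set 'rV[R]_d) : open O ->
  O = \bigcup_(j in [set j : nat * 'rV[int]_d | cube j.1 j.2 `<=` O]) cube j.1 j.2.
Proof.
move=> oO; apply/seteqP; split=> [u Ou|u [j /= jO] /jO//].
have [k cu] := open_cube oO Ou; exists (k, cube_index k u) => //=.
exact: cu.
Qed.

Lemma countable_bigcup_measurable (disp : measure_display) (T : measurableType disp)
    (I : countType) (P : set I) (F : I -> set T) :
  (forall i, P i -> measurable (F i)) -> measurable (\bigcup_(i in P) F i).
Proof.
move=> mF; rewrite bigcup_mkcond; apply: countable_bigcupT_measurable => // i.
by case: ifPn => // /set_mem; exact: mF.
Qed.

Lemma lebesgue_int_ge0 d (F : 'rV[R]_d -> \bar R) :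
  (forall u, 0 <= F u)%E -> (0 <= lebesgue_int F)%E.
Proof.
elim: d F => [|d IH] F F0 //=.
by apply: integral_ge0 => x _; apply: IH.
Qed.

(** The integral of a nonnegative function is a supremum over the simple functions below it, which
    makes it monotone for arbitrary functions. Iterated integrals can then be compared without
    discussing the measurability of the partial ones. *)
Lemma ge0_le_integral_nomeas (disp : measure_display) (T : measurableType disp)
    (mu : {measure set T -> \bar R}) (f g : T -> \bar R) :
  (forall x, 0 <= f x)%E -> (forall x, f x <= g x)%E ->
  (\int[mu]_x f x <= \int[mu]_x g x)%E.
Proof.
move=> f0 fg; have g0 x : (0 <= g x)%E by apply: le_trans (fg x).
rewrite !ge0_integralTE//; apply: le_ereal_sup => _ [h hf <-]; exists h => // x.
exact: le_trans (hf x) (fg x).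
Qed.

Lemma lebesgue_int_le d (F G : 'rV[R]_d -> \bar R) :
  (forall u, 0 <= F u)%E -> (forall u, F u <= G u)%E ->
  (lebesgue_int F <= lebesgue_int G)%E.
Proof.
elim: d F G => [|d IH] F G F0 FG //=.
by apply: ge0_le_integral_nomeas => x; [exact: lebesgue_int_ge0|exact: IH].
Qed.

Lemma row_mx_ord0 d (x : R) (v : 'rV[R]_d) :
  (row_mx (x%:M : 'rV_1) v : 'rV_d.+1) 0 ord0 = x.
Proof.
have -> : (ord0 : 'I_d.+1) = lshift d (0 : 'I_1) by exact/val_inj.
by rewrite (row_mxEl (x%:M : 'rV_1)) mxE eqxx.
Qed.

Lemma row_mx_lift d (x : R) (v : 'rV[R]_d) i :
  (row_mx (x%:M : 'rV_1) v : 'rV_d.+1) 0 (lift ord0 i) = v 0 i.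
Proof.
have -> : lift ord0 i = rshift 1 i by exact/val_inj.
by rewrite (row_mxEr (x%:M : 'rV_1)).
Qed.

Lemma lebesgue_int0 d : lebesgue_int (fun _ : 'rV[R]_d => 0%E) = 0%E.
Proof. by elim: d => [//|d IH] /=; apply: integral0_eq. Qed.

Lemma lebesgue_int_prod d (J : 'I_d -> set R) (l : 'I_d -> R) :
  (forall i, measurable (J i)) -> (forall i, lebesgue_measure (J i) = (l i)%:E) ->
  lebesgue_int (fun u : 'rV[R]_d => (\1_[set u : 'rV[R]_d | forall i, J i (u 0 i)] u)%:E)
  = (\prod_(i < d) l i)%:E.
Proof.
elim: d J l => [|d IH] J l mJ Jl /=.
  by rewrite big_ord0 indicE mem_set// => -[].
have l0 i : 0 <= l i by rewrite -lee_fin -Jl measure_ge0.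
rewrite big_ord_recl mulrC EFinM.
transitivity (\int[lebesgue_measure]_x ((\prod_(i < d) l (lift ord0 i))%:E
   * (\1_(J ord0) x)%:E))%E.
  apply: eq_integral => x _; rewrite -(IH (fun i => J (lift ord0 i)) (fun i => l (lift ord0 i)))//.
  rewrite [in RHS]indicE; case: (boolP (x \in _)) => xab.
    rewrite mule1; congr lebesgue_int; apply/funext => v; rewrite !indicE; congr ((_ : bool)%:R%:E).
    apply/idP/idP => /set_mem /= uab; apply/mem_set => /= i.
      by have := uab (lift ord0 i); rewrite row_mx_lift.
    case: (unliftP ord0 i) => [j|] ->; first by rewrite row_mx_lift.
    by rewrite row_mx_ord0; exact: set_mem.
  rewrite mule0 -[RHS](lebesgue_int0 d); congr lebesgue_int; apply/funext => v.
  rewrite indicE memNset//= => /(_ ord0); rewrite row_mx_ord0 => xab'.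
  by move: xab; rewrite mem_set.
rewrite ge0_integralZl//=; last 2 first.
- by apply: measurableT_comp => //; apply: measurable_indic; exact: mJ.
- by rewrite lee_fin; apply: prodr_ge0.
rewrite integral_indic ?setIT//; last exact: mJ.
by congr (_ * _)%E; exact: Jl.
Qed.

Lemma lebesgue_int_box d (a b : 'I_d -> R) : (forall i, a i <= b i) ->
  lebesgue_int (fun u : 'rV[R]_d => (\1_[set u : 'rV[R]_d | forall i, a i <= u 0 i < b i] u)%:E)
  = (\prod_(i < d) (b i - a i))%:E.
Proof.
move=> ab; rewrite -(@lebesgue_int_prod d (fun i => `[a i, b i[%classic)) => [|i|i].
- congr lebesgue_int; apply/funext => u; congr (\1__ u)%:E.
- exact: measurable_itv.
rewrite (@lebesgue_measure_itv R `[a i, b i[)/= lte_fin -EFinB.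
by have := ab i; rewrite le_eqVlt => /orP[/eqP ->|->//]; rewrite ltxx subrr.
Qed.

Lemma measurable_open d (O : set (borelV d)) : open (O : set 'rV[R]_d) -> measurable O.
Proof. by move=> oO; exact: sub_sigma_algebra. Qed.

(** The preimage of a cube is an interval times a cube, and open sets are countable unions of
    cubes. *)
Lemma measurable_rowmx d : measurable_fun setT
  (fun p : R * borelV d => row_mx (p.1%:M : 'rV_1) p.2 : borelV d.+1).
Proof.
apply: (@measurability _ _ _ _ _ _ (@open 'rV[R]_d.+1 : set (set (borelV d.+1)))) => //.
move=> _ [U oU <-]; rewrite setTI (open_bigcup_cubes oU) preimage_bigcup.
apply: countable_bigcup_measurable => -[k z] _ /=.
rewrite (_ : _ @^-1` _ = (`[(z 0 ord0)%:~R / 2 ^+ k, (z 0 ord0 + 1)%:~R / 2 ^+ k[%classic : set R)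
   `*` (cube k (\row_i z 0 (lift ord0 i)) : set (borelV d))); last first.
  rewrite !cubeE; apply/seteqP; split=> -[x v] /=.
    move=> uz; rewrite in_itv/=; split=> [|i]; first by have := uz ord0; rewrite row_mx_ord0.
    by have := uz (lift ord0 i); rewrite row_mx_lift mxE.
  rewrite in_itv/= => -[xz vz] i.
  case: (unliftP ord0 i) => [j|] ->; rewrite ?row_mx_lift ?row_mx_ord0//.
  by have := vz j; rewrite mxE.
by apply: measurableX => //; exact: measurable_cube.
Qed.

(** Induction on the dimension: the product of the measure on the line with the one obtained for
    [d], pushed forward by concatenation, integrates as the iterated integral by Tonelli.
    Sigma-finiteness is carried along because Tonelli asks for it at the next step. *)
Lemma lebesgue_int_measure d : exists mu : {sigma_finite_measure set (borelV d) -> \bar R},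
  forall F : borelV d -> \bar R, measurable_fun setT F -> (forall u, 0 <= F u)%E ->
  lebesgue_int F = (\int[mu]_u F u)%E.
Proof.
elim: d => [|d [mu IH]].
  exists (@dirac _ (borelV 0) 0 R) => F mF F0 /=.
  by rewrite integral_dirac// diracT mul1e.
pose f := (fun p : R * borelV d => row_mx (p.1%:M : 'rV_1) p.2 : borelV d.+1).
have mf : measurable_fun setT f by exact: measurable_rowmx.
pose nu := pushforward (@lebesgue_measure R \x mu)%E f.
have nuE (F : borelV d.+1 -> \bar R) : measurable_fun setT F -> (forall u, 0 <= F u)%E ->
    lebesgue_int (F : 'rV_d.+1 -> _) = (\int[nu]_u F u)%E.
  move=> mF' F0 /=; rewrite ge0_integral_pushforward//.
  rewrite preimage_setT fubini_tonelli1//=; last exact: measurableT_comp.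
  apply: eq_integral => x _ /=; rewrite /fubini_F IH//=.
  have -> : (fun v : borelV d => F (row_mx (x%:M : 'rV_1) v)) = F \o f \o (fun v => (x, v)) by [].
  by apply: measurableT_comp => //; exact: measurableT_comp.
have sf : sigma_finite setT nu.
  (* Exhaustion by the boxes with sides [[-k, k)], whose measure the iterated integral computes. *)
  exists (fun k => [set u : 'rV[R]_d.+1 | forall i, - k%:R <= u 0 i < k%:R]).
    apply/esym/seteqP; split=> // u _; exists (Num.Def.archi_bound `|u : 'rV[R]_d.+1|) => //= i.
    have := le_lt_trans (rV_coord_le (u : 'rV[R]_d.+1) i) (archi_boundP (normr_ge0 (u : 'rV[R]_d.+1))).
    by rewrite ltr_norml => /andP[/ltW -> ->].
  move=> k; split; first exact: (@measurable_box d.+1 (fun=> - k%:R) (fun=> k%:R)).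
  set B := (mkset _); have mB : measurable (B : set (borelV d.+1)).
    exact: (@measurable_box d.+1 (fun=> - k%:R) (fun=> k%:R)).
  have -> : nu B = (\int[nu]_u (\1_B u)%:E)%E by rewrite integral_indic// setIT.
  rewrite -nuE.
  - by rewrite (@lebesgue_int_box d.+1 (fun=> - k%:R) (fun=> k%:R)) ?ltry// => _; rewrite lerNl (le_trans _ (ler0n R k))// lerNl oppr0 ler0n.
  - by apply: measurableT_comp => //; exact: measurable_indic.
  - by move=> u; rewrite lee_fin.
pose nu' : {measure set (borelV d.+1) -> \bar R} :=
  measure_function_pushforward__canonical__measure_function_Measure (@lebesgue_measure R \x mu)%E mf.
pose H := Measure_isSigmaFinite.Build _ _ _ nu' sf.
pose nu'' : {sigma_finite_measure set (borelV d.+1) -> \bar R} := HB.pack (Measure.sort nu') H.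
by exists nu''.
Qed.

Definition lebesgueV d : {sigma_finite_measure set (borelV d) -> \bar R} :=
  sval (cid (lebesgue_int_measure d)).

Lemma lebesgue_intE d (F : borelV d -> \bar R) : measurable_fun setT F ->
  (forall u, 0 <= F u)%E -> lebesgue_int (F : 'rV_d -> _) = (\int[lebesgueV d]_u F u)%E.
Proof. by rewrite /lebesgueV; case: cid => mu /= h; exact: h. Qed.

Lemma lebesgueVE d (T : set (borelV d)) : measurable T ->
  lebesgueV d T = lebesgue_int (fun u : 'rV[R]_d => (\1_T u)%:E).
Proof.
move=> mT; rewrite lebesgue_intE; first by rewrite integral_indic// setIT.
  by apply: measurableT_comp => //; exact: measurable_indic.
by move=> u; rewrite lee_fin.
Qed.

Lemma lebesgueV_box d (a b : 'I_d -> R) : (forall i, a i <= b i) ->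
  lebesgueV d [set u : 'rV[R]_d | forall i, a i <= u 0 i < b i] = (\prod_(i < d) (b i - a i))%:E.
Proof. by move=> ab; rewrite lebesgueVE ?lebesgue_int_box//; exact: measurable_box. Qed.

Lemma lebesgueV_cube d k z : lebesgueV d (cube k z) = ((2 ^+ k)^-1 ^+ d)%:E.
Proof.
rewrite cubeE lebesgueV_box => [|i]; last first.
  by rewrite ler_pM2r ?invr_gt0 ?exprn_gt0// ler_int lerDl.
rewrite -[in RHS](card_ord d) -prodr_const; congr EFin; apply: eq_bigr => i _.
by rewrite -mulrBl -intrB addrAC subrr add0r mul1r.
Qed.

(** Uniqueness of a measure given on an exhausting pi-system, here the dyadic cubes. Translations,
    diagonal matrices and permutations are thereby reduced to their effect on cubes. *)
Lemma lebesgueV_unique d (m : {measure set (borelV d) -> \bar R}) :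
  (forall k z, m (cube k z) = ((2 ^+ k)^-1 ^+ d)%:E) ->
  forall T, measurable T -> lebesgueV d T = m T.
Proof.
move=> mcube T mT.
pose G := [set C : set (borelV d) | C = set0 \/ exists k z, C = cube k z].
pose g i := if unpickle i is Some z then cube 0 z else set0 : set (borelV d).
apply: (measure_unique G g) => //.
- apply/seteqP; split=> A.
    move=> mA; move: mA; apply: smallest_sub; first exact: smallest_sigma_algebra.
    move=> U oU; rewrite (open_bigcup_cubes oU).
    have := @countable_bigcup_measurable _ (g_sigma_algebraType G) _
      [set j : nat * 'rV[int]_d | cube j.1 j.2 `<=` U] (fun j => cube j.1 j.2).
    by apply=> -[k z] _; apply: sub_sigma_algebra; right; exists k, z.
  apply: smallest_sub; first exact: sigma_algebra_measurable.
  by move=> _ [->|[k [z ->]]]; [exact: measurable0|exact: measurable_cube].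
- move=> A B [->|[k [z ->]]]; first by rewrite set0I; left.
  move=> [->|[l [w ->]]]; first by rewrite setI0; left.
  wlog kl : k z l w / (k <= l)%N => [hw|].
    by case/orP: (leq_total k l) => [/hw|/hw h]; [exact|rewrite setIC; exact: h].
  have [[u [uz uw]]|/nonemptyPn ->] := pselect (cube k z `&` cube l w !=set0); last by left.
  right; exists l, w; apply/setIidPr => v vw; rewrite /cube/= -uz.
  by apply: (cube_nested kl); rewrite (uw : cube_index l u = w).
- by move=> i; rewrite /g; case: unpickle => [z|]; [right; exists 0%N, z|left].
- apply/seteqP; split=> // u _; exists (pickle (cube_index 0 (u : 'rV[R]_d))) => //.
  by rewrite /g pickleK.
- by move=> A [->|[k [z ->]]]; rewrite ?measure0//; exact: etrans (lebesgueV_cube k z) (esym (mcube k z)).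
- move=> i; rewrite /g; case: unpickle => [z|]; last by rewrite measure0.
  apply: (@le_lt_trans _ _ ((2 ^+ 0)^-1 ^+ d)%:E); last exact: ltry.
  by rewrite -(lebesgueV_cube 0 z).
Qed.

(** The neighbourhoods of [C] of radius [1 / (n + 1)] decrease to [C], and a finite measure is
    continuous along decreasing sequences. *)
Lemma closed_regular d (m : {measure set (borelV d) -> \bar R}) (C : set 'rV[R]_d) (e : R) :
  (m setT < +oo)%E -> closed C -> 0 < e ->
  exists O : set 'rV[R]_d, [/\ open O, C `<=` O & (m (O `\` C) <= e%:E)%E].
Proof.
move=> mfin cC e0.
pose O n : set 'rV[R]_d := \bigcup_(y in C) ball y (n.+1%:R^-1).
have oO n : open (O n) by apply: bigcup_open => y _; apply: ball_open; rewrite invr_gt0.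
have CO n : C `<=` O n.
  by move=> y Cy; exists y => //; apply: ballxx; rewrite invr_gt0.
have OC : \bigcap_n (O n) `\` C = set0.
  rewrite -subset0 => x [Ox nCx].
  have [r r0 rC] := rV_open_ballP (closed_openC cC) nCx.
  have [n] := @near_infty_natSinv_lt R (PosNum r0).
  move=> _ /(_ n (leqnn _))/= nr; have [y Cy] := Ox n I.
  rewrite mx_norm_ball /ball_/= => yx; apply: (rC y) => //.
  by rewrite distrC; apply: lt_trans nr.
have mO n : measurable (O n `\` C : set (borelV d)).
  apply: measurableD; first exact: measurable_open.
  by rewrite -[X in measurable X]setCK; apply: measurableC; apply: measurable_open; exact: closed_openC.
have : (m (O n `\` C) @[n --> \oo] --> m (\bigcap_n (O n `\` C)))%E.
  apply: nonincreasing_cvg_mu => //.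
  - by apply: le_lt_trans mfin; apply: le_measure; rewrite ?inE.
  - exact: bigcapT_measurable.
  - move=> i j ij; apply/subsetPset; apply: setSD => x [y Cy yx]; exists y => //.
    by apply: le_ball yx; rewrite lef_pV2 ?posrE// ler_nat.
have -> : \bigcap_n (O n `\` C) = set0 by rewrite -OC; apply/seteqP; split=> [x h|x [h1 h2] n _]; split=> //; [move=> n _; exact: (h n I).1|exact: (h 0%N I).2|exact: h1].
rewrite measure0 => /fine_cvgP[mOfin] /cvgrPdist_lt/(_ e e0) cv.
near \oo => n.
exists (O n); split => //.
have fn : m (O n `\` C) \is a fin_num by near: n.
rewrite -(fineK fn) lee_fin.
have : `|0 - fine (m (O n `\` C))| < e by near: n.
by rewrite sub0r normrN => /ltW; apply: le_trans; exact: ler_norm.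
Unshelve. all: by end_near.
Qed.

(** The sets approximated from both sides, by a closed set inside and an open one outside, form a
    sigma-algebra; the two-sided form makes complements immediate. Open sets belong to it as
    complements of closed ones. *)
Lemma finite_measure_regular d (m : {measure set (borelV d) -> \bar R}) (T : set (borelV d)) :
  (m setT < +oo)%E -> measurable T -> forall e : R, 0 < e ->
  exists O C : set 'rV[R]_d, [/\ open O, closed C, C `<=` T, T `<=` O & (m (O `\` C) <= e%:E)%E].
Proof.
move=> mfin; have mC (C : set (borelV d)) : closed (C : set 'rV[R]_d) -> measurable C.
  move=> cC; rewrite -[X in measurable X]setCK; apply: measurableC; apply: measurable_open.
  exact: closed_openC.
have compl (S : set 'rV[R]_d) :
    (forall e : R, 0 < e -> exists O C : set 'rV[R]_d,
      [/\ open O, closed C, C `<=` S, S `<=` O & (m (O `\` C) <= e%:E)%E]) ->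
    (forall e : R, 0 < e -> exists O C : set 'rV[R]_d,
      [/\ open O, closed C, C `<=` ~` S, ~` S `<=` O & (m (O `\` C) <= e%:E)%E]).
  move=> h e /h[U [C [oO cC CS SO OC]]]; exists (~` C), (~` U); split.
  - exact: closed_openC.
  - exact: open_closedC.
  - exact: subsetC.
  - exact: subsetC.
  - by rewrite setDE setCK setIC -setDE.
apply: (@smallest_sub _ (sigma_algebra setT) _
  [set T | forall e : R, 0 < e -> exists O C : set 'rV[R]_d,
     [/\ open O, closed C, C `<=` T, T `<=` O & (m (O `\` C) <= e%:E)%E]]); last first.
  move=> U oU; rewrite -[U]setCK; apply: compl => e e0 /=.
  have [V [oO UO OU]] := closed_regular mfin (open_closedC oU) e0.
  by exists V, (~` U); split=> //; exact: open_closedC.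
split=> /=.
- move=> e e0; exists set0, set0; split=> //; last by rewrite setD0 measure0 lee_fin ltW.
  exact: (@closed0 'rV[R]_d).
- by move=> S hS; rewrite setTD; exact: compl.
- move=> F hF e e0.
  have e2 n : 0 < e / 2 / (2 ^ n.+1)%:R by rewrite !divr_gt0// ltr0n expn_gt0.
  have /choice[OC hOC] : forall n, exists OC : set 'rV[R]_d * set 'rV[R]_d,
      [/\ open OC.1, closed OC.2, OC.2 `<=` F n, F n `<=` OC.1 &
        (m (OC.1 `\` OC.2) <= (e / 2 / (2 ^ n.+1)%:R)%:E)%E].
    by move=> n; have [U [C h]] := hF n _ (e2 n); exists (U, C).
  pose C := \bigcup_n (OC n).2.
  (* A countable union of closed sets need not be closed, so only the first [N] are kept. The rest,
     [D N], decreases to the empty set and costs at most [e / 2]. *)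
  pose D N := C `\` \bigcup_(n in `I_N) (OC n).2.
  have mOC n : measurable ((OC n).2 : set (borelV d)) by apply: mC; have [] := hOC n.
  have mO n : measurable ((OC n).1 : set (borelV d)).
    by apply: measurable_open; have [] := hOC n.
  have mCC : measurable (C : set (borelV d)) by apply: bigcupT_measurable.
  have mCN N : measurable (\bigcup_(n in `I_N) (OC n).2 : set (borelV d)).
    by apply: bigcup_measurable => n _.
  have mD N : measurable (D N : set (borelV d)) by apply: measurableD.
  have D0 : \bigcap_N D N = set0.
    by rewrite -subset0 => x Dx; have [[n _ Cnx] _] := Dx 0%N I;
      have [_] := Dx n.+1 I; apply; exists n => /=.
  have : (m (D N) @[N --> \oo] --> m (\bigcap_N D N))%E.
    apply: nonincreasing_cvg_mu => //.
    - by apply: le_lt_trans mfin; apply: le_measure; rewrite ?inE.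
    - exact: bigcapT_measurable.
    - move=> i j ij; apply/subsetPset; apply: setDS => x [n /= ni Cx]; exists n => //=.
      exact: leq_trans ni ij.
  have e20 : 0 < e / 2 by rewrite divr_gt0.
  rewrite D0 measure0 => /fine_cvgP[mDfin] /cvgrPdist_lt/(_ _ e20) cv.
  near \oo => N.
  exists (\bigcup_n (OC n).1), (\bigcup_(n in `I_N) (OC n).2); split.
  + by apply: bigcup_open => n _; have [] := hOC n.
  + by apply: closed_bigcup => [|n _]; [exact: finite_II|have [] := hOC n].
  + by move=> x [n _ Cnx]; exists n => //; have [_ _ + _ _] := hOC n; exact.
  + by apply: subset_bigcup => n _; have [] := hOC n.
  + apply: (@le_trans _ _ (m ((\bigcup_n ((OC n).1 `\` (OC n).2)) `|` D N))%E).
      apply: le_measure; rewrite ?inE.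
      * by apply: measurableD => //; exact: bigcupT_measurable.
      * by apply: measurableU => //; apply: bigcupT_measurable => n; apply: measurableD.
      * move=> x [[n _ Ox] nCx]; have [Cx|nC] := pselect (C x); first by right; split.
        by left; exists n => //; split=> // Cn; apply: nC; exists n.
    apply: le_trans (measureU2 _ _ _) _ => //; first by apply: bigcupT_measurable => n; apply: measurableD.
    rewrite [e in (_ <= e%:E)%E](splitr e) EFinD; apply: leeD; last first.
      have fn : m (D N) \is a fin_num by near: N.
      apply: (@le_trans _ _ (fine (m (D N)))%:E); first by rewrite fineK.
      rewrite lee_fin; have : `|0 - fine (m (D N))| < e / 2 by near: N.
      by rewrite sub0r normrN => /ltW; apply: le_trans; exact: ler_norm.
    apply: le_trans (epsilon_trick0 xpredT (ltW e20)).
    have mOD n : measurable ((OC n).1 `\` (OC n).2 : set (borelV d)) by apply: measurableD.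
    apply: le_trans (measure_sigma_subadditive _ mOD _ (subset_refl _)) _ => //.
    * exact: bigcupT_measurable.
    * by apply: lee_nneseries => // n _; have [] := hOC n.
Unshelve. all: by end_near.
Qed.

(** The lower corner consists of the infima of the coordinates. The side [l'] exceeds the diameter
    [l] because the box is half-open. *)
Lemma small_set_box d (E : set 'rV[R]_d) (l l' : R) : 0 <= l -> l < l' ->
  (forall u v, E u -> E v -> `|u - v| <= l) ->
  exists B : set (borelV d), [/\ measurable B, E `<=` B & lebesgueV d B = (l' ^+ d)%:E].
Proof.
move=> l0 ll' El.
pose a i := inf [set u 0 i | u in E].
exists [set u : 'rV[R]_d | forall i, a i <= u 0 i < a i + l'].
split; first exact: measurable_box; last first.
  rewrite lebesgueV_box => [|i]; last by rewrite lerDl ltW// (le_lt_trans l0).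
  rewrite -[in RHS](card_ord d) -prodr_const; congr EFin; apply: eq_bigr => i _.
  by rewrite addrAC subrr add0r.
move=> u Eu /= i; have lbE : lbound [set v 0 i | v in E] (u 0 i - l).
  move=> _ [v Ev <-]; have := El u v Eu Ev.
  by move=> /(rV_norm_leP _ l0)/(_ i); rewrite !mxE ler_norml => /andP[_]; lra.
apply/andP; split; first by apply: ge_inf; [exists (u 0 i - l)|exists u].
have : u 0 i - l <= a i by apply: lb_le_inf => //; exists (u 0 i), u.
lra.
Qed.

(** At level [k] keep the cubes contained in [U]. The part of [T] sent into one of them has diameter
    at most [L * 2^-k], so it lies in a box of volume [L' ^+ d] times that of the cube. A point of
    [U] lies in a kept cube for all large [k]; hence the increasing sets [D j], of the points
    covered at every level from [j] on, have a union containing [T]. *)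
Lemma lebesgueV_expand_open d (T : set (borelV d)) (U : set 'rV[R]_d)
    (f : 'rV[R]_d -> 'rV[R]_d) (L L' : R) :
  measurable T -> open U -> 0 <= L -> L < L' ->
  (forall u, T u -> U (f u)) ->
  (forall u v, T u -> T v -> `|u - v| <= L * `|f u - f v|) ->
  (lebesgueV d T <= (L' ^+ d)%:E * lebesgueV d U)%E.
Proof.
move=> mT oU L0 LL' fU fL; have L'0 : 0 < L' by apply: le_lt_trans LL'.
pose c k n : set (borelV d) := if pickle_inv n is Some z then
  (if `[< cube k z `<=` U >] then cube k z else set0) else set0.
have mc k n : measurable (c k n).
  by rewrite /c; case: pickle_inv => // z; case: ifP => // _; exact: measurable_cube.
have cU k : \bigcup_n c k n `<=` U.
  move=> u [n _]; rewrite /c; case: pickle_inv => // z.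
  by case: ifPn => [/asboolP zU|//]; exact: zU.
have tc k : trivIset setT (c k).
  move=> i j _ _ [u []]; rewrite /c.
  case ni : (pickle_inv i) => [z|//]; case: ifPn => // _ uz.
  case nj : (pickle_inv j) => [w|//]; case: ifPn => // _ uw.
  have zw : z = w by rewrite -(uz : cube_index k u = z) (uw : cube_index k u = w).
  have := @pickle_invK 'rV[int]_d i; have := @pickle_invK 'rV[int]_d j.
  by rewrite ni nj zw /= => -> ->.
have bx k n : exists B : set (borelV d), [/\ measurable B,
    T `&` f @^-1` (c k n) `<=` B & (lebesgueV d B <= (L' ^+ d)%:E * lebesgueV d (c k n))%E].
  have [[z cz]|c0] : (exists z, c k n = cube k z) \/ c k n = set0.
    by rewrite /c; case: pickle_inv => [z|]; [case: ifPn => _; [left; exists z|right]|right].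
    have k0 : 0 < (2 ^+ k)^-1 :> R by rewrite invr_gt0 exprn_gt0.
    have [| | |B [mB EB lB]] := @small_set_box d (T `&` f @^-1` (c k n)) (L * (2 ^+ k)^-1) (L' * (2 ^+ k)^-1).
    - by rewrite mulr_ge0// ltW.
    - by rewrite ltr_pM2r.
    - move=> u v [Tu fu] [Tv fv]; apply: le_trans (fL _ _ Tu Tv) _.
      by apply: ler_wpM2l => //; rewrite /preimage/= cz in fu fv; exact: cube_dist fu fv.
    exists B; split => //; rewrite lB cz; rewrite (lebesgueV_cube k z).
    by rewrite -EFinM exprMn.
  exists set0; split => //; first by rewrite c0 preimage_set0 setI0.
  by rewrite measure0 mule_ge0// lee_fin exprn_ge0// ltW.
have /choice[b hb] : forall k, exists bk : nat -> set (borelV d), forall n,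
    [/\ measurable (bk n), T `&` f @^-1` (c k n) `<=` bk n &
      (lebesgueV d (bk n) <= (L' ^+ d)%:E * lebesgueV d (c k n))%E].
  by move=> k; have /choice[bk hbk] := bx k; exists bk.
have mb k n : measurable (b k n) by have [] := hb k n.
pose D j := \bigcap_(k in [set k | (j <= k)%N]) \bigcup_n b k n.
have mD j : measurable (D j).
  by apply: bigcap_measurable => [|k _]; [exists j => /=|exact: bigcupT_measurable].
have TD : T `<=` \bigcup_j D j.
  move=> u Tu; have [k0 hk] := open_cube oU (fU _ Tu).
  exists k0 => // k /= kk; exists (pickle (cube_index k (f u))) => //.
  have [_ + _] := hb k (pickle (cube_index k (f u))); apply; split => //=.
  by rewrite /c pickleK_inv; case: asboolP => // /(_ (hk _ kk)).
have lD j : (lebesgueV d (D j) <= (L' ^+ d)%:E * lebesgueV d U)%E.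
  apply: (@le_trans _ _ (lebesgueV d (\bigcup_n b j n))).
    apply: le_measure; rewrite ?inE//; first exact: bigcupT_measurable.
    by apply: bigcap_inf => /=.
  apply: le_trans (measure_sigma_subadditive _ (mb j) _ _) _.
  - exact: bigcupT_measurable.
  - exact: subset_refl.
  apply: (@le_trans _ _ (\sum_(n <oo) (L' ^+ d)%:E * lebesgueV d (c j n))%E).
    by apply: lee_nneseries => // n _; have [] := hb j n.
  rewrite nneseriesZl//.
  rewrite -measure_semi_bigcup//; last exact: bigcupT_measurable.
  apply: lee_wpmul2l; first by rewrite lee_fin exprn_ge0// ltW.
  apply: le_measure; rewrite ?inE//; first exact: bigcupT_measurable.
  exact: measurable_open.
apply: (@le_trans _ _ (lebesgueV d (\bigcup_j D j))).
  by apply: le_measure; rewrite ?inE//; exact: bigcupT_measurable.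
have ndD : nondecreasing_seq D.
  move=> i j ij; apply/subsetPset => u Du k /= jk; apply: Du => /=.
  exact: leq_trans jk.
have h : (lebesgueV d (D j) @[j --> \oo] --> lebesgueV d (\bigcup_j D j))%E.
  by apply: nondecreasing_cvg_mu => //; exact: bigcupT_measurable.
rewrite -(cvg_lim _ h)//; apply: lime_le; first exact: (cvgP _ h).
by apply: nearW.
Qed.

(** Outer regularity replaces [S] by an open set of almost the same measure. The bound on [S] serves
    to restrict Lebesgue measure to a ball, where it is finite. *)
Lemma lebesgueV_expand d (T S : set (borelV d)) (f : 'rV[R]_d -> 'rV[R]_d) (L L' : R) :
  measurable T -> measurable S -> 0 <= L -> L < L' ->
  (exists r, forall u : 'rV[R]_d, S u -> `|u| < r) ->
  (forall u, T u -> S (f u)) ->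
  (forall u v, T u -> T v -> `|u - v| <= L * `|f u - f v|) ->
  (lebesgueV d T <= (L' ^+ d)%:E * lebesgueV d S)%E.
Proof.
move=> mT mS L0 LL' [r Sr] fS fL; have L'0 : 0 < L' by apply: le_lt_trans LL'.
have r0 : 0 < `|r| + 1 by rewrite ltr_wpDl.
pose B : set 'rV[R]_d := ball 0 (`|r| + 1).
have SB : S `<=` B.
  move=> u /Sr ur; rewrite /B mx_norm_ball /ball_/= sub0r normrN; apply: lt_le_trans ur _.
  by rewrite (le_trans (ler_norm r))// lerDl.
have oB : open B by exact: ball_open.
have mB : measurable (B : set (borelV d)) by exact: measurable_open.
have Bfin : (lebesgueV d B < +oo)%E.
  apply: (@le_lt_trans _ _ (lebesgueV d [set u : 'rV[R]_d | forall i, - (`|r| + 1) <= u 0 i < `|r| + 1])).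
    apply: le_measure; rewrite ?inE//; first exact: (@measurable_box d (fun=> - (`|r| + 1)) (fun=> `|r| + 1)).
    move=> u; rewrite /B mx_norm_ball /ball_/= sub0r normrN => /(rV_norm_ltP _ r0) ur i.
    by have := ur i; rewrite ltr_norml => /andP[/ltW -> ->].
  rewrite (@lebesgueV_box d (fun=> - (`|r| + 1)) (fun=> `|r| + 1)) ?ltry// => _.
  by rewrite ge0_cp// ltW.
have mfin : (mrestr (lebesgueV d) mB setT < +oo)%E by rewrite /mrestr setTI.
apply/lee_addgt0Pr => e e0.
have e'0 : 0 < e / L' ^+ d by rewrite divr_gt0// exprn_gt0.
have [U [C [oU cC CS SU UC]]] := finite_measure_regular mfin mS e'0.
have oUB : open (U `&` B) by exact: openI.
apply: (@le_trans _ _ ((L' ^+ d)%:E * lebesgueV d (U `&` B))%E).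
  apply: (@lebesgueV_expand_open _ _ _ f L) => // u Tu; split; first exact: SU (fS _ Tu).
  exact: SB (fS _ Tu).
have -> : U `&` B = S `|` ((U `&` B) `\` S).
  by rewrite setDE setUIr setUv setIT; apply/esym/setUidPr => u Su; split; [exact: SU|exact: SB].
have -> : (e%:E = (L' ^+ d)%:E * (e / L' ^+ d)%:E)%E.
  by rewrite -EFinM mulrCA mulfV ?mulr1// gt_eqF// exprn_gt0.
rewrite -ge0_muleDr//; last by rewrite lee_fin ltW.
apply: lee_wpmul2l; first by rewrite lee_fin exprn_ge0// ltW.
have mUB : measurable ((U `&` B) `\` S : set (borelV d)).
  by apply: measurableD => //; exact: measurable_open.
apply: le_trans (measureU2 _ _ _) _ => //; apply: leeD => //.
apply: le_trans UC; apply: le_measure; rewrite ?inE//.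
  apply: measurableI => //; apply: measurableD; first exact: measurable_open.
  rewrite -[X in measurable X]setCK; apply: measurableC; apply: measurable_open; exact: closed_openC.
by move=> u [[Uu Bu] nSu]; split=> //; split=> // /CS.
Qed.

End DyadicCubes.

(** * Linear changes of variables *)

Section LinearChange.
Context {R : realType}.
Local Notation lebV := (@lebesgueV R).

Lemma measurable_continuous d d' (f : 'rV[R]_d -> 'rV[R]_d') :
  continuous f -> measurable_fun setT (f : borelV d -> borelV d').
Proof.
move=> cf; apply: (@measurability _ _ _ _ _ _ (@open 'rV[R]_d' : set (set (borelV d')))) => //.
move=> _ [U oU <-]; rewrite setTI; apply: measurable_open.
by apply: open_comp => // u _; exact: cf.
Qed.

Lemma measurable_preimage_continuous d d' (f : 'rV[R]_d -> 'rV[R]_d') (T : set (borelV d')) :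
  continuous f -> measurable T -> measurable (f @^-1` T : set (borelV d)).
Proof.
by move=> cf mT; rewrite -[X in measurable X]setTI; exact: (measurable_continuous cf).
Qed.

Lemma rV_continuousP (T : topologicalType) d (f : T -> 'rV[R]_d) (x : T) :
  (forall j, {for x, continuous (fun y => f y 0 j)}) -> {for x, continuous f}.
Proof.
move=> cf; apply/cvgrPdist_lt => e e0.
have : \forall y \near x, forall j, `|f x 0 j - f y 0 j| < e.
  by apply: filter_forall => j; have /cvgrPdist_lt/(_ e e0) := cf j.
by apply: filterS => y fy; apply/rV_norm_ltP => // j; rewrite !mxE.
Qed.

Lemma mulmx_continuous d d' (A : 'M[R]_(d, d')) : continuous (fun u : 'rV[R]_d => u *m A).
Proof.
move=> u; apply: rV_continuousP => j.
have -> : (fun v : 'rV[R]_d => (v *m A) 0 j) = (fun v => \sum_(i < d) v 0 i * A i j).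
  by apply/funext => v; rewrite mxE.
move: u; apply: continuous_big => [|i _ u]; first exact: add_continuous.
by apply: continuousM; [exact: coord_continuous|exact: cst_continuous].
Qed.

Lemma lebesgueV_prod d (J : 'I_d -> set R) (l : 'I_d -> R) :
  (forall i, measurable (J i)) -> (forall i, lebesgue_measure (J i) = (l i)%:E) ->
  lebV d [set u : 'rV[R]_d | forall i, J i (u 0 i)] = (\prod_(i < d) l i)%:E.
Proof.
move=> mJ Jl; rewrite lebesgueVE ?(lebesgue_int_prod mJ Jl)//.
rewrite (_ : mkset _ = \bigcap_(i in [set: 'I_d]) ((fun u : borelV d => u 0 i : R) @^-1` J i)).
  apply: fin_bigcap_measurable => // i _; rewrite -[X in measurable X]setTI.
  exact: measurable_coord.
by apply/seteqP; split=> u /= uz i => [_|]; have := uz i; rewrite /=; apply.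
Qed.

Lemma lebesgueV_pushforward d (f : 'rV[R]_d -> 'rV[R]_d) (c : R) : 0 < c ->
  continuous f ->
  (forall k z, lebV d (f @^-1` cube k z) = (c^-1 * (2 ^+ k)^-1 ^+ d)%:E) ->
  forall T : set (borelV d), measurable T -> (c%:E * lebV d (f @^-1` T) = lebV d T)%E.
Proof.
move=> c0 cf fcube T mT.
have mf := measurable_continuous cf.
pose m : {measure set (borelV d) -> \bar R} := mscale (NngNum (ltW c0))
  (measure_function_pushforward__canonical__measure_function_Measure (lebV d) mf).
rewrite -[LHS]/(m T); apply/esym/lebesgueV_unique => // k z.
rewrite /m /= /mscale /= /pushforward fcube -EFinM mulrA mulfV ?mul1r//.
by rewrite gt_eqF.
Qed.

Lemma lebesgueV_translate d (w : 'rV[R]_d) (T : set (borelV d)) : measurable T ->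
  lebV d [set u : 'rV[R]_d | T (u + w)] = lebV d T.
Proof.
move=> mT; rewrite -[LHS]mul1e.
apply: (@lebesgueV_pushforward d (fun u => u + w) 1 _ _ _ T) => //.
  by move=> u; apply: continuousD; [exact: cvg_id|exact: cst_continuous].
move=> k z; have -> : (fun u => u + w) @^-1` cube k z =
    [set u : 'rV[R]_d | forall i, (z 0 i)%:~R / 2 ^+ k - w 0 i <= u 0 i < (z 0 i + 1)%:~R / 2 ^+ k - w 0 i].
  by rewrite cubeE; apply/seteqP; split=> u /= h i; have := h i; rewrite !mxE lerBlDr ltrBrDr.
rewrite lebesgueV_box => [|i]; last first.
  by rewrite lerB// ler_pM2r ?invr_gt0 ?exprn_gt0// ler_int lerDl.
rewrite invr1 mul1r -[in RHS](card_ord d) -prodr_const; congr EFin; apply: eq_bigr => i _.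
by rewrite opprB addrA subrK -mulrBl -intrB addrAC subrr add0r mul1r.
Qed.

(** Stated with the preimage of [T], measurable by continuity alone, and with the determinant as a
    factor, which makes the property multiplicative in [A]. *)
Definition scales_volume d (A : 'M[R]_d) := forall T : set (borelV d), measurable T ->
  (`|\det A|%:E * lebV d [set u : 'rV[R]_d | T (u *m A)] = lebV d T)%E.

Lemma scales_volumeM d (A B : 'M[R]_d) :
  scales_volume A -> scales_volume B -> scales_volume (A *m B).
Proof.
move=> hA hB T mT; have := hA [set u | T (u *m B)].
rewrite -(hB _ mT) => <-; last first.
  by apply: measurable_preimage_continuous mT; exact: mulmx_continuous.
rewrite det_mulmx normrM [X in X%:E]mulrC EFinM -muleA; congr (_ * (_ * lebV d _))%E.
by apply/seteqP; split=> u /=; rewrite mulmxA.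
Qed.

(** The preimage of a cube is a product of intervals of length [2^-k / |a i|]. A negative entry
    exchanges the closed and the open end, so these products are not all half-open boxes of the same
    kind and [lebesgueV_prod] is used. *)
Lemma scales_volume_diag d (a : 'rV[R]_d) : (forall i, a 0 i != 0) -> scales_volume (diag_mx a).
Proof.
move=> a0 T mT; apply: lebesgueV_pushforward mT.
- by rewrite normr_gt0 det_diag; apply/prodf_neq0 => i _.
- exact: mulmx_continuous.
move=> k z; set s := fun i => (z 0 i)%:~R / 2 ^+ k : R; set t := fun i => (z 0 i + 1)%:~R / 2 ^+ k : R.
have st i : t i - s i = (2 ^+ k)^-1 by rewrite /t /s -mulrBl -intrB addrAC subrr add0r mul1r.
have k0 : 0 < (2 ^+ k)^-1 :> R by rewrite invr_gt0 exprn_gt0.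
have -> : (fun u : 'rV[R]_d => u *m diag_mx a) @^-1` cube k z =
    [set u : 'rV[R]_d | forall i, [set x | s i <= x * a 0 i < t i] (u 0 i)].
  by rewrite cubeE; apply/seteqP; split=> u /= h i; have := h i; rewrite mul_mx_diag mxE.
have key i : lebesgue_measure [set x | s i <= x * a 0 i < t i] = ((2 ^+ k)^-1 / `|a 0 i|)%:E.
  have := a0 i; rewrite neq_lt => /orP[an|ap].
    have -> : [set x | s i <= x * a 0 i < t i] = `]t i / a 0 i, s i / a 0 i]%classic.
      by apply/seteqP; split=> x /=; rewrite in_itv/= ltr_ndivrMr// ler_ndivlMr// andbC.
    rewrite lebesgue_measure_itv/= lte_fin ltr_ndivlMr// divfK ?lt_eqF//.
    rewrite -subr_gt0 st k0 -EFinB -mulrBl ltr0_norm// invrN mulrN -mulNr.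
    by rewrite -(st i) opprB.
  have -> : [set x | s i <= x * a 0 i < t i] = `[s i / a 0 i, t i / a 0 i[%classic.
    by apply/seteqP; split=> x /=; rewrite in_itv/= (ler_pdivrMr _ _ ap) (ltr_pdivlMr _ _ ap).
  rewrite lebesgue_measure_itv/= lte_fin ltr_pM2r ?invr_gt0//.
  by rewrite -subr_gt0 st k0 -EFinB -mulrBl gtr0_norm// st.
rewrite (lebesgueV_prod _ key) => [|i]; last first.
  rewrite -[X in measurable X]setTI.
  have := @measurable_funM _ _ R setT id (cst (a 0 i)) (@measurable_id _ _ _) (measurable_cst _).
  move=> /(_ measurableT `[s i, t i[%classic (measurable_itv _)).
  by congr measurable; apply/seteqP; split=> x /= []; rewrite in_itv.
rewrite big_split/= prodr_const card_ord mulrC; congr (_ * _)%:E.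
by rewrite det_diag -normfV -prodfV normr_prod; apply: eq_bigr => i _; rewrite normfV.
Qed.

Lemma mulmx_permE d (s : 'S_d) (u : 'rV[R]_d) i : (u *m perm_mx s) 0 i = u 0 (s^-1%g i).
Proof. by rewrite -[s in LHS]invgK -col_permE mxE. Qed.

Lemma scales_volume_perm d (s : 'S_d) : scales_volume (perm_mx s).
Proof.
move=> T mT; apply: lebesgueV_pushforward mT.
- by rewrite det_perm normr_sign.
- exact: mulmx_continuous.
move=> k z; rewrite det_perm normr_sign invr1 mul1r.
have -> : (fun u : 'rV[R]_d => u *m perm_mx s) @^-1` cube k z = cube k (\row_i z 0 (s i)).
  rewrite !cubeE; apply/seteqP; split=> u /= h i.
    by have := h (s i); rewrite mulmx_permE permK mxE.
  by have := h (s^-1%g i); rewrite mulmx_permE mxE permKV.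
exact: lebesgueV_cube.
Qed.

Lemma measurable_slice_set d (S : set (borelV d.+1)) (x : R) : measurable S ->
  measurable ([set v | S (row_mx (x%:M : 'rV[R]_1) v : 'rV_d.+1)] : set (borelV d)).
Proof.
move=> mS.
have := @measurable_xsection _ _ _ _ ((fun p : R * borelV d => row_mx (p.1%:M : 'rV_1) p.2 : borelV d.+1) @^-1` S) x.
rewrite xsectionE; apply.
by rewrite -[X in measurable X]setTI; exact: measurable_rowmx.
Qed.

Lemma lebesgueV_slice d (S : set (borelV d.+1)) : measurable S ->
  lebV d.+1 S = (\int[lebesgue_measure]_x lebV d [set v | S (row_mx (x%:M : 'rV[R]_1) v : 'rV_d.+1)])%E.
Proof.
move=> mS; rewrite lebesgueVE//=; apply: eq_integral => x _; rewrite lebesgueVE//.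
exact: measurable_slice_set.
Qed.

Lemma measurable_slice d (S : set (borelV d.+1)) : measurable S ->
  measurable_fun setT (fun x : R => lebV d [set v | S (row_mx (x%:M : 'rV[R]_1) v : 'rV_d.+1)]).
Proof.
move=> mS; pose P := (fun p : R * borelV d => row_mx (p.1%:M : 'rV_1) p.2 : borelV d.+1) @^-1` S.
have mP : measurable P by rewrite -[X in measurable X]setTI; exact: measurable_rowmx.
have := @measurable_fun_xsection _ _ _ (borelV d) _ (lebV d) P mP.
by congr measurable_fun; apply/funext => x /=; rewrite xsectionE.
Qed.

Lemma row_mx_mul_block d x (v r : 'rV[R]_d) (U : 'M[R]_d) :
  (row_mx (x%:M : 'rV[R]_1) v : 'rV[R]_(d.+1)) *m (block_mx (1%:M : 'M[R]_1) r 0 U : 'M[R]_(d.+1))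
  = row_mx (x%:M : 'rV[R]_1) (x *: r + v *m U) :> 'rV[R]_(d.+1).
Proof.
apply: (etrans (@mul_row_block R 1 1 d 1 d _ _ _ _ _ _)).
by rewrite mulmx1 mulmx0 addr0 mul_scalar_mx.
Qed.

(** Slice along the first coordinate: over [x] the shear is the translation by [x *: r]. *)
Lemma scales_volume_shear d (r : 'rV[R]_d) :
  scales_volume (block_mx (1%:M : 'M[R]_1) r 0 1%:M : 'M[R]_(d.+1)).
Proof.
move=> T mT.
have mT' : measurable ([set u | T (u *m (block_mx (1%:M : 'M[R]_1) r 0 1%:M : 'M[R]_(d.+1)))] : set (borelV d.+1)).
  by apply: measurable_preimage_continuous mT; exact: mulmx_continuous.
rewrite (@det_ublock _ 1 d) !det1 mulr1 normr1 mul1e !lebesgueV_slice//; apply: eq_integral => x _.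
have mTx := measurable_slice_set x mT.
rewrite -(lebesgueV_translate (x *: r) mTx); congr (lebV d _); apply/seteqP.
by split=> v /=; rewrite row_mx_mul_block mulmx1 addrC.
Qed.

Lemma scales_volume_block d (U : 'M[R]_d) : scales_volume U ->
  scales_volume (block_mx (1%:M : 'M[R]_1) 0 0 U : 'M[R]_(d.+1)).
Proof.
move=> hU T mT.
have mT' : measurable ([set u | T (u *m (block_mx (1%:M : 'M[R]_1) 0 0 U : 'M[R]_(d.+1)))] : set (borelV d.+1)).
  by apply: measurable_preimage_continuous mT; exact: mulmx_continuous.
rewrite (@det_ublock _ 1 d) det1 mul1r !lebesgueV_slice//.
rewrite -ge0_integralZl//; last exact: measurable_slice.
apply: eq_integral => x _.
have mTx := measurable_slice_set x mT.
rewrite -[RHS]hU//; congr (_ * _)%E; congr (lebV d _); apply/seteqP.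
by split=> v /=; rewrite row_mx_mul_block scaler0 add0r.
Qed.

(** Splits off the first row: a diagonal matrix carries the pivot, a block matrix the remaining
    minor, and a shear the rest of the row. *)
Lemma scales_volume_upper d (U : 'M[R]_d) : (forall i j : 'I_d, (j < i)%N -> U i j = 0) ->
  (forall i, U i i != 0) -> scales_volume U.
Proof.
elim: d U => [|d IH] U Ulow Udiag.
  move=> T mT; rewrite det_mx00 normr1 mul1e; congr (lebV 0 _).
  by apply/seteqP; split=> u /=; rewrite (_ : u *m U = u)//; apply/rowP => -[].
pose a := U ord0 ord0; have a0 : a != 0 by exact: Udiag.
pose r : 'rV[R]_d := @ursubmx _ 1 d 1 d U; pose V : 'M[R]_d := @drsubmx _ 1 d 1 d U.
have Ue : U = block_mx (a%:M : 'M[R]_1) r 0 V.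
  rewrite -[LHS](@submxK _ 1 d 1 d); congr (@block_mx _ 1 d 1 d); apply/matrixP => i j.
    by rewrite !mxE !ord1 mulr1n /a; congr (U _ _); exact/val_inj.
  by rewrite !mxE Ulow// ord1.
have -> : U = diag_mx (row_mx (a%:M : 'rV[R]_1) (const_mx 1) : 'rV_d.+1) *m
   ((block_mx (1%:M : 'M[R]_1) 0 0 V : 'M[R]_(d.+1)) *m (block_mx (1%:M : 'M[R]_1) (a^-1 *: r) 0 1%:M : 'M[R]_(d.+1))).
  rewrite (@mulmx_block _ 1 d 1 d 1 d) !mulmx1 !mul1mx !mulmx0 !mul0mx !addr0 add0r.
  have -> : diag_mx (row_mx (a%:M : 'rV[R]_1) (const_mx 1) : 'rV_d.+1) = block_mx (a%:M : 'M[R]_1) 0 0 1%:M.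
    apply: (etrans (@diag_mx_row R d 1 (a%:M) (const_mx 1))).
    by rewrite diag_const_mx; congr (@block_mx _ 1 d 1 d); apply/matrixP => i j; rewrite !mxE !ord1.
  rewrite (@mulmx_block _ 1 d 1 d 1 d) !mulmx0 !mul0mx !addr0 !add0r mulmx1 mul1mx Ue.
  by rewrite mul_scalar_mx scalerA mulfV// scale1r.
apply: scales_volumeM.
  apply: scales_volume_diag => i; case: (unliftP ord0 i) => [j|] ->.
    by rewrite row_mx_lift mxE oner_eq0.
  by rewrite row_mx_ord0.
apply: scales_volumeM; last exact: scales_volume_shear.
apply: scales_volume_block; apply: IH => [i j ji|i].
  by rewrite !mxE Ulow.
by rewrite !mxE Udiag.
Qed.

(** Conjugation by the order-reversing permutation exchanges lower and upper triangular matrices. *)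
Lemma scales_volume_lower d (L : 'M[R]_d) : (forall i j : 'I_d, (i < j)%N -> L i j = 0) ->
  (forall i, L i i != 0) -> scales_volume L.
Proof.
move=> Lup Ldiag; pose s : 'S_d := perm (@rev_ord_inj d).
have sV : (s^-1)%g = s.
  by apply/permP => i; apply: (@perm_inj _ s); rewrite permKV !permE rev_ordK.
have -> : L = perm_mx s *m (row_perm s (col_perm s L)) *m perm_mx s.
  by rewrite -[s in _ *m perm_mx s]sV -row_permE -col_permE; apply/matrixP => i j; rewrite !mxE !permE !rev_ordK.
apply: scales_volumeM; last exact: scales_volume_perm.
apply: scales_volumeM; first exact: scales_volume_perm.
apply: scales_volume_upper => [i j ji|i]; rewrite !mxE; last exact: Ldiag.
by apply: Lup; rewrite !permE /=; have := ltn_ord i; lia.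
Qed.

(** LUP decomposition: [L] has a unit diagonal, and invertibility makes the diagonal of [U]
    nonzero. *)
Theorem unitmx_scales_volume d (A : 'M[R]_d) : A \in unitmx -> scales_volume A.
Proof.
case: d A => [|d] A uA.
  by apply: scales_volume_upper => -[].
have := cormen_lup_correct A; have := cormen_lup_perm A; have := cormen_lup_detL A.
have := cormen_lup_lower A; have := cormen_lup_upper A.
case: cormen_lup => [[P L] U] /= Uup Llow detL /is_perm_mxP[s ->] PA.
have AE : A = perm_mx (s^-1)%g *m (L *m U).
  have <- : perm_mx s *m A = L *m U by exact: PA.
  by rewrite mulmxA -perm_mxM mulVg perm_mx1 mul1mx.
have detU : \det U = \prod_i U i i.
  rewrite -det_tr det_trig; first by apply: eq_bigr => i _; rewrite mxE.
  by apply/is_trig_mxP => i j ij; rewrite mxE Uup.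
have U0 i : U i i != 0.
  move: uA; rewrite unitmxE AE !det_mulmx detL mul1r detU unitfE mulf_eq0 negb_or => /andP[_ /prodf_neq0].
  exact.
rewrite AE; apply: scales_volumeM; first exact: scales_volume_perm.
apply: scales_volumeM; last exact: scales_volume_upper.
apply: scales_volume_lower => [i j ij|i]; rewrite Llow//; last by rewrite eqxx oner_eq0.
  by rewrite (_ : (i == j) = false)//; apply/eqP => ijE; rewrite ijE ltnn in ij.
by rewrite ltnW.
Qed.

End LinearChange.

(** * The area inequality *)

Section StrictDifferentiability.
Context {R : realType}.

Lemma is_derive_line (V W : normedModType R) (f : V -> W) (v w : V) (t : R) :
  derivable f (v + t *: w) w ->
  is_derive t (1 : R) (fun s : R => f (v + s *: w)) ('D_w f (v + t *: w)).
Proof.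
move=> df.
have E : (fun h : R => h^-1 *: (f (v + (h *: (1 : R) + t) *: w) - f (v + t *: w))) =
         (fun h : R => h^-1 *: (f (h *: w + (v + t *: w)) - f (v + t *: w))).
  by apply/funext => h; congr (_ *: (f _ - _)); rewrite scalerDl [h%:A]mulr1 addrCA.
apply: DeriveDef; last by rewrite /derive /= /shift/= E.
by rewrite /derivable /shift/= E.
Qed.

Lemma mulmx_norm_le d d' (A : 'M[R]_(d, d')) : exists2 C, 0 < C &
  forall u : 'rV[R]_d, `|u *m A| <= C * `|u|.
Proof.
exists (\sum_(i < d) \sum_(j < d') `|A i j| + 1).
  by rewrite ltr_wpDl// sumr_ge0// => i _; rewrite sumr_ge0.
move=> u; apply/rV_norm_leP => [|j]; first by rewrite mulr_ge0// addr_ge0// sumr_ge0// => i _; rewrite sumr_ge0.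
rewrite mxE; apply: le_trans (ler_norm_sum _ _ _) _.
rewrite mulrDl mul1r ler_wpDr// mulr_suml; apply: ler_sum => i _.
rewrite normrM mulrC ler_pM//; last exact: rV_coord_le.
by rewrite (bigD1 j)//= lerDl sumr_ge0.
Qed.

Lemma continuous_at_sum (T : topologicalType) (I : Type) (r : seq I) (P : pred I) (F : I -> T -> R) x :
  (forall i, P i -> {for x, continuous (F i)}) ->
  {for x, continuous (fun y => \sum_(i <- r | P i) F i y)}.
Proof.
move=> cF; apply: (@cvg_big _ _ _ _ _ _ _ (nbhs x)) => //.
exact: add_continuous.
Qed.

Lemma continuous_at_prod (T : topologicalType) (I : Type) (r : seq I) (P : pred I) (F : I -> T -> R) x :
  (forall i, P i -> {for x, continuous (F i)}) ->
  {for x, continuous (fun y => \prod_(i <- r | P i) F i y)}.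
Proof.
move=> cF; apply: (@cvg_big _ _ _ _ _ _ _ (nbhs x)) => //.
exact: mul_continuous.
Qed.

Lemma continuous_det (T : topologicalType) d (M : T -> 'M[R]_d) x :
  (forall i j, {for x, continuous (fun y => M y i j)}) ->
  {for x, continuous (fun y => \det (M y))}.
Proof.
move=> cM; apply: continuous_at_sum => s _; apply: continuousM; first exact: cst_continuous.
by apply: continuous_at_prod => i _.
Qed.

Lemma jacobian_row d q (f : 'rV[R]_d -> 'rV[R]_q) u i j : differentiable f u ->
  'J f u i j = 'D_(delta_mx 0 i) f u 0 j.
Proof. by move=> df; rewrite deriveEjacobian// -(rowE i ('J f u)) [RHS]mxE. Qed.

Lemma continuous_near_eq (T U : topologicalType) (f g : T -> U) (x : T) :
  (\forall y \near x, f y = g y) -> {for x, continuous f} -> {for x, continuous g}.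
Proof.
move=> fg cf; rewrite /prop_for /continuous_at -(nbhs_singleton fg) => A /cf; rewrite !nbhs_simpl.
by apply: filterS2 fg => y /= ->.
Qed.

Lemma continuous_coord_comp (T : topologicalType) d q (f : T -> 'M[R]_(d, q)) (x : T) i j :
  {for x, continuous f} -> {for x, continuous (fun y => f y i j)}.
Proof.
by move=> cf; exact: (@continuous_comp _ _ _ f (fun M => M i j) x cf (@coord_continuous _ _ _ i j (f x))).
Qed.

Lemma Ck1_continuous_jacobian d q (U : set 'rV[R]_d) (f : 'rV[R]_d -> 'rV[R]_q) u i j :
  open U -> Ck 1 U f -> U u -> {for u, continuous (fun v => 'J f v i j)}.
Proof.
move=> oU [df cf] Uu.
apply: (@continuous_near_eq _ _ (fun v => 'D_(delta_mx 0 i) f v 0 j)).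
  by near=> v; rewrite jacobian_row//; apply: df; near: v; exact: open_nbhs_nbhs.
by apply: continuous_coord_comp; exact: cf.
Unshelve. all: by end_near.
Qed.

Lemma derive_coord d q (V : normedModType R) (f : V -> 'M[R]_(d, q)) (u w : V) i j :
  derivable f u w -> derivable (fun v => f v i j) u w /\ 'D_w (fun v => f v i j) u = ('D_w f u) i j.
Proof.
move=> /derivable_mxP df; split; first exact: (df i j).
by rewrite derive_mx ?mxE//; apply/derivable_mxP.
Qed.

Lemma mulmx_subE d q (A B : 'M[R]_(d, q)) (a b : 'rV[R]_q) w j :
  a 0 j - b 0 j = (w *m A) 0 j -> (a - b - w *m B) 0 j = (w *m (A - B)) 0 j.
Proof. by move=> ab; rewrite mulmxBr !mxE ab !mxE. Qed.

Lemma mulmx_sub_le d q (A B : 'M[R]_(d, q)) (e : R) (w : 'rV[R]_d) j :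
  (forall i j, `|A i j - B i j| <= e) -> `|(w *m (B - A)) 0 j| <= d%:R * e * `|w|.
Proof.
move=> AB; rewrite mxE; apply: le_trans (ler_norm_sum _ _ _) _.
apply: (@le_trans _ _ (\sum_(i < d) `|w| * e)).
  apply: ler_sum => i _; rewrite normrM ler_pM//; first exact: rV_coord_le.
  by rewrite !mxE distrC.
by rewrite sumr_const card_ord -[_ *+ d]mulr_natl [`|w| * e]mulrC mulrA.
Qed.

(** Mean value theorem along the segment from [v] to [u], one coordinate of [f] at a time. Near [u0]
    the partial derivatives vary by less than [e / (d + 1)], and [d] of them are summed. *)
Lemma strict_differentiability d q (U : set 'rV[R]_d) (f : 'rV[R]_d -> 'rV[R]_q) u0 e :
  open U -> Ck 1 U f -> U u0 -> 0 < e ->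
  exists2 r, 0 < r & (forall u, `|u0 - u| < r -> U u) /\
    (forall u v, `|u0 - u| < r -> `|u0 - v| < r ->
      `|f u - f v - (u - v) *m 'J f u0| <= e * `|u - v|).
Proof.
move=> oU Cf Uu0 e0; have [df _] := Cf.
pose e1 := e / (d.+1)%:R; have e10 : 0 < e1 by rewrite divr_gt0.
have : \forall v \near u0, U v /\ forall i j, `|'J f u0 i j - 'J f v i j| < e1.
  apply: filterI; first exact: open_nbhs_nbhs.
  have : \forall v \near u0, forall i, forall j, `|'J f u0 i j - 'J f v i j| < e1; last by [].
  apply: (@filter_forall _ 'I_d (fun i v => forall j, `|'J f u0 i j - 'J f v i j| < e1) (nbhs u0)) => i.
  apply: (@filter_forall _ 'I_q (fun j v => `|'J f u0 i j - 'J f v i j| < e1) (nbhs u0)) => j.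
  by have /cvgrPdist_lt/(_ e1 e10) := @Ck1_continuous_jacobian d q U f u0 i j oU Cf Uu0.
move=> /nbhs_ballP[r r0 rU]; exists r => //.
have {}rU v : `|u0 - v| < r -> U v /\ forall i j, `|'J f u0 i j - 'J f v i j| < e1.
  by move=> vr; apply: rU; rewrite mx_norm_ball.
split=> [u /rU[]//|u v ur vr].
have [w Ew] : exists w, w = u - v by exists (u - v).
rewrite -Ew; have seg t : 0 <= t <= 1 -> `|u0 - (v + t *: w)| < r.
  move=> /andP[t0 t1].
  have -> : u0 - (v + t *: w) = (1 - t) *: (u0 - v) + t *: (u0 - u).
    by rewrite Ew; apply/rowP => k; rewrite !mxE; ring.
  apply: le_lt_trans (ler_normD _ _) _; rewrite !normrZ !ger0_norm ?subr_ge0//.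
  have [->|tn0] := eqVneq t 0; first by rewrite subr0 mul1r mul0r addr0.
  have tp : 0 < t by rewrite lt_def tn0.
  have h1 : (1 - t) * `|u0 - v| <= (1 - t) * r by rewrite ler_wpM2l ?subr_ge0// ltW.
  have h2 : t * `|u0 - u| < t * r by rewrite ltr_pM2l.
  by lra.
apply/rV_norm_leP => [|j]; first by rewrite mulr_ge0// ltW.
pose phi (t : R) := f (v + t *: w) 0 j.
have dphi (t : R) : 0 <= t <= 1 -> is_derive t (1 : R) phi (('D_w f (v + t *: w)) 0 j).
  move=> /seg/rU[Ut _].
  have dfw : derivable f (v + t *: w) w by apply: diff_derivable; exact: df.
  have [dl El] := is_derive_line dfw.
  have [dc Ec] := derive_coord 0 j dl.
  by have := derivableP dc; rewrite Ec El.
have [| |t t01 phi10] := @MVT_segment R phi (fun t => ('D_w f (v + t *: w)) 0 j) 0 1 ler01.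
- by move=> t; rewrite in_itv/= => /andP[t0 t1]; apply: dphi; rewrite !ltW.
- apply: derivable_within_continuous => t; rewrite in_itv/= => t01.
  by have [] := dphi t t01.
have t01' : 0 <= t <= 1 by move: t01; rewrite in_itv.
have [Ut Jt] := rU _ (seg _ t01').
have E : f u 0 j - f v 0 j = (w *m 'J f (v + t *: w)) 0 j.
  rewrite -(deriveEjacobian _ (df _ Ut)); move: phi10; rewrite /phi subr0 mulr1 scale1r scale0r addr0 => <-.
  by congr (f _ 0 j - _); rewrite Ew addrC subrK.
rewrite (mulmx_subE _ E); apply: le_trans (mulmx_sub_le w j (fun i j => ltW (Jt i j))) _.
by rewrite ler_wpM2r// /e1 mulrA ler_pdivrMr// mulrC ler_pM2l// ler_nat.
Qed.

(** Followed by the inverse of ['J f u0], the map [f] becomes [g], which differs from the identity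
    by a map of Lipschitz constant [e]. On the ball its inverse is then Lipschitz with constant
    [1 / (1 - e)], and [lebesgueV_expand] applies; [unitmx_scales_volume] puts the linear factor
    back. *)
Lemma area_local d (U : set 'rV[R]_d) (f : 'rV[R]_d -> 'rV[R]_d) u0 (K : R) :
  open U -> Ck 1 U f -> U u0 -> 'J f u0 \in unitmx -> 1 < K ->
  exists2 r, 0 < r & (forall u, `|u0 - u| < r -> U u /\ `|\det ('J f u)| <= K * `|\det ('J f u0)|) /\
    (forall (T S : set (borelV d)), measurable T -> measurable S ->
      (forall u, T u -> `|u0 - u| < r) -> S = f @` T ->
      (`|\det ('J f u0)|%:E * lebesgueV d T <= K%:E * lebesgueV d S)%E).
Proof.
move=> oU Cf Uu0 uJ K1; set A := 'J f u0.
have detA : 0 < `|\det A| by rewrite normr_gt0 -unitfE -unitmxE.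
have [C C0 hC] := mulmx_norm_le (invmx A).
have [C' C'0 hC'] := mulmx_norm_le A.
(* [(1 - e)^-1] is the Lipschitz constant of the inverse; the added [e] provides the strict
   inequality [L < L'] that [lebesgueV_expand] requires. *)
have [e /andP[e0 e1] eK] : exists2 e : R, 0 < e < 1 & ((1 - e)^-1 + e) ^+ d <= K.
  have cphi : {for (0 : R), continuous (fun e : R => ((1 - e)^-1 + e) ^+ d)}.
    apply: (@continuous_comp _ _ _ (fun e : R => (1 - e)^-1 + e) (fun x : R => x ^+ d)); last exact: exprn_continuous.
    apply: continuousD; last exact: cvg_id.
    apply: continuousV; first by rewrite subr0 oner_eq0.
    by apply: continuousB; [exact: cst_continuous|exact: cvg_id].
  have : \forall e \near (0 : R), ((1 - e)^-1 + e) ^+ d < K.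
    by apply: (cvgr_lt _ cphi); rewrite subr0 invr1 addr0 expr1n.
  move=> /nbhs_ballP[r r0 rK]; exists (Num.min (r / 2) (1 / 2)).
    by rewrite lt_min gt_min !divr_gt0//= orbC ltr_pdivrMr// mul1r ltr1n.
  apply: ltW; apply: rK; rewrite /ball/= sub0r normrN ger0_norm.
    by rewrite gt_min ltr_pdivrMr// ltr_pMr ?ltr1n.
  by rewrite le_min !divr_ge0// ltW.
have e'0 : 0 < e / C by rewrite divr_gt0.
have [r1 r10 [rU rf]] := strict_differentiability oU Cf Uu0 e'0.
have : \forall v \near u0, `|\det ('J f v)| < K * `|\det A|.
  have cd : {for u0, continuous (fun v => `|\det ('J f v)|)}.
    apply: (@continuous_comp _ _ _ (fun v => \det ('J f v)) (fun x => `|x|) u0); last exact: norm_continuous.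
    by apply: continuous_det => i j; exact: Ck1_continuous_jacobian Uu0.
  by apply: (cvgr_lt _ cd); rewrite ltr_pMl.
move=> /nbhs_ballP[r2 r20 rdet].
have r0 : 0 < Num.min r1 r2 by rewrite lt_min r10.
exists (Num.min r1 r2) => //; split.
  move=> u; rewrite lt_min => /andP[ur1 ur2]; split; first exact: rU.
  by apply: ltW; apply: rdet; rewrite mx_norm_ball.
move=> T S mT mS Tr SE.
pose g u := f u *m invmx A.
pose S' : set (borelV d) := [set u | S (u *m A)].
have mS' : measurable S' by apply: measurable_preimage_continuous mS; exact: mulmx_continuous.
rewrite -(unitmx_scales_volume uJ mS) muleCA.
apply: lee_wpmul2l; first by rewrite lee_fin.
apply: (@le_trans _ _ ((((1 - e)^-1 + e) ^+ d)%:E * lebesgueV d S')%E); last first.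
  by apply: lee_wpmul2r; rewrite ?measure_ge0// lee_fin.
have ie0 : 0 < (1 - e)^-1 by rewrite invr_gt0 subr_gt0.
have key0 u v : `|u0 - u| < r1 -> `|u0 - v| < r1 -> `|g u - g v - (u - v)| <= e * `|u - v|.
  move=> ur1 vr1.
  have -> : g u - g v - (u - v) = (f u - f v - (u - v) *m A) *m invmx A.
    by rewrite /g !mulmxBl !mulmxK.
  apply: le_trans (hC _) _; have := rf u v ur1 vr1.
  by rewrite -(ler_pM2l C0) => /le_trans; apply; rewrite mulrA [C * _]mulrC divfK// gt_eqF.
have key u v : T u -> T v -> `|u - v| <= (1 - e)^-1 * `|g u - g v|.
  move=> /Tr; rewrite lt_min => /andP[ur1 _] /Tr; rewrite lt_min => /andP[vr1 _].
  rewrite ler_pdivlMl ?subr_gt0//.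
  have h2 := key0 u v ur1 vr1.
  have := ler_distD (g u - g v) (u - v) 0; rewrite !subr0 distrC => h3.
  by rewrite mulrBl mul1r lerBlDr (le_trans h3)// addrC lerD2l.
apply: (@lebesgueV_expand _ _ _ _ g (1 - e)^-1) => //.
- exact: ltW.
- by rewrite ltrDl.
- exists (`|g u0| + (1 + e) * r1) => w /=.
  rewrite /S' /= SE => -[u Tu fuw].
  have -> : w = g u by rewrite /g fuw mulmxK.
  have := Tr _ Tu; rewrite lt_min => /andP[ur1 _].
  have h1 := key0 u u0 ur1; rewrite subrr normr0 in h1; have {}h1 := h1 r10.
  have h2 := ler_distD (u - u0) (g u - g u0) 0; rewrite !subr0 in h2.
  have h3 := ler_distD (g u0) (g u) 0; rewrite !subr0 in h3.
  apply: le_lt_trans h3 _; rewrite addrC ltrD2l; apply: le_lt_trans h2 _.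
  apply: (@le_lt_trans _ _ ((1 + e) * `|u - u0|)).
    by rewrite mulrDl mul1r addrC lerD2l.
  by rewrite ltr_pM2l ?addr_gt0// distrC.
- by move=> u Tu; rewrite /S'/= /g mulmxKV// SE; exists u.
Qed.

(* [T] is cut into countably many pieces, each in a dyadic cube on which [area_local] applies. *)
Theorem area_inequality d (U : set 'rV[R]_d) (f : 'rV[R]_d -> 'rV[R]_d) (T : set (@borelV R d))
    (F : 'rV[R]_d -> R) (c K : R) :
  open U -> Ck 1 U f -> measurable T -> T `<=` U -> 0 <= c -> 1 < K ->
  (forall u, T u -> 'J f u \in unitmx) ->
  (forall T' : set (@borelV R d), measurable T' -> T' `<=` T -> measurable (f @` T' : set (@borelV R d))) ->
  (forall u v, T u -> T v -> f u = f v -> u = v) ->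
  (forall u, T u -> 0 <= F u <= c * `|\det ('J f u)|) ->
  (lebesgue_int (fun u => (\1_T u * F u)%:E) <= (c * K)%:E * lebesgueV d (f @` T))%E.
Proof.
move=> oU Cf mT TU c0 K1 uJ mf injf Fc.
(* A factor [K'] is lost twice: the determinant varies over a cube, and the image of the cube is
   compared with that of its linear model. *)
have [K' K'1 K'K] : exists2 K' : R, 1 < K' & K' * K' = K.
  exists (Num.sqrt K); last by rewrite -expr2 sqr_sqrtr// ltW// (lt_trans ltr01).
  by rewrite -sqrtr1 ltr_sqrt// (lt_trans ltr01).
have K'0 : 0 < K' by apply: lt_trans K'1.
have loc u : T u -> exists2 r, 0 < r & (forall v, `|u - v| < r -> U v /\ `|\det ('J f v)| <= K' * `|\det ('J f u)|) /\
    (forall (T S : set (@borelV R d)), measurable T -> measurable S ->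
      (forall v, T v -> `|u - v| < r) -> S = f @` T ->
      (`|\det ('J f u)|%:E * lebesgueV d T <= K'%:E * lebesgueV d S)%E).
  by move=> Tu; apply: area_local (TU _ Tu) (uJ _ Tu) K'1.
(* [D] stands for [|\det ('J f u)|] at some point [u], but the property mentions only the set [C].
   It can thus be tested on each of the countably many cubes, and those that fail are replaced by
   the empty set. *)
pose good (C : set 'rV[R]_d) (D : R) := 0 <= D /\ (forall v, T v -> C v -> `|\det ('J f v)| <= K' * D) /\
    (forall (T' S : set (@borelV R d)), measurable T' -> measurable S -> T' `<=` T -> T' `<=` C ->
      S = f @` T' -> (D%:E * lebesgueV d T' <= K'%:E * lebesgueV d S)%E).
pose cub n : set (@borelV R d) := if pickle_inv n is Some (k, z) then
  (if `[< exists D, good (@cube R d k z) D >] then @cube R d k z else set0) else set0.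
have mc n : measurable (cub n).
  by rewrite /cub; case: pickle_inv => // -[k z]; case: ifP => // _; exact: measurable_cube.
have gc n : exists D, good (cub n) D.
  have g0 : exists D, good set0 D.
    exists 0; split=> //; split=> [//|T' S mT' mS _ T'0 SE]; rewrite mul0e mule_ge0// lee_fin.
    exact: ltW.
  by rewrite /cub; case: pickle_inv => // -[k z]; case: ifPn => // /asboolP.
have /choice[D hD] := gc.
have Tc : T `<=` \bigcup_n cub n.
  move=> u Tu; have [r r0 [rU rT]] := loc u Tu.
  have [k kr] : exists k, cube k (cube_index k u) `<=` ball u r.
    have oB : open (ball u r) by exact: ball_open.
    have Bu : ball u r u by exact: ballxx.
    by have [k hk] := open_cube oB Bu; exists k; exact: hk.
  have {}kr v : cube k (cube_index k u) v -> `|u - v| < r by move=> /kr; rewrite mx_norm_ball.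
  exists (pickle (k, cube_index k u)) => //; rewrite /cub pickleK_inv.
  case: asboolP => // -[]; exists `|\det ('J f u)|; split=> //; split=> [v Tv /kr/rU[]//|].
  by move=> T' S mT' mS _ T'C SE; apply: rT => // v /T'C/kr.
pose Tn n := T `&` seqDU cub n.
have mTn n : measurable (Tn n) by apply: measurableI => //; apply: measurableD => //; exact: bigsetU_measurable.
have tTn : trivIset setT Tn by apply: trivIset_setIl; exact: trivIset_seqDU.
have TE : T = \bigcup_n Tn n.
  rewrite /Tn -setI_bigcupr -seqDU_bigcup_eq; apply/seteqP; split=> u; last by case.
  by move=> Tu; split=> //; exact: Tc.
have Tnc n : Tn n `<=` cub n by move=> u [_ [Cu _]].
have TnT n : Tn n `<=` T by move=> u [].
have D0 n : 0 <= D n by have [] := hD n.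
pose G u := (\sum_(n <oo) (c * K' * D n)%:E * (\1_(Tn n) u)%:E)%E.
have cD0 n : 0 <= c * K' * D n by rewrite !mulr_ge0// ltW.
have mG n : measurable_fun setT (fun u : @borelV R d => (c * K' * D n)%:E * (\1_(Tn n) u)%:E)%E.
  by apply: measurable_funeM; apply: measurableT_comp => //; exact: measurable_indic.
have G0 n u : (0 <= (c * K' * D n)%:E * (\1_(Tn n) u)%:E)%E by rewrite mule_ge0// lee_fin.
apply: (@le_trans _ _ (lebesgue_int G)).
  apply: lebesgue_int_le => u.
    rewrite lee_fin indicE; case: (boolP (u \in T)) => [/set_mem Tu|_]; last by rewrite mul0r.
    by have /andP[] := Fc u Tu; rewrite mul1r.
  rewrite indicE; case: (boolP (u \in T)) => [/set_mem Tu|_]; last first.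
    by rewrite mul0r; apply: nneseries_ge0.
  rewrite mul1r; have := Tu; rewrite {1}TE => -[n _ Tnu].
  apply: (@le_trans _ _ ((c * K' * D n)%:E * (\1_(Tn n) u)%:E)%E).
    rewrite indicE mem_set// mule1 lee_fin; have /andP[_ /le_trans] := Fc u Tu; apply.
    rewrite -mulrA ler_wpM2l//; have [_ [+ _]] := hD n; apply => //; exact: Tnc.
  apply: (@le_trans _ _ (\sum_(0 <= i < n.+1) (c * K' * D i)%:E * (\1_(Tn i) u)%:E)%E).
    by rewrite big_nat_recr//= leeDr// sume_ge0.
  exact: nneseries_lim_ge.
rewrite (@lebesgue_intE R d G); last 2 first.
- by apply: ge0_emeasurable_sum => // n u _ _; exact: G0.
- by move=> u; apply: nneseries_ge0 => n _ _; exact: G0.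
rewrite integral_nneseries//.
have mfTn n : measurable (f @` Tn n : set (@borelV R d)) by exact: mf.
have fTE : f @` T = \bigcup_n (f @` Tn n) by rewrite {1}TE image_bigcup.
have tfT : trivIset setT (fun n => f @` Tn n).
  move=> i j _ _ [v [[u Tiu <-] [w Tjw fw]]].
  have uw : w = u by apply: injf => //; [exact: TnT Tjw|exact: TnT Tiu].
  by apply: tTn => //; exists u; split=> //; rewrite -uw.
rewrite fTE measure_semi_bigcup//; last exact: bigcupT_measurable.
have cK0 : 0 <= c * K by rewrite mulr_ge0// ltW// (lt_trans ltr01).
rewrite -nneseriesZl//.
apply: lee_nneseries => [n _ _|n _]; first by apply: integral_ge0 => u _; exact: G0.
rewrite ge0_integralZl//; last 2 first.
- by apply: measurableT_comp => //; exact: measurable_indic.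
- by rewrite lee_fin.
rewrite integral_indic// setIT -K'K mulrA !EFinM -!muleA.
apply: lee_wpmul2l; first by rewrite lee_fin.
apply: lee_wpmul2l; first by rewrite lee_fin ltW.
have [_ [_ ]] := hD n; apply => //; exact: Tnc.
Qed.
End StrictDifferentiability.

(** * Smooth functions *)

Section CkCalculus.
Context {R : realType}.

Lemma mx_continuousP (T : topologicalType) p q (f : T -> 'M[R]_(p, q)) (x : T) :
  (forall i j, {for x, continuous (fun y => f y i j)}) -> {for x, continuous f}.
Proof.
move=> cf; apply/cvgrPdist_lt => e e0.
have : \forall y \near x, forall i, forall j, `|f x i j - f y i j| < e.
  apply: (@filter_forall _ 'I_p (fun i y => forall j, `|f x i j - f y i j| < e) (nbhs x)) => i.
  apply: (@filter_forall _ 'I_q (fun j y => `|f x i j - f y i j| < e) (nbhs x)) => j.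
  by have /cvgrPdist_lt/(_ e e0) := cf i j.
apply: filterS => y fy; rewrite [Num.norm _](_ : _ = mx_norm (f x - f y))// mx_normrE.
by apply/bigmax_ltP; split=> // -[i j] _ /=; rewrite !mxE.
Qed.

Lemma near_eq_differentiable (V W : normedModType R) (f g : V -> W) (x : V) :
  (\forall y \near x, f y = g y) -> differentiable f x -> differentiable g x.
Proof.
move=> fg /diff_locallyP[cdf fE].
have gE : g \o shift x = cst (g x) + 'd f x +o_ 0 id.
  apply/eqaddoP => e e0; move/eqaddoP: fE => /(_ e e0).
  have : \forall h \near 0, f (h + x) = g (h + x).
    move: fg; rewrite (near_shift 0) /=; apply: filterS => h /=.
    by rewrite subr0.
  apply: filterS2 => h /= fgh; rewrite /= !fctE /= /shift /= fgh.
  by rewrite (nbhs_singleton fg).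
by apply/diff_locallyP; rewrite (diff_unique cdf gE).
Qed.

Lemma Ck_ext (V W : normedModType R) k (U : set V) (f g : V -> W) :
  open U -> (forall x, U x -> f x = g x) -> Ck k U f -> Ck k U g.
Proof.
move=> oU; have near_fg (f' g' : V -> W) x : (forall x, U x -> f' x = g' x) -> U x ->
    \forall y \near x, f' y = g' y.
  by move=> h Ux; near=> y; apply: h; near: y; exact: open_nbhs_nbhs.
elim: k f g => [|k IH] f g fg /= Cf.
  by move=> x Ux; apply: continuous_near_eq (near_fg _ _ _ fg Ux) (Cf _ Ux).
case: Cf => df Cf; split=> [x Ux|v].
  exact: near_eq_differentiable (near_fg _ _ _ fg Ux) (df _ Ux).
apply: IH (Cf v) => x Ux; apply: near_eq_derive; exact: near_fg.
Unshelve. all: by end_near.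
Qed.

Lemma CkS (V W : normedModType R) k (U : set V) (f : V -> W) : Ck k.+1 U f -> Ck k U f.
Proof.
elim: k f => [|k IH] f [df Cf] /=; first by move=> x /df; exact: differentiable_continuous.
by split=> // v; apply: IH.
Qed.

Lemma Ck_subset (V W : normedModType R) k (U U' : set V) (f : V -> W) :
  U' `<=` U -> Ck k U f -> Ck k U' f.
Proof.
move=> UU; elim: k f => [|k IH] f /=; first by move=> h x /UU; exact: h.
by move=> [df Cf]; split=> [x /UU/df//|v]; exact: IH.
Qed.

(** [Ck] speaks of the derivatives of a total function at the points of a set, so one point at a
    time can be checked, each with its own neighbourhood and its own chart. *)
Lemma Ck_pointwise (V W : normedModType R) k (U : set V) (f : V -> W) :
  (forall x, U x -> Ck k [set x] f) -> Ck k U f.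
Proof.
elim: k f => [|k IH] f /= h; first by move=> x Ux; exact: (h x Ux).
by split=> [x Ux|v]; [have [+ _] := h x Ux; exact|apply: IH => x Ux; have [] := h x Ux].
Qed.

Lemma Ck_cst (V W : normedModType R) k (U : set V) (a : W) : Ck k U (fun _ : V => a).
Proof.
elim: k a => [|k IH] a /=; first by move=> x _; exact: cst_continuous.
split=> [x _|v]; first exact: differentiable_cst.
have -> : (fun x : V => 'D_v (fun _ : V => a) x) = (fun _ => 0) by apply/funext => x; exact: derive_cst.
exact: IH.
Qed.

Lemma Ck_linear (V W : normedModType R) k (U : set V) (f : {linear V -> W}) :
  continuous f -> Ck k U f.
Proof.
move=> cf; case: k => [|k] /=; first by move=> x _; exact: cf.
split=> [x _|v]; first exact: linear_differentiable.
have -> : (fun x : V => 'D_v f x) = (fun _ => f v).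
  by apply/funext => x; rewrite deriveE ?diff_lin//; exact: linear_differentiable.
exact: Ck_cst.
Qed.

Lemma CkD (V W : normedModType R) k (U : set V) (f g : V -> W) : open U ->
  Ck k U f -> Ck k U g -> Ck k U (fun x => f x + g x).
Proof.
move=> oU; elim: k f g => [|k IH] f g /=.
  by move=> cf cg x Ux; apply: continuousD; [exact: cf|exact: cg].
move=> [df Cf] [dg Cg]; split=> [x Ux|v]; first by apply: differentiableD; [exact: df|exact: dg].
apply: (Ck_ext oU _ (IH _ _ (Cf v) (Cg v))) => x Ux; apply/esym/deriveD; apply: diff_derivable.
  exact: df.
exact: dg.
Qed.

Lemma Ck_sum (V W : normedModType R) k (U : set V) (I : Type) (r : seq I) (P : pred I) (F : I -> V -> W) :
  open U -> (forall i, P i -> Ck k U (F i)) -> Ck k U (fun x => \sum_(i <- r | P i) F i x).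
Proof.
move=> oU CF; elim: r => [|i r IH].
  have -> : (fun x => \sum_(i <- [::] | P i) F i x) = (fun _ => 0) by apply/funext => x; rewrite big_nil.
  exact: Ck_cst.
have -> : (fun x => \sum_(i0 <- i :: r | P i0) F i0 x) =
   (fun x => (if P i then F i x else 0) + \sum_(i <- r | P i) F i x).
  by apply/funext => x; rewrite big_cons; case: ifP; rewrite ?add0r.
apply: CkD => //; case: (boolP (P i)) => Pi; [exact: CF|exact: Ck_cst].
Qed.

Lemma CkM (V : normedModType R) k (U : set V) (f g : V -> R) : open U ->
  Ck k U f -> Ck k U g -> Ck k U (fun x => f x * g x).
Proof.
move=> oU; elim: k f g => [|k IH] f g.
  by move=> cf cg x Ux; apply: continuousM; [exact: cf|exact: cg].
move=> Cf Cg; have [df Cdf] := Cf; have [dg Cdg] := Cg.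
split=> [x Ux|v]; first by apply: differentiableM; [exact: df|exact: dg].
have C1 := IH _ _ (CkS Cf) (Cdg v); have C2 := IH _ _ (CkS Cg) (Cdf v).
apply: (Ck_ext oU _ (CkD oU C1 C2)) => x Ux.
have := @deriveM _ _ f g x v (diff_derivable (df _ Ux)) (diff_derivable (dg _ Ux)).
by move=> ->.
Qed.

Lemma Ck_prod (V : normedModType R) k (U : set V) (I : Type) (r : seq I) (P : pred I) (F : I -> V -> R) :
  open U -> (forall i, P i -> Ck k U (F i)) -> Ck k U (fun x => \prod_(i <- r | P i) F i x).
Proof.
move=> oU CF; elim: r => [|i r IH].
  have -> : (fun x => \prod_(i <- [::] | P i) F i x) = (fun _ => 1) by apply/funext => x; rewrite big_nil.
  exact: Ck_cst.
have -> : (fun x => \prod_(i0 <- i :: r | P i0) F i0 x) =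
   (fun x => (if P i then F i x else 1) * \prod_(i <- r | P i) F i x).
  by apply/funext => x; rewrite big_cons; case: ifP; rewrite ?mul1r.
apply: CkM => //; case: (boolP (P i)) => Pi; [exact: CF|exact: Ck_cst].
Qed.

Lemma differentiable_mx (V : normedModType R) p q (f : V -> 'M[R]_(p, q)) x :
  (forall i j, differentiable (fun y => f y i j) x) -> differentiable f x.
Proof.
move=> df.
have -> : f = (\sum_(i < p) (\sum_(j < q) (fun y => f y i j *: delta_mx i j))).
  by apply/funext => y; rewrite [LHS]matrix_sum_delta fct_sumE; apply: eq_bigr => i _; rewrite fct_sumE.
apply: differentiable_sum => i; apply: differentiable_sum => j.
exact: differentiableZl.
Qed.

Lemma Ck_mxP (V : normedModType R) k (U : set V) p q (f : V -> 'M[R]_(p, q)) : open U ->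
  Ck k U f <-> (forall i j, Ck k U (fun x => f x i j)).
Proof.
move=> oU; elim: k f => [|k IH] f /=.
  split=> [cf i j x Ux|cf x Ux]; first exact: continuous_coord_comp (cf _ Ux).
  by apply: mx_continuousP => i j; exact: cf.
split=> [[df Cf] i j|Cf].
  split=> [x Ux|v].
    apply: (@differentiable_comp _ _ _ _ f (fun M : 'M[R]_(p, q) => M i j)) (df _ Ux) _.
    exact: differentiable_coord.
  have /IH/(_ i j) := Cf v; apply: Ck_ext => // x Ux.
  by have [_ ->] := derive_coord i j (diff_derivable (v := v) (df _ Ux)).
have df x : U x -> differentiable f x.
  by move=> Ux; apply: differentiable_mx => i j; have [+ _] := Cf i j; exact.
split=> // v; apply/IH => i j; have [_ /(_ v)] := Cf i j; apply: Ck_ext => // x Ux.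
by have [_ ->] := derive_coord i j (diff_derivable (v := v) (df _ Ux)).
Qed.

(** Induction through the chain rule: a directional derivative of [g \o f] is a sum of products of
    derivatives of [f] with partial derivatives of [g] composed with [f], to which the induction
    hypothesis applies. *)
Lemma Ck_comp (V : normedModType R) k (U : set V) d (U' : set 'rV[R]_d) (f : V -> 'rV[R]_d)
    (g : 'rV[R]_d -> R) : open U -> (forall x, U x -> U' (f x)) ->
  Ck k U f -> Ck k U' g -> Ck k U (g \o f).
Proof.
move=> oU UU'; elim: k g => [|k IH] g Cf Cg.
  by move=> x Ux; apply: continuous_comp; [exact: Cf|apply: Cg; exact: UU'].
have [df Cdf] := Cf; have [dg Cdg] := Cg.
split=> [x Ux|v]; first by apply: differentiable_comp; [exact: df|apply: dg; exact: UU'].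
apply: (@Ck_ext _ _ _ _ (fun x => \sum_(j < d) ('D_v f x) 0 j * 'D_(delta_mx 0 j) g (f x))) => // [x Ux|].
  have dgx : differentiable g (f x) by apply: dg; exact: UU'.
  have dgf : differentiable (g \o f) x by apply: differentiable_comp => //; exact: df.
  rewrite [RHS]deriveE// diff_comp//=; last exact: df.
  have -> : 'D_v f x = 'd f x v by rewrite deriveE//; exact: df.
  rewrite [in RHS](row_sum_delta ('d f x v)) linear_sum/=; apply: eq_bigr => j _.
  by rewrite linearZ/= deriveE.
apply: Ck_sum => // j _; apply: CkM => //.
  by have /(Ck_mxP _ _ oU) := Cdf v; apply.
exact: (IH (fun y => 'D_(delta_mx 0 j) g y) (CkS Cf) (Cdg _)).
Qed.

Lemma Ck_comp_mx (V : normedModType R) k (U : set V) d p q (U' : set 'rV[R]_d) (f : V -> 'rV[R]_d)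
    (g : 'rV[R]_d -> 'M[R]_(p, q)) : open U -> open U' -> (forall x, U x -> U' (f x)) ->
  Ck k U f -> Ck k U' g -> Ck k U (g \o f).
Proof.
move=> oU oU' UU' Cf Cg; apply/Ck_mxP => // i j.
apply: (Ck_comp oU UU' Cf (g := fun u => g u i j)).
by move/(Ck_mxP _ _ oU') : Cg; apply.
Qed.

Lemma Ck_comp1 (V : normedModType R) k (U : set V) (f : V -> R) (g : R -> R) : open U ->
  Ck k U f -> Ck k setT g -> Ck k U (g \o f).
Proof.
move=> oU; elim: k g => [|k IH] g Cf Cg.
  by move=> x Ux; apply: continuous_comp; [exact: Cf|exact: Cg].
have [df Cdf] := Cf; have [dg Cdg] := Cg.
split=> [x Ux|v]; first by apply: differentiable_comp; [exact: df|exact: dg].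
apply: (@Ck_ext _ _ _ _ (fun x => 'D_v f x * 'D_1 g (f x))) => // [x Ux|].
  have dgx : differentiable g (f x) by exact: dg.
  have dgf : differentiable (g \o f) x by apply: differentiable_comp => //; exact: df.
  rewrite [RHS]deriveE// diff_comp//=; last exact: df.
  have -> : 'D_v f x = 'd f x v by rewrite deriveE//; exact: df.
  rewrite -[X in 'd g (f x) X]mulr1 -[_ * 1]/('d f x v *: (1 : R)) linearZ/=.
  by rewrite deriveE.
apply: CkM => //; first exact: Cdf.
exact: (IH (fun y => 'D_1 g y) (CkS Cf) (Cdg 1)).
Qed.

Lemma Ck_id (V : normedModType R) k (U : set V) : Ck k U (id : V -> V).
Proof. by apply: (@Ck_linear V V k U idfun) => x; exact: cvg_id. Qed.

Lemma Ck_coord k d (U : set 'rV[R]_d) i : open U -> Ck k U (fun u : 'rV[R]_d => u 0 i).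
Proof. by move=> oU; have /(Ck_mxP k (@id 'rV[R]_d) oU) := Ck_id k U; apply. Qed.

Lemma Ck_partial d q (U : set 'rV[R]_d) (f : 'rV[R]_d -> 'rV[R]_q) k i j :
  open U -> Ck k.+1 U f -> Ck k U (fun u => 'J f u i j).
Proof.
move=> oU [df Cf]; have /(Ck_mxP _ _ oU)/(_ 0 j) := Cf (delta_mx 0 i).
by apply: Ck_ext => // u Uu; rewrite jacobian_row//; exact: df.
Qed.

End CkCalculus.

(** * A smooth bump function *)

Section FlatFunction.
Context {R : realType}.

(** [flat 0] is the classical [exp (- 1 / x)]. The powers of [1 / x] make the family closed under
    differentiation up to linear combinations, so that smoothness is a plain induction. *)
Definition flat (n : nat) (x : R) : R := if 0 < x then x^-1 ^+ n * expR (- x^-1) else 0.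

(** From the term of order [n + 2] of the series of [exp (1 / x)]. Being quadratic, the bound makes
    the derivative at [0] vanish. *)
Lemma flat_le n x : 0 < x -> flat n x <= (n.+2)`!%:R * x ^+ 2.
Proof.
move=> x0; rewrite /flat x0.
have xi0 : 0 < x^-1 by rewrite invr_gt0.
have h := expR_ge1Dxn n.+1 (ltW xi0).
set F := (n.+2)`!%:R in h *; have f0 : 0 < F by rewrite ltr0n fact_gt0.
have {}h : x^-1 ^+ n.+2 / F <= expR (x^-1) by rewrite (le_trans _ h)// lerDr.
rewrite expRN ler_pdivrMr ?expR_gt0//.
have -> : x^-1 ^+ n = F * x ^+ 2 * (x^-1 ^+ n.+2 / F).
  rewrite -[n.+2]addn2 exprD; set z := _ ^+ n; field.
  by rewrite !gt_eqF.
by rewrite ler_pM2l// mulr_gt0// exprn_gt0.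
Qed.

Lemma flat_ge0 n x : 0 <= flat n x.
Proof. by rewrite /flat; case: ifPn => // x0; rewrite mulr_ge0 ?expR_ge0// exprn_ge0// invr_ge0 ltW. Qed.

Lemma is_derive_flat n x :
  is_derive x (1 : R) (flat n) (flat n.+2 x - n%:R * flat n.+1 x).
Proof.
have [x0|x0|->] := ltgtP x 0.
- have fl0 k (y : R) : y < 0 -> flat k y = 0 by move=> y0; rewrite /flat ltNge ltW.
  rewrite !fl0// mulr0 subr0.
  apply: (@near_eq_is_derive _ _ _ (cst (0 : R))).
    by near=> y; rewrite fl0//; near: y; exact: lt_nbhsl.
- have flE k (y : R) : 0 < y -> flat k y = y^-1 ^+ k * expR (- y^-1) by move=> y0; rewrite /flat y0.
  rewrite !flE//.
  pose inv (y : R) := y^-1.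
  have invX k y : (inv ^+ k) y = y^-1 ^+ k.
    by elim: k => [|k IH]; rewrite ?expr0// !exprS -IH.
  apply: (@near_eq_is_derive R _ _ (inv ^+ n * (expR \o - inv))).
    near=> y; rewrite flE; first by rewrite -invX.
    by near: y; exact: lt_nbhsr.
  have xn0 : x != 0 by rewrite gt_eqF.
  have dV : is_derive x (1 : R) inv (- x ^- 2 *: 1) by exact: is_deriveV.
  have dE := is_derive1_comp (is_derive_expR _) (is_deriveN dV).
  apply: (is_derive_eq (is_deriveM (is_deriveX n dV) dE)).
  rewrite invX /= /inv /GRing.scale/= !mulr1 -!exprVn.
  by case: n {flE} => [|n]; rewrite ?exprS ?expr0 /=; ring.
- have fl0 k : flat k 0 = 0 by rewrite /flat ltxx.
  rewrite !fl0 mulr0 subr0.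
  pose F : R := (n.+2)`!%:R; have F0 : 0 < F by rewrite ltr0n fact_gt0.
  have flF h : `|flat n h| <= F * h ^+ 2.
    rewrite ger0_norm ?flat_ge0//; have [h0|h0] := ltP 0 h; first exact: flat_le.
    by rewrite /flat ltNge h0/= mulr_ge0 ?sqr_ge0// ltW.
  have cv : (fun h : R => h^-1 *: (flat n (h *: (1 : R) + 0) - flat n 0)) @ 0^' --> (0 : R).
    apply/cvgrPdist_le => e e0; near=> h.
    have hn0 : h != 0 by near: h; exact: nbhs_dnbhs_neq.
    rewrite sub0r normrN fl0 subr0 addr0 [h *: 1]mulr1 normrM normfV ler_pdivrMl ?normr_gt0//.
    apply: le_trans (flF h) _.
    have hF : `|h| < e / F by near: h; apply: nbhs_dnbhs; apply/nbhs_ballP; exists (e / F);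
      [rewrite /= divr_gt0|move=> z; rewrite /ball/= sub0r normrN].
    rewrite -(real_normK (num_real h)) expr2 mulrCA ler_wpM2l//.
    by rewrite mulrC -ler_pdivlMr// ltW.
  apply: DeriveDef; first exact: cvgP cv.
  exact: cvg_lim cv.
Unshelve. all: by end_near.
Qed.

Lemma Ck_flat k n : Ck k setT (flat n).
Proof.
elim: k n => [|k IH] n.
  move=> x _; apply: differentiable_continuous; apply/derivable1_diffP.
  by have [] := is_derive_flat n x.
split=> [x _|v]; first by apply/derivable1_diffP; have [] := is_derive_flat n x.
apply: (@Ck_ext _ _ _ _ _ (fun x => v * (flat n.+2 x + (- n%:R) * flat n.+1 x))).
- exact: openT.
- move=> x _; rewrite mulNr; have [dx <-] := is_derive_flat n x.
  rewrite !deriveE; [|by apply/derivable1_diffP..].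
  by rewrite -[X in _ = 'd _ _ X]mulr1 -[_ * 1]/(v *: (1 : R)) linearZ.
- apply: CkM; [exact: openT|exact: Ck_cst|].
  apply: CkD; [exact: openT|exact: IH|].
  by apply: CkM; [exact: openT|exact: Ck_cst|exact: IH].
Qed.

Lemma flat_le1 x y : x <= y -> flat 0 x <= flat 0 y.
Proof.
move=> xy; rewrite {1}/flat; case: ifPn => x0; last exact: flat_ge0.
have y0 : 0 < y by apply: lt_le_trans xy.
by rewrite /flat y0 !expr0 !mul1r ler_expR lerN2 lef_pV2.
Qed.

Lemma flat_gt0 x : 0 < x -> 0 < flat 0 x.
Proof. by move=> x0; rewrite /flat x0 expr0 mul1r expR_gt0. Qed.

(** A product over the coordinates: it is positive exactly on the open unit ball of the sup norm,
    which is the norm of ['rV[R]_d]. *)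
Definition bump_fun {d} (u : 'rV[R]_d) : R := \prod_(i < d) flat 0 (1 - u 0 i ^+ 2).

Lemma bump_ge0 d (u : 'rV[R]_d) : 0 <= bump_fun u.
Proof. by apply: prodr_ge0 => i _; exact: flat_ge0. Qed.

Lemma bump_gt0 d (u : 'rV[R]_d) : `|u| < 1 -> 0 < bump_fun u.
Proof.
move=> /(rV_norm_ltP _ ltr01) u1; apply: prodr_gt0 => i _; apply: flat_gt0.
by rewrite subr_gt0 -real_normK ?num_real// expr_lt1// u1.
Qed.

Lemma bump_eq0 d (u : 'rV[R]_d) : 1 <= `|u| -> bump_fun u = 0.
Proof.
move=> u1; have [i ui] : exists i, 1 <= `|u 0 i|.
  apply: contrapT => h; move: u1; rewrite leNgt => /negP; apply.
  by apply/rV_norm_ltP => // i; rewrite ltNge; apply/negP => ui; apply: h; exists i.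
rewrite /bump_fun (bigD1 i)//= /flat ltNge subr_le0 -[u 0 i ^+ 2]real_normK ?num_real// exprn_ege1//=.
by rewrite mul0r.
Qed.

Lemma bump_half d (u : 'rV[R]_d) : `|u| <= 1 / 2 -> flat 0 (3 / 4) ^+ d <= bump_fun u.
Proof.
move=> /(rV_norm_leP _ _) u1; rewrite -[in X in X <= _](card_ord d) -prodr_const.
apply: ler_prod => i _; rewrite flat_ge0/=; apply: flat_le1.
have := u1 ltac:(by rewrite divr_ge0) i => ui.
have : `|u 0 i| ^+ 2 <= (1 / 2) ^+ 2 by rewrite ler_pXn2r// nnegrE// divr_ge0.
by rewrite real_normK ?num_real// => h; lra.
Qed.

Lemma bump_le d (u : 'rV[R]_d) : bump_fun u <= bump_fun (0 : 'rV[R]_d).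
Proof.
apply: ler_prod => i _; rewrite flat_ge0/=; apply: flat_le1.
by rewrite mxE expr0n/= subr0 gerBl sqr_ge0.
Qed.

Lemma Ck_bump k d : Ck k setT (@bump_fun d).
Proof.
apply: Ck_prod => [|i _]; first exact: openT.
have -> : (fun u : 'rV[R]_d => flat 0 (1 - u 0 i ^+ 2)) =
    flat 0 \o (fun u => 1 + (- 1) * (u 0 i * u 0 i)).
  by apply/funext => u /=; rewrite mulN1r.
apply: Ck_comp1; [exact: openT| |exact: Ck_flat].
have oT : open [set: 'rV[R]_d] by exact: openT.
apply: CkD => //; first exact: Ck_cst.
apply: CkM => //; first exact: Ck_cst.
by apply: CkM => //; exact: Ck_coord.
Qed.

End FlatFunction.

(** * The Euclidean norm and positive definite matrices *)

Section EuclideanNorm.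
Context {R : realType}.

Lemma sqnormE d (u : 'rV[R]_d) : sqnorm u = \sum_(i < d) u 0 i ^+ 2.
Proof. by rewrite /sqnorm mxE; apply: eq_bigr => i _; rewrite mxE expr2. Qed.

Lemma sqnorm_ge0 d (u : 'rV[R]_d) : 0 <= sqnorm u.
Proof. by rewrite sqnormE sumr_ge0// => i _; exact: sqr_ge0. Qed.

Lemma sqnormZ d (u : 'rV[R]_d) a : sqnorm (a *: u) = a ^+ 2 * sqnorm u.
Proof. by rewrite !sqnormE mulr_sumr; apply: eq_bigr => i _; rewrite mxE exprMn. Qed.

Definition norm2 d (u : 'rV[R]_d) : R := Num.sqrt (sqnorm u).

Lemma norm2_ge0 d (u : 'rV[R]_d) : 0 <= norm2 u.
Proof. exact: sqrtr_ge0. Qed.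

Lemma norm2_sqr d (u : 'rV[R]_d) : norm2 u ^+ 2 = sqnorm u.
Proof. by rewrite sqr_sqrtr// sqnorm_ge0. Qed.

Lemma norm2Z d (u : 'rV[R]_d) a : norm2 (a *: u) = `|a| * norm2 u.
Proof. by rewrite /norm2 sqnormZ sqrtrM ?sqr_ge0// sqrtr_sqr. Qed.

Lemma norm2N d (u : 'rV[R]_d) : norm2 (- u) = norm2 u.
Proof. by rewrite -scaleN1r norm2Z normrN1 mul1r. Qed.

Lemma norm2_0 d : norm2 (0 : 'rV[R]_d) = 0.
Proof. by rewrite -(scale0r 0) norm2Z normr0 mul0r. Qed.

(** Cauchy-Schwarz, by expanding the square of [norm2 v *: u - norm2 u *: v]. Null vectors are
    treated apart because [norm2 u * norm2 v] is cancelled. *)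
Lemma dot_le_norm2 d (u v : 'rV[R]_d) : (u *m v^T) 0 0 <= norm2 u * norm2 v.
Proof.
have dotE (a b : 'rV[R]_d) : (a *m b^T) 0 0 = \sum_(i < d) a 0 i * b 0 i.
  by rewrite mxE; apply: eq_bigr => i _; rewrite mxE.
have [u0|u0] := eqVneq (norm2 u) 0.
  suff -> : u = 0 by rewrite mul0mx mxE norm2_0 mul0r.
  have : sqnorm u = 0 by rewrite -norm2_sqr u0 expr0n.
  rewrite sqnormE => /eqP; rewrite psumr_eq0 => [/allP h|i _]; last exact: sqr_ge0.
  by apply/rowP => i; rewrite mxE; apply/eqP; rewrite -sqrf_eq0; apply: h; rewrite mem_index_enum.
have up : 0 < norm2 u by rewrite lt_def u0 norm2_ge0.
have h : 0 <= sqnorm (norm2 v *: u - norm2 u *: v) by exact: sqnorm_ge0.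
have E : sqnorm (norm2 v *: u - norm2 u *: v) =
    norm2 v ^+ 2 * sqnorm u + norm2 u ^+ 2 * sqnorm v - 2 * (norm2 u * norm2 v) * (u *m v^T) 0 0.
  rewrite dotE !sqnormE !mulr_sumr -!big_split/= -sumrB; apply: eq_bigr => i _.
  by rewrite !mxE; ring.
rewrite E -!norm2_sqr in h.
have [v0|v0] := eqVneq (norm2 v) 0.
  have {v0} v0 : v = 0.
    have : sqnorm v = 0 by rewrite -norm2_sqr v0 expr0n.
    rewrite sqnormE => /eqP; rewrite psumr_eq0 => [/allP hh|i _]; last exact: sqr_ge0.
    by apply/rowP => i; rewrite mxE; apply/eqP; rewrite -sqrf_eq0; apply: hh; rewrite mem_index_enum.
  by rewrite v0 trmx0 mulmx0 mxE norm2_0 mulr0.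
have vp : 0 < norm2 v by rewrite lt_def v0 norm2_ge0.
have uv : 0 < norm2 u * norm2 v by rewrite mulr_gt0.
rewrite -(ler_pM2l uv); nra.
Qed.

Lemma norm2_triangle d (u v : 'rV[R]_d) : norm2 (u + v) <= norm2 u + norm2 v.
Proof.
rewrite -(@ler_pXn2r _ 2)// ?nnegrE ?addr_ge0 ?norm2_ge0//.
have E : norm2 (u + v) ^+ 2 = norm2 u ^+ 2 + norm2 v ^+ 2 + 2 * (u *m v^T) 0 0.
  rewrite !norm2_sqr !sqnormE mxE mulr_sumr -!big_split/=; apply: eq_bigr => i _.
  by rewrite !mxE; ring.
have := dot_le_norm2 u v; rewrite E; lra.
Qed.

Lemma norm2_le_norm d (u : 'rV[R]_d) : norm2 u <= d%:R * `|u|.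
Proof.
have E : u = \sum_(i < d) u 0 i *: delta_mx 0 i by exact: row_sum_delta.
rewrite {1}E; apply: (@le_trans _ _ (\sum_(i < d) `|u|)); last first.
  by rewrite sumr_const card_ord mulr_natl.
elim/big_ind2: _ => [|x1 x2 y1 y2 h1 h2|i _]; first by rewrite norm2_0.
  exact: le_trans (norm2_triangle _ _) (lerD h1 h2).
rewrite norm2Z; have -> : norm2 (delta_mx 0 i : 'rV[R]_d) = 1.
  rewrite /norm2 sqnormE (bigD1 i)//= mxE !eqxx/= big1 ?addr0 ?expr1n ?sqrtr1// => j ji.
  by rewrite mxE eqxx (negbTE ji) expr0n.
by rewrite mulr1 rV_coord_le.
Qed.

Lemma norm_le_norm2 d (u : 'rV[R]_d) : `|u| <= norm2 u.
Proof.
apply/rV_norm_leP => [|i]; first exact: norm2_ge0.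
rewrite -sqrtr_sqr ler_wsqrtr// sqnormE (bigD1 i)//= lerDl sumr_ge0// => j _.
exact: sqr_ge0.
Qed.

End EuclideanNorm.

Section PositiveDefinite.
Context {R : realType}.

Definition posdef d (G : 'M[R]_d) :=
  G^T = G /\ forall v : 'rV[R]_d, v != 0 -> 0 < (v *m G *m v^T) 0 0.

(** Induction on the size: the Schur complement [D'] of the corner entry is again positive definite.
    The factor [S] later turns the Gram matrix of an immersion into a linear change of
    coordinates. *)
Lemma posdef_cholesky d (G : 'M[R]_d) : posdef G ->
  exists2 S : 'M[R]_d, S \in unitmx & G = S *m S^T.
Proof.
elim: d G => [|d IH] G [Gsym Gpos].
  by exists 1%:M; rewrite ?unitmx1//; apply/matrixP => -[].
pose a := G ord0 ord0; pose r : 'rV[R]_d := @ursubmx _ 1 d 1 d G.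
pose D : 'M[R]_d := @drsubmx _ 1 d 1 d G.
have GE : G = block_mx (a%:M : 'M[R]_1) r r^T D.
  rewrite -[LHS](@submxK _ 1 d 1 d); congr (@block_mx _ 1 d 1 d).
    by apply/matrixP => i j; rewrite !mxE !ord1 mulr1n /a; congr (G _ _); exact/val_inj.
  by apply/matrixP => i j; rewrite !mxE -[in LHS]Gsym mxE.
have quad x (v : 'rV[R]_d) : (row_mx (x%:M : 'rV[R]_1) v *m block_mx (a%:M : 'M[R]_1) r r^T D *m
     (row_mx (x%:M : 'rV[R]_1) v)^T) 0 0 =
   a * x ^+ 2 + 2 * x * (r *m v^T) 0 0 + (v *m D *m v^T) 0 0.
  rewrite tr_row_mx mul_row_block mul_row_col !mulmxDl.
  have -> : v *m r^T *m (x%:M : 'rV[R]_1)^T = x *: (r *m v^T)^T.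
    by rewrite tr_scalar_mx mul_mx_scalar trmx_mul trmxK.
  rewrite tr_scalar_mx -!scalar_mxM !mul_scalar_mx -scalemxAl !mxE.
  by rewrite !eqxx !mulr1n -!/(_ *m _) expr2; ring.
have a0 : 0 < a.
  have := Gpos (row_mx (1%:M : 'rV[R]_1) 0 : 'rV_d.+1).
  rewrite GE quad trmx0 mulmx0 mul0mx mulmx0 !mxE !mulr0 !addr0 expr1n mulr1; apply.
  apply/eqP => /rowP/(_ ord0); rewrite row_mx_ord0 mxE => /eqP.
  by rewrite oner_eq0.
pose D' := D - a^-1 *: (r^T *m r).
have [S' uS' D'E] : exists2 S : 'M[R]_d, S \in unitmx & D' = S *m S^T.
  apply: IH; split.
    have : G^T = G by [].
    rewrite {1 2}GE (@tr_block_mx _ 1 d 1 d) => /(@eq_block_mx _ 1 d 1 d)[_ _ _ DT].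
    by rewrite /D' linearB/= linearZ/= trmx_mul trmxK DT.
  (* This [x] minimizes the quadratic form in the first coordinate, and the minimum is the form of
     the Schur complement. *)
  move=> v v0; pose x := - a^-1 * (r *m v^T) 0 0.
  have := Gpos (row_mx (x%:M : 'rV[R]_1) v : 'rV_d.+1).
  rewrite GE quad => h.
  have -> : (v *m D' *m v^T) 0 0 = a * x ^+ 2 + 2 * x * (r *m v^T) 0 0 + (v *m D *m v^T) 0 0.
    rewrite /D' mulmxBr mulmxBl mxE addrC; congr (_ + _).
    have -> : v *m (a^-1 *: (r^T *m r)) *m v^T = a^-1 *: ((r *m v^T)^T *m (r *m v^T)).
      by rewrite -scalemxAr -scalemxAl trmx_mul trmxK !mulmxA.
    rewrite /x; move: (r *m v^T) => q; rewrite !mxE big_ord1 !mxE !ord1.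
    by field; rewrite gt_eqF.
  apply: h; apply: contra v0 => /eqP/rowP h; apply/eqP/rowP => i.
  by have := h (lift ord0 i); rewrite row_mx_lift !mxE.
pose s := Num.sqrt a; have s0 : s != 0 by rewrite gt_eqF// sqrtr_gt0.
have ss : s * s = a by rewrite -expr2 sqr_sqrtr// ltW.
exists (block_mx (s%:M : 'M[R]_1) 0 (s^-1 *: r^T) S').
  by rewrite unitmxE (@det_lblock _ 1 d) det_scalar1 unitrM !unitfE s0 -unitfE -unitmxE.
rewrite (@tr_block_mx _ 1 d 1 d) (@mulmx_block _ 1 d 1 d 1 d) GE tr_scalar_mx trmx0 !mulmx0 !mul0mx !addr0.
congr (@block_mx _ 1 d 1 d).
- by rewrite -scalar_mxM ss.
- by rewrite linearZ/= trmxK mul_scalar_mx scalerA mulfV// scale1r.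
- by rewrite mul_mx_scalar scalerA mulfV// scale1r.
- rewrite -D'E /D' linearZ/= trmxK -scalemxAl -scalemxAr scalerA -invfM ss.
  by rewrite addrC subrK.
Qed.

Lemma posdef_unit d (G : 'M[R]_d) : posdef G -> G \in unitmx /\ 0 < \det G.
Proof.
move=> /posdef_cholesky[S uS ->]; rewrite unitmx_mul unitmx_tr uS; split=> //.
by rewrite det_mulmx det_tr -expr2 lt_def sqr_ge0 andbT sqrf_eq0 -unitfE -unitmxE.
Qed.

(** The determinant of the block matrix [M], computed by clearing either of its off-diagonal
    blocks. *)
Lemma det_rank_one d (c : 'cV[R]_d) (r : 'rV[R]_d) : \det (1%:M + c *m r) = 1 + (r *m c) 0 0.
Proof.
pose M : 'M[R]_(1 + d) := block_mx 1%:M (- r) c 1%:M.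
have E1 : block_mx 1%:M 0 (- c) 1%:M *m M = block_mx 1%:M (- r) 0 (1%:M + c *m r).
  by rewrite mulmx_block !mul1mx !mul0mx !addr0 mulmx1 addNr mulmxN mulNmx opprK addrC.
have E2 : block_mx 1%:M r 0 1%:M *m M = block_mx (1%:M + r *m c) 0 c 1%:M.
  by rewrite mulmx_block !mul1mx !mul0mx !add0r mulmx1 addNr.
have := congr1 determinant E1; have := congr1 determinant E2.
rewrite !det_mulmx !det_lblock !det_ublock !det1 !mulr1 !mul1r => -> <-.
by rewrite det_mx11 !mxE eqxx.
Qed.

Lemma det_rank_one_le d (G : 'M[R]_d) (v : 'rV[R]_d) : G \in unitmx ->
  \det (G + v^T *m v) = \det G * (1 + (v *m invmx G *m v^T) 0 0).
Proof.
move=> uG; have -> : G + v^T *m v = G *m (1%:M + (invmx G *m v^T) *m v).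
  by rewrite mulmxDr mulmx1 !mulmxA mulmxV// mul1mx.
by rewrite det_mulmx det_rank_one mulmxA.
Qed.

End PositiveDefinite.

(** * Charts and embeddings *)

Section JacobianChainRule.
Context {R : realType}.

(** Chart inverses are total functions with arbitrary values off the image of the chart, so
    composites of local representatives are known only near a point. Jacobians act on row vectors
    from the right, hence the order of the product. *)
Lemma jacobian_comp_near d q r (h : 'rV[R]_d -> 'rV[R]_q) (g : 'rV[R]_q -> 'rV[R]_r)
    (k : 'rV[R]_d -> 'rV[R]_r) u :
  differentiable h u -> differentiable g (h u) -> (\forall v \near u, g (h v) = k v) ->
  differentiable k u /\ 'J k u = 'J h u *m 'J g (h u).
Proof.
move=> dh dg gk.
have dgh : differentiable (g \o h) u by exact: differentiable_comp.
have dk : differentiable k u by exact: near_eq_differentiable gk dgh.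
split=> //; apply/row_matrixP => i; rewrite row_mul !rowE.
rewrite -!deriveEjacobian//; last first.
rewrite -(near_eq_derive _ gk) (deriveE (f := g \o h))// diff_comp//=.
by rewrite (deriveE (f := h))// deriveE.
Qed.

Lemma mulmx_eq1_unit d (A B C : 'M[R]_d) : C = A *m B -> C = 1%:M -> A \in unitmx.
Proof. by move=> -> /mulmx1_unit[]. Qed.

Lemma near_open (T : topologicalType) (U : set T) x : open U -> U x -> \forall y \near x, U y.
Proof. by move=> oU Ux; exact: open_nbhs_nbhs. Qed.

Lemma row_free_mulmxP p q (A : 'M[R]_(p, q)) :
  (forall v : 'rV[R]_p, v *m A = 0 -> v = 0) <-> row_free A.
Proof.
split=> [h|rA v vA].
  rewrite -kermx_eq0; apply/eqP/row_matrixP => i; rewrite row0.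
  by apply: h; rewrite -row_mul mulmx_ker row0.
by apply/eqP; rewrite -(mulmx_free_eq0 _ rA) vA.
Qed.

End JacobianChainRule.

Section ChartFacts.
Context {R : realType} {M : topologicalType} {d : nat}.
Variable A : set (chart R M d).
Hypothesis smA : smooth_manifold A.

Lemma chart_open_dom c : A c -> open (cdom c).
Proof. by move=> Ac; have [_ _ /(_ c Ac)[] ] := smA. Qed.

Lemma chart_open_cod c : A c -> open (ccod c).
Proof. by move=> Ac; have [_ _ /(_ c Ac)[] ] := smA. Qed.

Lemma chart_cmap_continuous c x : A c -> cdom c x -> {for x, continuous (cmap c)}.
Proof. by move=> Ac cx; have [_ _ /(_ c Ac)[_ _ h _ _] _ _] := smA; exact: h. Qed.

Lemma chart_cinv_continuous c u : A c -> ccod c u -> {for u, continuous (cinv c)}.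
Proof. by move=> Ac cx; have [_ _ /(_ c Ac)[_ _ _ h _] _ _] := smA; exact: h. Qed.

Lemma chart_cmapK c x : A c -> cdom c x -> cinv c (cmap c x) = x.
Proof. by move=> Ac cx; have [_ _ /(_ c Ac)[_ _ _ _ h] _ _] := smA; exact: h. Qed.

Lemma chart_cod (c : chart R M d) x : cdom c x -> ccod c (cmap c x).
Proof. by move=> cx; exists x. Qed.

Lemma chart_cinvP c u : A c -> ccod c u -> cdom c (cinv c u) /\ cmap c (cinv c u) = u.
Proof. by move=> Ac [x cx <-]; rewrite chart_cmapK. Qed.

Lemma chart_covers x : exists2 c, A c & cdom c x.
Proof. by have [_ _ _ /(_ x)] := smA. Qed.

Lemma preimage_cmap_open c (V : set 'rV[R]_d) : A c -> open V -> open (cdom c `&` cmap c @^-1` V).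
Proof.
move=> Ac oV; rewrite openE => x [cx Vx]; apply: filterI.
  by apply: open_nbhs_nbhs; split=> //; exact: chart_open_dom.
by apply: (chart_cmap_continuous Ac cx); exact: open_nbhs_nbhs.
Qed.

Lemma preimage_cinv_open c (V : set M) : A c -> open V -> open (ccod c `&` cinv c @^-1` V).
Proof.
move=> Ac oV; rewrite openE => x [cx Vx]; apply: filterI.
  by apply: open_nbhs_nbhs; split=> //; exact: chart_open_cod.
by apply: (chart_cinv_continuous Ac cx); exact: open_nbhs_nbhs.
Qed.

Lemma image_cmapE c (V : set M) : A c -> cmap c @` (cdom c `&` V) = ccod c `&` cinv c @^-1` V.
Proof.
move=> Ac; apply/seteqP; split=> [_ [x [cx Vx] <-]|u [/(chart_cinvP Ac)[cu uE] Vu]].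
  by split; [exact: chart_cod|rewrite /= chart_cmapK].
by exists (cinv c u).
Qed.

Lemma image_cmap_open c (V : set M) : A c -> open V -> open (cmap c @` (cdom c `&` V)).
Proof. by move=> Ac oV; rewrite image_cmapE//; exact: preimage_cinv_open. Qed.

Lemma image_cinv_open c (V : set 'rV[R]_d) : A c -> open V -> V `<=` ccod c -> open (cinv c @` V).
Proof.
move=> Ac oV Vc; rewrite (_ : _ @` _ = cdom c `&` cmap c @^-1` V); first exact: preimage_cmap_open.
apply/seteqP; split=> [_ [u Vu <-]|x [cx Vx]].
  by have [? E] := chart_cinvP Ac (Vc _ Vu); split=> //; rewrite /preimage/= E.
by exists (cmap c x) => //; rewrite chart_cmapK.
Qed.

Lemma transition_smooth c e : A c -> A e ->
  Cinfty (cmap c @` (cdom c `&` cdom e)) (transition c e).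
Proof. by move=> Ac Ae; have [_ _ _ _] := smA; apply. Qed.

Lemma transition_differentiable c e x : A c -> A e -> cdom c x -> cdom e x ->
  differentiable (transition c e) (cmap c x).
Proof.
by move=> Ac Ae cx ex; have [+ _] := transition_smooth Ac Ae 1; apply; exists x.
Qed.

Lemma near_cinv_cdom c e x : A c -> A e -> cdom c x -> cdom e x ->
  \forall u \near cmap c x, ccod c u /\ cdom e (cinv c u).
Proof.
move=> Ac Ae cx ex.
have := near_open (preimage_cinv_open Ac (chart_open_dom Ae)); apply.
by split; [exact: chart_cod|rewrite /preimage/= chart_cmapK].
Qed.

Lemma jacobian_chart_change N (K : M -> 'rV[R]_N) c e x : A c -> A e -> cdom c x -> cdom e x ->
  differentiable (K \o cinv e) (cmap e x) ->
  differentiable (K \o cinv c) (cmap c x) /\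
  'J (K \o cinv c) (cmap c x) = 'J (transition c e) (cmap c x) *m 'J (K \o cinv e) (cmap e x).
Proof.
move=> Ac Ae cx ex dK.
have tx : transition c e (cmap c x) = cmap e x by rewrite /transition/= chart_cmapK.
rewrite -tx in dK *; apply: jacobian_comp_near => //; first exact: transition_differentiable.
apply: filterS (near_cinv_cdom Ac Ae cx ex) => u [cu eu].
by rewrite /transition /= chart_cmapK.
Qed.

Lemma transition_jacobian_unit c e x : A c -> A e -> cdom c x -> cdom e x ->
  'J (transition c e) (cmap c x) \in unitmx.
Proof.
move=> Ac Ae cx ex.
have := @jacobian_comp_near R d d d (transition c e) (transition e c) id (cmap c x).
have tx : transition c e (cmap c x) = cmap e x by rewrite /transition/= chart_cmapK.
rewrite tx => /(_ (transition_differentiable Ac Ae cx ex) (transition_differentiable Ae Ac ex cx)).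
case.
  apply: filterS (near_cinv_cdom Ac Ae cx ex) => u [cu eu].
  by rewrite /transition /= chart_cmapK// (chart_cinvP Ac cu).2.
move=> _ E.
have J1 : 'J (@id 'rV[R]_d) (cmap c x) = 1%:M.
  by apply/row_matrixP => i; rewrite !rowE -deriveEjacobian// derive_id mulmx1.
exact: mulmx_eq1_unit E J1.
Qed.

Definition smooth_fun N (K : M -> 'rV[R]_N) := forall c, A c -> Cinfty (ccod c) (K \o cinv c).

Lemma smooth_fun_differentiable N (K : M -> 'rV[R]_N) c u : smooth_fun K -> A c -> ccod c u ->
  differentiable (K \o cinv c) u.
Proof. by move=> sK Ac cu; have [+ _] := sK c Ac 1; apply. Qed.

Lemma smooth_fun_continuous N (K : M -> 'rV[R]_N) : smooth_fun K -> continuous K.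
Proof.
move=> sK x; have [c Ac cx] := chart_covers x.
apply: (@continuous_near_eq _ _ ((K \o cinv c) \o cmap c)).
  apply: filterS (near_open (chart_open_dom Ac) cx) => y cy /=.
  by rewrite chart_cmapK.
apply: continuous_comp; first exact: chart_cmap_continuous.
by apply: differentiable_continuous; apply: smooth_fun_differentiable => //; exact: chart_cod.
Qed.

(** Any chart at a point is related to the chosen one by a smooth transition, so a single chart
    around each point is enough. *)
Lemma smooth_fun_local N (K : M -> 'rV[R]_N) :
  (forall x, exists c (V : set M), [/\ A c, open V, V x, V `<=` cdom c &
     Cinfty (cmap c @` V) (K \o cinv c)]) -> smooth_fun K.
Proof.
move=> loc c Ac k; apply: Ck_pointwise => u cu.
have [cx uE] := chart_cinvP Ac cu; set x := cinv c u in cx uE.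
have [e [V [Ae oV Vx Ve Ke]]] := loc x.
pose U := ccod c `&` cinv c @^-1` V.
have oU : open U by exact: preimage_cinv_open.
have Uu : U u by [].
apply: (Ck_subset (U := U)); first by move=> _ ->.
have VE : cmap e @` V = cmap e @` (cdom e `&` V) by congr (_ @` _); apply/esym/setIidPr.
apply: (@Ck_ext _ _ _ _ _ ((K \o cinv e) \o transition c e)) => //.
  by move=> v [cv Vv]; rewrite /transition/= chart_cmapK//; exact: Ve.
apply: (@Ck_comp_mx _ _ _ _ _ _ _ (cmap e @` V)) => //.
- by rewrite VE; exact: image_cmap_open.
- by move=> v [cv Vv]; exists (cinv c v).
- apply: Ck_subset (transition_smooth Ac Ae k) => v [cv Vv].
  by rewrite image_cmapE//; split=> //; exact: Ve.
Qed.

End ChartFacts.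

(** * Embedding a compact manifold into a Euclidean space *)

Section Embedding.
Context {R : realType} {M : topologicalType} {d : nat}.
Variable A : set (chart R M d).
Hypothesis smA : smooth_manifold A.

Lemma closed_ball_compact p (u0 : 'rV[R]_p) r : compact [set u : 'rV[R]_p | `|u - u0| <= r].
Proof.
apply: bounded_closed_compact.
  exists (`|u0| + `|r|); split; first exact: num_real.
  move=> t tr u /= ur; apply: le_trans (ltW tr).
  by have := ler_normD (u - u0) u0; rewrite subrK => /le_trans; apply; rewrite addrC lerD2l (le_trans ur)// ler_norm.
have -> : [set u : 'rV[R]_p | `|u - u0| <= r] = (fun u => `|u - u0|) @^-1` [set x | x <= r] by [].
apply: closed_comp => [u _|]; last exact: closed_le.
apply: (@continuous_comp _ _ _ (fun u : 'rV[R]_p => u - u0) (fun v => `|v|)); last exact: norm_continuous.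
by apply: continuousB; [exact: cvg_id|exact: cst_continuous].
Qed.

(** The near-covering form of compactness, applied to the filter of finite lists of points of [S]
    that is generated by the lists containing a given one. *)
Lemma compact_finite_subcover (T : topologicalType) (S : set T) (F : T -> set T) :
  compact S -> (forall x, S x -> open (F x) /\ F x x) ->
  exists s : seq T, (forall x, x \in s -> S x) /\ forall x, S x -> exists2 y, y \in s & F y x.
Proof.
move=> /compact_near_coveringP cS oF.
pose G : set_system (seq T) := [set U | exists2 s0 : seq T, (forall x, x \in s0 -> S x) &
  forall s : seq T, (forall x, x \in s -> S x) -> {subset s0 <= s} -> U s].
have FG : Filter G.
  split.
  - by exists [::].
  - move=> U U' [s sS sU] [s' sS' sU']; exists (s ++ s').
      by move=> x; rewrite mem_cat => /orP[/sS|/sS'].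
    move=> t tS st; split; [apply: sU|apply: sU'] => // x xs; apply: st; rewrite mem_cat xs ?orbT//.
  - by move=> U U' UU' [s sS sU]; exists s => // t tS st; apply: UU'; exact: sU.
have : \forall s \near G, S `<=` (fun x => exists2 y, y \in s & F y x).
  apply: (cS _ G (fun s x => exists2 y, y \in s & F y x)) => x Sx.
  exists (F x, [set s : seq T | x \in s]) => /=; last first.
    by move=> [y s] /= [Fy xs]; exists x.
  split; last by exists [:: x] => [y|t _]; [rewrite inE => /eqP ->|apply; rewrite inE].
  by apply: open_nbhs_nbhs; exact: oF.
by move=> [s0 s0S /(_ s0 s0S) h]; exists s0; split=> //; apply: h.
Qed.

Lemma cinv_compact c u0 r : A c -> (forall u, `|u - u0| <= r -> ccod c u) ->
  compact (cinv c @` [set u : 'rV[R]_d | `|u - u0| <= r]).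
Proof.
move=> Ac uc; apply: continuous_compact; last exact: closed_ball_compact.
apply: continuous_in_subspaceT => u /set_mem ur.
by apply: (chart_cinv_continuous smA Ac); exact: uc.
Qed.

Definition chart_extend N c (b : 'rV[R]_d -> 'rV[R]_N) (y : M) : 'rV[R]_N :=
  if `[< cdom c y >] then b (cmap c y) else 0.

(** Off the chart domain a neighbourhood is needed on which the extension vanishes. The image of the
    closed ball supporting [b] is compact, hence closed in a Hausdorff manifold, and its complement
    serves. *)
Lemma chart_extend_smooth N c u0 r (b : 'rV[R]_d -> 'rV[R]_N) : A c ->
  (forall u, `|u - u0| <= r -> ccod c u) -> Cinfty setT b ->
  (forall u, r <= `|u - u0| -> b u = 0) -> smooth_fun A (chart_extend c b).
Proof.
move=> Ac rc Cb b0; apply: (smooth_fun_local smA) => x.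
have [cx|ncx] := pselect (cdom c x).
  exists c, (cdom c); split=> //; first exact: (chart_open_dom smA).
  move=> k; apply: (@Ck_ext _ _ _ _ _ b); last exact: Ck_subset (Cb k).
    exact: (chart_open_cod smA Ac).
  by move=> u /(chart_cinvP smA Ac)[cu uE]; rewrite /= /chart_extend asboolT// uE.
have [e Ae ex] := chart_covers smA x.
pose Z := cinv c @` [set u : 'rV[R]_d | `|u - u0| <= r].
have hM : hausdorff_space M by have [] := smA.
have cZ : closed Z by apply: compact_closed => //; exact: cinv_compact.
have Zx : ~ Z x by move=> [u ur ux]; apply: ncx; rewrite -ux; have [] := chart_cinvP smA Ac (rc _ ur).
have oV : open (cdom e `&` ~` Z) by apply: openI; [exact: (chart_open_dom smA)|exact: closed_openC].
exists e, (cdom e `&` ~` Z); split=> //.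
move=> k.
have oW : open (cmap e @` (cdom e `&` ~` Z)).
  have -> : cdom e `&` ~` Z = cdom e `&` (cdom e `&` ~` Z) by rewrite setIA setIid.
  exact: (image_cmap_open smA).
apply: (@Ck_ext _ _ _ _ _ (fun _ => 0)) => //; last exact: Ck_cst.
move=> _ [y [ey Zy] <-] /=; rewrite (chart_cmapK smA)// /chart_extend; case: asboolP => // cy.
rewrite b0// leNgt; apply/negP => yr; apply: Zy; exists (cmap c y); first exact: ltW.
exact: (chart_cmapK smA).
Qed.

Lemma Cinfty_scaled_bump (u0 : 'rV[R]_d) r k : Ck k setT (fun u : 'rV[R]_d => bump_fun (r^-1 *: (u - u0))).
Proof.
have oT : open [set: 'rV[R]_d] by exact: openT.
apply: (@Ck_comp _ _ k setT d setT (fun u => r^-1 *: (u - u0))) => //; last exact: Ck_bump.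
apply/Ck_mxP => // i j.
apply: (@Ck_ext _ _ _ _ _ (fun u : 'rV[R]_d => r^-1 * (u 0 j + - u0 0 j))) => //.
  by move=> u _; rewrite !mxE !ord1.
apply: CkM => //; first exact: Ck_cst.
by apply: CkD => //; [exact: Ck_coord|exact: Ck_cst].
Qed.

Lemma scaled_bump_eq0 (u0 u : 'rV[R]_d) r : 0 < r -> r <= `|u - u0| -> bump_fun (r^-1 *: (u - u0)) = 0.
Proof.
move=> r0 ur; apply: bump_eq0; rewrite normrZ (@ger0_norm _ r^-1); last by rewrite invr_ge0 ltW.
by rewrite ler_pdivlMl// mulr1.
Qed.

Lemma scaled_bump_gt0 (u0 u : 'rV[R]_d) r : 0 < r -> `|u - u0| < r -> 0 < bump_fun (r^-1 *: (u - u0)).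
Proof.
move=> r0 ur; apply: bump_gt0; rewrite normrZ ger0_norm ?invr_ge0 ?ltW//.
by rewrite ltr_pdivrMl// mulr1.
Qed.

Definition immersive_at N (K : M -> 'rV[R]_N) (y : M) :=
  forall e, A e -> cdom e y -> row_free ('J (K \o cinv e) (cmap e y)).

Lemma immersive_at_chart N (K : M -> 'rV[R]_N) c y : smooth_fun A K -> A c -> cdom c y ->
  row_free ('J (K \o cinv c) (cmap c y)) -> immersive_at K y.
Proof.
move=> sK Ac cy fK e Ae ey.
have dK := smooth_fun_differentiable sK Ac (chart_cod cy).
have [_ ->] := jacobian_chart_change smA Ae Ac ey cy dK.
by rewrite /row_free mxrankMfree// mxrank_unit//; exact: (transition_jacobian_unit smA).
Qed.

(** The other point ranges over the whole manifold. So finitely many maps, each separating the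
    points of one set of a cover, combine into an injective map. *)
Definition separates N (K : M -> 'rV[R]_N) (y : M) := forall y', K y = K y' -> y = y'.

Lemma chart_ball x : exists c r, [/\ A c, cdom c x, 0 < r &
  forall u, `|u - cmap c x| <= r -> ccod c u].
Proof.
have [c Ac cx] := chart_covers smA x.
have [r r0 rc] := rV_open_ballP (chart_open_cod smA Ac) (chart_cod cx).
exists c, (r / 2); split=> //; first by rewrite divr_gt0.
move=> u ur; apply: rc; rewrite distrC; apply: le_lt_trans ur _.
by rewrite ltr_pdivrMr// ltr_pMr// ltr1n.
Qed.

Lemma graph_neq0 (t : R) (v : 'rV[R]_d) : t != 0 ->
  row_mx (t%:M : 'M[R]_1) (t *: v) = 0 -> False.
Proof.
move=> t0; rewrite -[0]row_mx0 => /eq_row_mx[/matrixP/(_ 0 0)].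
by rewrite !mxE mulr1n => t1; rewrite t1 eqxx in t0.
Qed.

Lemma graph_inj (t t' : R) (u0 u u' : 'rV[R]_d) : t != 0 ->
  row_mx (t%:M : 'M[R]_1) (t *: (u - u0)) = row_mx t'%:M (t' *: (u' - u0)) -> u = u'.
Proof.
move=> t0 /eq_row_mx[/matrixP/(_ 0 0)]; rewrite !mxE !mulr1n => <-.
by move/(scalerI t0)/addIr.
Qed.

(* The map [(b, b * (u - u0))], where [b] is a bump function, determines [u] where [b] does
   not vanish, also infinitesimally. *)
Lemma local_embedding x : exists O N (K : M -> 'rV[R]_N),
  [/\ open O, O x, smooth_fun A K & forall y, O y -> separates K y /\ immersive_at K y].
Proof.
have [c [r [Ac cx r0 rc]]] := chart_ball x.
set u0 := cmap c x in rc.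
pose b u := bump_fun (r^-1 *: (u - u0)).
pose B (u : 'rV[R]_d) : 'rV[R]_(1 + d) := row_mx (b u)%:M (b u *: (u - u0)).
have oT : open [set: 'rV[R]_d] by exact: openT.
have Cb k : Ck k setT b by exact: Cinfty_scaled_bump.
have Cu k i : Ck k setT (fun u : 'rV[R]_d => u 0 i - u0 0 i).
  by apply: CkD => //; [exact: Ck_coord|exact: Ck_cst].
have CB : Cinfty setT B.
  move=> k; apply/Ck_mxP => // i j; rewrite ord1.
  case: (split_ordP j) => l ->.
    apply: (@Ck_ext _ _ _ _ _ b) => // u _.
    by rewrite /B row_mxEl ord1 mxE eqxx.
  apply: (@Ck_ext _ _ _ _ _ (fun u => b u * (u 0 l - u0 0 l))) => //.
    by move=> u _; rewrite /B row_mxEr !mxE.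
  exact: CkM.
have B0 u : r <= `|u - u0| -> B u = 0.
  by move=> ur; rewrite /B /b scaled_bump_eq0// scale0r -[0%:M]/(scalar_mx 0) raddf0 row_mx0.
pose K := chart_extend c B.
have sK : smooth_fun A K by apply: chart_extend_smooth CB B0.
exists (cdom c `&` cmap c @^-1` (ball u0 r)), (1 + d)%N, K.
have oO : open (cdom c `&` cmap c @^-1` (ball u0 r)).
  by apply: (preimage_cmap_open smA Ac); exact: ball_open.
split=> //; first by split=> //; exact: ballxx.
move=> y [cy]; rewrite /preimage /= mx_norm_ball /ball_ /= distrC => yr.
have by0 : 0 < b (cmap c y) by exact: scaled_bump_gt0.
split.
  move=> y'; rewrite /K /chart_extend asboolT//.
  case: asboolP => [cy' /(graph_inj (lt0r_neq0 by0)) E|_ /(graph_neq0 (lt0r_neq0 by0))//].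
  by rewrite -(chart_cmapK smA Ac cy) E (chart_cmapK smA Ac cy').
apply: (immersive_at_chart sK Ac cy).
have dB : differentiable B (cmap c y) by have [+ _] := CB 1; apply.
have [_ ->] : differentiable (K \o cinv c) (cmap c y) /\ 'J (K \o cinv c) (cmap c y) = 'J (@id 'rV[R]_d) (cmap c y) *m 'J B (cmap c y).
  apply: (@jacobian_comp_near _ _ _ _ id B) => //.
  apply: filterS (near_open (chart_open_cod smA Ac) (chart_cod cy)) => u cu /=.
  by have [cu' uE] := chart_cinvP smA Ac cu; rewrite /K /chart_extend asboolT// uE.
have did : differentiable (@id 'rV[R]_d) (cmap c y) by [].
apply/row_free_mulmxP => w; rewrite mulmxA -(deriveEjacobian w did) derive_id -(deriveEjacobian w dB).
move: (cmap c y) by0 dB => u bu dB Bw.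
have dBw : derivable B u w by exact: diff_derivable.
have db : derivable b u w by apply: diff_derivable; have [+ _] := Cb 1; apply.
(* The first component of [B] shows that [b] has derivative zero along [w]; the product rule on the
   other components then leaves [b u] times the coordinates of [w]. *)
have Dbw : 'D_w b u = 0.
  have [_ E] := derive_coord 0 (lshift d ord0) dBw; rewrite Bw mxE in E; rewrite -E.
  by congr ('D_w _ u); apply/funext => v; rewrite /B row_mxEl mxE eqxx.
apply/rowP => i; rewrite mxE.
have [_ E] := derive_coord 0 (rshift 1 i) dBw; rewrite Bw mxE in E.
have fE : (fun v => B v 0 (rshift 1 i)) = b * (fun v => v 0 i - u0 0 i).
  by apply/funext => v; rewrite /B row_mxEr !mxE.
have di : derivable (fun v : 'rV[R]_d => v 0 i - u0 0 i) u w.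
  by apply: diff_derivable; have [+ _] := Cu 1 i; apply.
have Di : 'D_w (fun v : 'rV[R]_d => v 0 i - u0 0 i) u = w 0 i.
  have [dc Ec] := derive_coord 0 i (@derivable_id _ _ u w).
  rewrite derive_id in Ec; rewrite -Ec.
  rewrite (_ : (fun v : 'rV[R]_d => v 0 i - u0 0 i) = (fun v : 'rV[R]_d => v 0 i) - cst (u0 0 i))//.
  by rewrite deriveB// derive_cst subr0.
move: E; rewrite fE deriveM// Dbw scaler0 addr0 Di => /eqP.
by rewrite scaler_eq0 gt_eqF//= => /eqP.
Qed.

Lemma smooth_fun_row_mx N1 N2 (K1 : M -> 'rV[R]_N1) (K2 : M -> 'rV[R]_N2) :
  smooth_fun A K1 -> smooth_fun A K2 -> smooth_fun A (fun y => row_mx (K1 y) (K2 y)).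
Proof.
move=> s1 s2 c Ac k; have oc := chart_open_cod smA Ac.
apply/Ck_mxP => // i j; rewrite ord1; case: (split_ordP j) => l ->.
  have /(Ck_mxP _ _ oc)/(_ 0 l) := s1 c Ac k; apply: Ck_ext => // u _ /=.
  by rewrite row_mxEl.
have /(Ck_mxP _ _ oc)/(_ 0 l) := s2 c Ac k; apply: Ck_ext => // u _ /=.
by rewrite row_mxEr.
Qed.

Lemma derive_row_mx (V : normedModType R) N1 N2 (f1 : V -> 'rV[R]_N1) (f2 : V -> 'rV[R]_N2) u w :
  differentiable f1 u -> differentiable f2 u -> differentiable (fun y => row_mx (f1 y) (f2 y)) u /\
  'D_w (fun y => row_mx (f1 y) (f2 y)) u = row_mx ('D_w f1 u) ('D_w f2 u).
Proof.
move=> d1 d2.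
have dr : differentiable (fun y => row_mx (f1 y) (f2 y)) u.
  apply: differentiable_mx => i j; rewrite ord1; case: (split_ordP j) => l ->.
    rewrite (_ : (fun y => _) = (fun y => f1 y 0 l)); last by apply/funext => y; rewrite row_mxEl.
    by apply: (@differentiable_comp _ _ _ _ f1 (fun N => N 0 l)) => //; exact: differentiable_coord.
  rewrite (_ : (fun y => _) = (fun y => f2 y 0 l)); last by apply/funext => y; rewrite row_mxEr.
  by apply: (@differentiable_comp _ _ _ _ f2 (fun N => N 0 l)) => //; exact: differentiable_coord.
split=> //; apply/rowP => j.
have [_ <-] := derive_coord 0 j (diff_derivable (v := w) dr).
case: (split_ordP j) => l ->.
  rewrite row_mxEl; have [_ <-] := derive_coord 0 l (diff_derivable (v := w) d1).
  by congr ('D_w _ u); apply/funext => y; rewrite row_mxEl.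
rewrite row_mxEr; have [_ <-] := derive_coord 0 l (diff_derivable (v := w) d2).
by congr ('D_w _ u); apply/funext => y; rewrite row_mxEr.
Qed.

Lemma immersive_row_mx N1 N2 (K1 : M -> 'rV[R]_N1) (K2 : M -> 'rV[R]_N2) y :
  smooth_fun A K1 -> smooth_fun A K2 -> immersive_at K1 y \/ immersive_at K2 y ->
  immersive_at (fun y => row_mx (K1 y) (K2 y)) y.
Proof.
move=> s1 s2 im e Ae ey; apply/row_free_mulmxP => w.
have d1 := smooth_fun_differentiable s1 Ae (chart_cod ey).
have d2 := smooth_fun_differentiable s2 Ae (chart_cod ey).
have [dr Dr] := derive_row_mx w d1 d2.
rewrite -deriveEjacobian// [LHS]Dr -[RHS]row_mx0 => /eq_row_mx[E1 E2].
case: im => /(_ e Ae ey)/row_free_mulmxP; apply.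
  by rewrite -deriveEjacobian.
by rewrite -deriveEjacobian.
Qed.

(** Finitely many local embeddings side by side: a concatenation separates a point, or is immersive
    there, as soon as one of its blocks does. *)
Theorem compact_embedding : compact [set: M] ->
  exists N (K : M -> 'rV[R]_N), [/\ smooth_fun A K, injective K & forall y, immersive_at K y].
Proof.
move=> cM.
have /choice[W hW] : forall x, exists U : set M, exists N (K : M -> 'rV[R]_N),
    [/\ open U, U x, smooth_fun A K & forall y, U y -> separates K y /\ immersive_at K y].
  by move=> x; have [U h] := local_embedding x; exists U.
have [s [_ sO]] : exists s : seq M, (forall x, x \in s -> setT x) /\
    forall x, setT x -> exists2 y, y \in s & W y x.
  by apply: compact_finite_subcover => // x _; have [N [K []]] := hW x.
suff [N [K [sK hK]]] : exists N (K : M -> 'rV[R]_N), smooth_fun A K /\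
    forall x, x \in s -> forall y, W x y -> separates K y /\ immersive_at K y.
  exists N, K; split=> [//|y y' Kyy'|y]; last by have [x xs Oxy] := sO y I; have [] := hK x xs y Oxy.
  by have [x xs Oxy] := sO y I; have [+ _] := hK x xs y Oxy; apply.
elim: s {sO} => [|x s [N [K [sK hK]]]].
  exists 0%N, (fun _ => 0); split=> // c Ac k; exact: Ck_cst.
have [N' [K' [_ _ sK' hK']]] := hW x.
exists (N' + N)%N, (fun y => row_mx (K' y) (K y)); split; first exact: smooth_fun_row_mx.
move=> z; rewrite inE => /orP[/eqP ->|zs] y Oy; split.
- by move=> y' /eq_row_mx[E _]; have [+ _] := hK' y Oy; apply.
- by apply: immersive_row_mx => //; left; have [] := hK' y Oy.
- by move=> y' /eq_row_mx[_ E]; have [+ _] := hK z zs y Oy; apply.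
- by apply: immersive_row_mx => //; right; have [] := hK z zs y Oy.
Qed.

End Embedding.

(** * Weighted pullback metrics *)

Section WeightedTensors.
Context {R : realType}.

Lemma weighted_gramE d N (J : 'M[R]_(d, N)) (w : 'rV[R]_N) i j :
  (J *m diag_mx w *m J^T) i j = \sum_l w 0 l * (J i l * J j l).
Proof.
rewrite mxE; apply: eq_bigr => l _; rewrite mul_mx_diag !mxE.
by rewrite mulrAC mulrC.
Qed.

Lemma weighted_gram_quad d N (J : 'M[R]_(d, N)) (w : 'rV[R]_N) (v : 'rV[R]_d) :
  (v *m (J *m diag_mx w *m J^T) *m v^T) 0 0 = \sum_l w 0 l * (v *m J) 0 l ^+ 2.
Proof.
have -> : v *m (J *m diag_mx w *m J^T) *m v^T = (v *m J) *m diag_mx w *m (v *m J)^T.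
  by rewrite trmx_mul !mulmxA.
by rewrite weighted_gramE; apply: eq_bigr => l _; rewrite expr2.
Qed.

Lemma weighted_gram_mul d e N (P : 'M[R]_(d, e)) (J : 'M[R]_(e, N)) (w : 'rV[R]_N) :
  (P *m J) *m diag_mx w *m (P *m J)^T = P *m (J *m diag_mx w *m J^T) *m P^T.
Proof. by rewrite trmx_mul !mulmxA. Qed.

(* The pullback under [K] of the metric [\sum_i W_i dx_i^2], where the weights depend on the
   point of [M]. *)
Definition wtensor (M : Type) d N (K W : M -> 'rV[R]_N) : tensor2 R M d :=
  fun c u => 'J (K \o cinv c) u *m diag_mx (W (cinv c u)) *m ('J (K \o cinv c) u)^T.

(** Equality is asked only at coordinates of points of the chart: tensors such as those produced by
    [pullback] take arbitrary values elsewhere. *)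
Definition is_wtensor (M : Type) d N (A : set (chart R M d)) (K W : M -> 'rV[R]_N)
    (g : tensor2 R M d) :=
  forall c x, A c -> cdom c x -> g c (cmap c x) = wtensor K W c (cmap c x).

Section WeightedMetric.
Context {M : topologicalType} {d : nat}.
Variable A : set (chart R M d).
Hypothesis smA : smooth_manifold A.

Lemma wtensor_smooth N (K W : M -> 'rV[R]_N) c : smooth_fun A K -> smooth_fun A W -> A c ->
  Cinfty (ccod c) (wtensor K W c).
Proof.
move=> sK sW Ac k; have oc := chart_open_cod smA Ac; apply/Ck_mxP => // i j.
apply: (@Ck_ext _ _ _ _ _ (fun u => \sum_l W (cinv c u) 0 l *
    ('J (K \o cinv c) u i l * 'J (K \o cinv c) u j l))) => //.
  by move=> u _; rewrite /wtensor weighted_gramE.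
apply: Ck_sum => // l _; apply: CkM => //.
  by have /(Ck_mxP _ _ oc)/(_ 0 l) := sW c Ac k.
by apply: CkM => //; apply: Ck_partial => //; exact: sK.
Qed.

Lemma wtensor_riemannian N (K W : M -> 'rV[R]_N) : smooth_fun A K -> smooth_fun A W ->
  (forall x i, 0 < W x 0 i) -> (forall x, immersive_at A K x) ->
  riemannian_metric A (wtensor K W).
Proof.
move=> sK sW W0 iK; split.
- by move=> c Ac; exact: wtensor_smooth.
- by move=> c u _ _; rewrite /wtensor !trmx_mul trmxK tr_diag_mx mulmxA.
- move=> c u v Ac cu v0; rewrite /wtensor weighted_gram_quad.
  have [cx uE] := chart_cinvP smA Ac cu.
  have := iK _ c Ac cx; rewrite uE => /row_free_mulmxP/(_ v).
  move: (_ *m _) => y yv.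
  have y0 : y != 0 by apply/eqP => /yv /eqP; exact/negP.
  have [i yi] : exists i, y 0 i != 0.
    apply: contrapT => h; move/eqP: y0; apply; apply/rowP => i; rewrite mxE.
    by apply/eqP; apply: contrapT => /negP yi; apply: h; exists i.
  rewrite (bigD1 i)//=; apply: ltr_wpDr.
    by apply: sumr_ge0 => j _; rewrite mulr_ge0 ?sqr_ge0// ltW.
  by rewrite mulr_gt0// exprn_even_gt0.
- move=> c e x Ac Ae cx ex.
  have dK := smooth_fun_differentiable sK Ae (chart_cod ex).
  have [_ JE] := jacobian_chart_change smA Ac Ae cx ex dK.
  by rewrite /wtensor JE weighted_gram_mul !(chart_cmapK smA).
Qed.

End WeightedMetric.

Section Pullback.
Context {M E : topologicalType} {d e : nat}.
Variables (A : set (chart R M d)) (C : set (chart R E e)).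
Hypothesis smA : smooth_manifold A.
Hypothesis chC : forall c, C c -> is_chart c.
Variable q : E -> M.
Lemma local_rep_domE c b : C c -> A b ->
  cmap c @` (cdom c `&` setT `&` q @^-1` cdom b) = ccod c `&` cinv c @^-1` (q @^-1` cdom b).
Proof.
move=> Cc Ab; have [_ _ _ _ cK] := chC Cc; apply/seteqP; split.
  by move=> _ [x [[cx _] bx] <-]; split; [exact: chart_cod|rewrite /preimage/= cK].
by move=> _ [[x cx <-]]; rewrite /preimage/= cK// => bx; exists x.
Qed.

Lemma local_rep_dom_open c b : continuous q -> C c -> A b ->
  open (cmap c @` (cdom c `&` setT `&` q @^-1` cdom b)).
Proof.
move=> cq Cc Ab; rewrite local_rep_domE//; have [_ oc _ cc _] := chC Cc.
rewrite openE => u [cu bu]; apply: filterI; first exact: (near_open oc cu).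
apply: (cc _ cu); apply: open_nbhs_nbhs; split=> //; apply: open_comp; last exact: (chart_open_dom smA).
by move=> x _; exact: cq.
Qed.

Hypothesis sq : smooth_map C A q.

Lemma smooth_map_continuous : continuous q.
Proof. by move=> x; have [+ _] := sq; apply. Qed.

Lemma local_rep_smooth c b : C c -> A b ->
  Cinfty (cmap c @` (cdom c `&` setT `&` q @^-1` cdom b)) (local_rep q c b).
Proof. by move=> Cc Ab; have [_] := sq; apply. Qed.

Lemma smooth_fun_comp N (K : M -> 'rV[R]_N) : smooth_fun A K -> smooth_fun C (K \o q).
Proof.
move=> sK c Cc k; apply: Ck_pointwise => u cu.
have [b Ab bx] := chart_covers smA (q (cinv c u)).
have oU := local_rep_dom_open smooth_map_continuous Cc Ab.
set U := (cmap c @` _) in oU.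
have Uu : U u by rewrite /U local_rep_domE.
apply: (Ck_subset (U := U)); first by move=> _ ->.
apply: (@Ck_ext _ _ _ _ _ ((K \o cinv b) \o local_rep q c b)) => //.
  by move=> v; rewrite /U local_rep_domE// /local_rep => -[cv bv] /=; rewrite (chart_cmapK smA).
apply: (@Ck_comp_mx _ _ _ _ _ _ _ (ccod b)) => //.
- exact: (chart_open_cod smA).
- by move=> v; rewrite /U local_rep_domE// => -[cv bv]; exists (q (cinv c v)).
- exact: local_rep_smooth.
- exact: sK.
Qed.

Lemma local_rep_differentiable c b u : C c -> A b -> ccod c u -> cdom b (q (cinv c u)) ->
  differentiable (local_rep q c b) u.
Proof.
move=> Cc Ab cu bx; have [+ _] := local_rep_smooth Cc Ab 1; apply.
by rewrite local_rep_domE.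
Qed.

Lemma jacobian_pullback N (K : M -> 'rV[R]_N) c b u : smooth_fun A K ->
  C c -> A b -> ccod c u -> cdom b (q (cinv c u)) ->
  'J ((K \o q) \o cinv c) u = 'J (local_rep q c b) u *m 'J (K \o cinv b) (cmap b (q (cinv c u))).
Proof.
move=> sK Cc Ab cu bx.
have dr := local_rep_differentiable Cc Ab cu bx.
have dK := smooth_fun_differentiable sK Ab (chart_cod bx).
have [] // := @jacobian_comp_near _ _ _ _ (local_rep q c b) (K \o cinv b) ((K \o q) \o cinv c) u.
have := near_open (local_rep_dom_open smooth_map_continuous Cc Ab); rewrite local_rep_domE// => h.
apply: filterS (h u _) => // v [cv bv] /=; rewrite /local_rep /= (chart_cmapK smA)//.
Qed.

(** By the chain rule a pullback just composes [K] and [W] with [q]. The metrics on a covering and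
    on a slice, and the speed of a path, thus all remain weighted sums of squares. *)
Lemma pullback_wtensor N (K W : M -> 'rV[R]_N) g c u : smooth_fun A K -> is_wtensor A K W g ->
  C c -> ccod c u -> pullback A g q c u = wtensor (K \o q) (W \o q) c u.
Proof.
move=> sK gE Cc cu; have [b0 Ab0 bx0] := chart_covers smA (q (cinv c u)).
rewrite /pullback; apply: xget_unique; last first.
  move=> _ [b [Ab bx ->]]; rewrite gE// /wtensor.
  by rewrite (jacobian_pullback sK Cc Ab cu bx) weighted_gram_mul (chart_cmapK smA).
exists b0; split=> //; rewrite gE// /wtensor.
by rewrite (jacobian_pullback sK Cc Ab0 cu bx0) weighted_gram_mul (chart_cmapK smA).
Qed.

Lemma is_wtensor_pullback N (K W : M -> 'rV[R]_N) g : smooth_fun A K -> is_wtensor A K W g ->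
  is_wtensor C (K \o q) (W \o q) (pullback A g q).
Proof.
by move=> sK gE c x Cc cx; rewrite (pullback_wtensor sK gE)//; exact: chart_cod.
Qed.

End Pullback.

Section Speed.
Context {M : topologicalType} {d : nat}.
Variable A : set (chart R M d).
Hypothesis smA : smooth_manifold A.
Variable gamma : R -> M.
Hypothesis sg : smooth_map (@line_atlas R) A gamma.

Lemma scalar1_continuous : continuous (fun t : R => t%:M : 'rV[R]_1).
Proof.
move=> t; apply/mx_continuousP => i j; rewrite !ord1.
rewrite (_ : (fun y : R => _) = id); first exact: cvg_id.
by apply/funext => y; rewrite mxE eqxx mulr1n.
Qed.

Lemma line_ccod : ccod (@line_chart R) = setT.
Proof.
apply/seteqP; split=> // u _; exists (u 0 0) => //.
by apply/rowP => i; rewrite ord1 mxE eqxx mulr1n.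
Qed.

Lemma line_is_chart (c : chart R R 1) : line_atlas c -> is_chart c.
Proof.
move=> ->; split; rewrite ?line_ccod.
- exact: openT.
- exact: openT.
- by move=> x _; exact: scalar1_continuous.
- by move=> u _; exact: coord_continuous.
- by move=> x _ /=; rewrite mxE eqxx mulr1n.
Qed.

Lemma smooth_path_continuous : continuous gamma.
Proof. by move=> t; have [+ _] := sg; apply. Qed.

Definition path_deriv N (K : M -> 'rV[R]_N) (i : 'I_N) (t : R) : R :=
  'J ((K \o gamma) \o cinv (@line_chart R)) t%:M 0 i.

Lemma smooth_fun_path N (K : M -> 'rV[R]_N) k : smooth_fun A K ->
  Ck k setT ((K \o gamma) \o cinv (@line_chart R)).
Proof.
move=> sK; rewrite -line_ccod.
by apply: (smooth_fun_comp smA line_is_chart sg sK).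
Qed.

Lemma path_deriv_continuous N (K : M -> 'rV[R]_N) i : smooth_fun A K -> continuous (path_deriv K i).
Proof.
move=> sK t.
have := Ck_partial 0 i openT (@smooth_fun_path N K 1 sK) => /(_ t%:M I) h.
by apply: (@continuous_comp _ _ _ (fun s : R => s%:M : 'rV[R]_1) _ t (@scalar1_continuous t) h).
Qed.

Lemma path_deriv_is_derive N (K : M -> 'rV[R]_N) i t : smooth_fun A K ->
  is_derive t (1 : R) (fun s => K (gamma s) 0 i) (path_deriv K i t).
Proof.
move=> sK; have [dk _] := @smooth_fun_path N K 1 sK.
rewrite /path_deriv; move: dk; set f := (_ \o _) => dk.
have df := dk t%:M I.
rewrite (jacobian_row 0 i df).
have [dc <-] := derive_coord 0 i (diff_derivable (v := delta_mx 0 0) df).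
have tE s : 0 + s *: (delta_mx 0 0 : 'rV[R]_1) = s%:M.
  by apply/rowP => j; rewrite add0r ord1 !mxE eqxx mulr1 mulr1n.
have := @is_derive_line _ _ _ (fun v => f v 0 i) 0 (delta_mx 0 0) t; rewrite tE => /(_ dc).
congr (is_derive _ _ _ _); apply/funext => s; rewrite tE.
by rewrite /f /= mxE eqxx mulr1n.
Qed.

Lemma speed_wtensor N (K W : M -> 'rV[R]_N) g t : smooth_fun A K -> is_wtensor A K W g ->
  speed A g gamma t = Num.sqrt (\sum_i W (gamma t) 0 i * path_deriv K i t ^+ 2).
Proof.
move=> sK gE; rewrite /speed.
rewrite (pullback_wtensor smA line_is_chart sg sK gE)//; last by rewrite line_ccod.
rewrite /wtensor weighted_gramE; congr Num.sqrt; apply: eq_bigr => i _.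
by rewrite -expr2 /= mxE eqxx mulr1n.
Qed.

Lemma speed_continuous N (K W : M -> 'rV[R]_N) g : smooth_fun A K -> smooth_fun A W ->
  is_wtensor A K W g -> continuous (speed A g gamma).
Proof.
move=> sK sW gE t.
rewrite (_ : speed A g gamma = Num.sqrt \o (fun t => \sum_i W (gamma t) 0 i * path_deriv K i t ^+ 2)).
  apply: continuous_comp; last exact: sqrt_continuous.
  apply: continuous_at_sum => i _; apply: continuousM.
    apply: (@continuous_comp _ _ _ gamma (fun x => W x 0 i)); first exact: smooth_path_continuous.
    by apply: continuous_coord_comp; exact: (smooth_fun_continuous smA sW).
  rewrite (_ : (fun x => _) = (fun x => path_deriv K i x * path_deriv K i x)).
    by apply: continuousM; exact: path_deriv_continuous.
  by apply/funext => x; rewrite expr2.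
by apply/funext => s /=; rewrite (speed_wtensor _ sK gE).
Qed.

End Speed.

End WeightedTensors.

(** * Lengths of paths control displacements *)

Section PathLength.
Context {R : realType}.

Lemma weighted_cauchy_schwarz N (w p q : 'rV[R]_N) : (forall i, 0 <= w 0 i) ->
  \sum_i w 0 i * p 0 i * q 0 i <=
    Num.sqrt (\sum_i w 0 i * p 0 i ^+ 2) * Num.sqrt (\sum_i w 0 i * q 0 i ^+ 2).
Proof.
move=> w0; pose s (x : 'rV[R]_N) : 'rV[R]_N := \row_i (Num.sqrt (w 0 i) * x 0 i).
have nE x : norm2 (s x) = Num.sqrt (\sum_i w 0 i * x 0 i ^+ 2).
  rewrite /norm2 sqnormE; congr Num.sqrt; apply: eq_bigr => i _.
  by rewrite mxE exprMn sqr_sqrtr.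
rewrite -!nE; apply: le_trans (dot_le_norm2 _ _); rewrite mxE; apply: ler_sum => i _.
by rewrite !mxE mulrACA -expr2 sqr_sqrtr// mulrA.
Qed.

(** Integrating from [-1] gives a primitive with two-sided derivatives at [0] and [1], so the ends
    of a path need no special treatment. *)
Lemma continuous_primitive (S : R -> R) : continuous S ->
  exists l : R -> R, (forall t : R, -1 < t -> t < 2 -> is_derive t (1 : R) l (S t)) /\
    (\int[lebesgue_measure]_(t in `[0%R, 1%R]) (S t)%:E)%E = (l 1 - l 0)%:E.
Proof.
move=> cS; pose l (t : R) : R := (\int[lebesgue_measure]_(x in `[-1, t]) (S x))%R.
have dl (t : R) : -1 < t -> t < 2 -> is_derive t (1 : R) l (S t).
  move=> t1 t2; have [] := @continuous_FTC1_closed R S (-1) t 2 t2 _ t1 (cS t).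
    apply: continuous_compact_integrable; first exact: segment_compact.
    exact: continuous_subspaceT.
  by move=> d1 d2; rewrite -d2 derive1E; exact/derivableP.
exists l; split=> //; rewrite EFinB; apply: continuous_FTC2 => //.
- exact: continuous_subspaceT.
- have cl (t : R) : -1 < t -> t < 2 -> {for t, continuous l}.
    move=> t1 t2; apply: differentiable_continuous; apply/derivable1_diffP.
    exact: (@ex_derive _ _ _ _ _ _ _ (dl t t1 t2)).
  split=> [t /[!in_itv]/= /andP[t0 t1]||].
  + by apply: (@ex_derive _ _ _ _ _ _ _ (dl t _ _)); lra.
  + by apply: cvg_at_right_filter; apply: cl; lra.
  + by apply: cvg_at_left_filter; apply: cl; lra.
- move=> t /[!in_itv]/= /andP[t0 t1]; rewrite derive1E.
  by apply: (@derive_val _ _ _ _ _ _ _ (dl t _ _)); lra.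
Qed.

Lemma le0_derive_nonincreasing (f df : R -> R) (s t : R) : s <= t ->
  (forall x : R, s <= x -> x <= t -> is_derive x (1 : R) f (df x)) ->
  (forall x : R, s <= x -> x <= t -> df x <= 0) -> f t <= f s.
Proof.
move=> st dfE df0.
have [||c] := @MVT_segment R f df s t st.
- by move=> x /[!in_itv]/= /andP[sx xt]; apply: dfE; exact: ltW.
- apply: derivable_within_continuous => x /[!in_itv]/= /andP[sx xt].
  exact: (@ex_derive _ _ _ _ _ _ _ (dfE x sx xt)).
rewrite in_itv/= => /andP[sc ct] E; rewrite -subr_le0 E.
by rewrite mulr_le0_ge0 ?subr_ge0// df0.
Qed.

(* [K] moves by at most [a] along some path from [y] to [y'], in every constant weighted norm
   that the weights [W] dominate on the path. *)
Definition controlled (E : topologicalType) N (K W : E -> 'rV[R]_N) (y y' : E) (a : R) :=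
  exists gamma : R -> E, [/\ continuous gamma, gamma 0 = y, gamma 1 = y' &
    forall (w : 'rV[R]_N) (D : set E), (forall i, 0 <= w 0 i) ->
      (forall x i, D x -> w 0 i <= W x 0 i) -> (forall t : R, 0 <= t -> t <= 1 -> D (gamma t)) ->
      forall t : R, 0 <= t -> t <= 1 ->
        \sum_i w 0 i * (K (gamma t) 0 i - K y 0 i) ^+ 2 <= a ^+ 2].

(** What is kept of a piecewise smooth path: steps of length less than [theta], with total [l].
    Arguments along a path become inductions on short steps. *)
Inductive chain (E : topologicalType) N (K W : E -> 'rV[R]_N) (theta : R) (x : E) :
    E -> R -> Prop :=
| chain_refl : chain K W theta x x 0
| chain_step y y' l a : chain K W theta x y l -> 0 <= a -> a < theta ->
    controlled K W y y' a -> chain K W theta x y' (l + a).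

Section Lengths.
Context {M : topologicalType} {d N : nat}.
Variable A : set (chart R M d).
Hypothesis smA : smooth_manifold A.
Variables (K W : M -> 'rV[R]_N) (g : tensor2 R M d).
Hypotheses (sK : smooth_fun A K) (sW : smooth_fun A W) (gE : is_wtensor A K W g).

(** Project on the total displacement [u]: by Cauchy-Schwarz the weighted product of [u] with
    [K (gamma x)] grows at most at the rate [c] times the speed, where [c] is the weighted norm of
    [u]. So [phi] is nonincreasing, which reads [c ^+ 2 <= c * (l t - l s)]. *)
Lemma speed_displacement (gamma : R -> M) (l : R -> R) (w : 'rV[R]_N) (s t : R) :
  smooth_map (@line_atlas R) A gamma -> s <= t ->
  (forall x : R, s <= x -> x <= t -> is_derive x (1 : R) l (speed A g gamma x)) ->
  (forall i, 0 <= w 0 i) ->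
  (forall (x : R) i, s <= x -> x <= t -> w 0 i <= W (gamma x) 0 i) ->
  \sum_i w 0 i * (K (gamma t) 0 i - K (gamma s) 0 i) ^+ 2 <= (l t - l s) ^+ 2.
Proof.
move=> sg st dl w0 wW.
pose u : 'rV[R]_N := K (gamma t) - K (gamma s).
have -> : \sum_i w 0 i * (K (gamma t) 0 i - K (gamma s) 0 i) ^+ 2 = \sum_i w 0 i * u 0 i ^+ 2.
  by apply: eq_bigr => i _; rewrite !mxE.
set q := \sum_i _.
have q0 : 0 <= q by apply: sumr_ge0 => i _; rewrite mulr_ge0// sqr_ge0.
pose c := Num.sqrt q.
have c0 : 0 <= c by exact: sqrtr_ge0.
have cc : c ^+ 2 = q by rewrite sqr_sqrtr.
pose phi x := \sum_i w 0 i * u 0 i * K (gamma x) 0 i - c * l x.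
pose dphi x := \sum_i w 0 i * u 0 i * path_deriv gamma K i x - c * speed A g gamma x.
have : phi t <= phi s.
  apply: (@le0_derive_nonincreasing _ dphi) => // x sx xt.
    apply: is_deriveB; last by apply: is_deriveZ; exact: dl.
    rewrite (_ : (fun y => _) = \sum_i (fun y => w 0 i * u 0 i * K (gamma y) 0 i)); last first.
      by apply/funext => y; rewrite fct_sumE.
    apply: is_derive_sum => i; apply: is_deriveZ.
    exact: (path_deriv_is_derive smA sg i x sK).
  rewrite /dphi subr_le0 (speed_wtensor smA sg x sK gE).
  pose v : 'rV[R]_N := \row_i path_deriv gamma K i x.
  have -> : \sum_i w 0 i * u 0 i * path_deriv gamma K i x = \sum_i w 0 i * u 0 i * v 0 i.
    by apply: eq_bigr => i _; rewrite [v 0 i]mxE.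
  apply: le_trans (weighted_cauchy_schwarz _ _ w0) _.
  apply: ler_wpM2l => //; apply: ler_wsqrtr; apply: ler_sum => i _.
  by rewrite [v 0 i]mxE ler_wpM2r ?sqr_ge0// wW.
have qE : q = \sum_i w 0 i * u 0 i * K (gamma t) 0 i - \sum_i w 0 i * u 0 i * K (gamma s) 0 i.
  rewrite -sumrB; apply: eq_bigr => i _.
  by rewrite -mulrBr !mxE expr2 !mulrA.
rewrite /phi => h; have {h} h : q <= c * (l t - l s) by rewrite qE; lra.
have [c00|cn] := eqVneq c 0; first by rewrite -cc c00 expr0n sqr_ge0.
have cp : 0 < c by rewrite lt_def cn.
move: h; rewrite -cc expr2 ler_pM2l// => h.
by rewrite -expr2 ler_pXn2r// nnegrE// (le_trans c0).
Qed.

Lemma speed_ge0 gamma t : 0 <= speed A g gamma t.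
Proof. exact: sqrtr_ge0. Qed.

Lemma path_chain (gamma : R -> M) theta x l0 : 0 < theta ->
  smooth_map (@line_atlas R) A gamma -> chain K W theta x (gamma 0) l0 ->
  exists2 l, length A g gamma = l%:E & chain K W theta x (gamma 1) (l0 + l).
Proof.
move=> th0 sg ch; have cS := speed_continuous smA sg sK sW gE.
have [l [dl lE]] := continuous_primitive cS.
exists (l 1 - l 0); first exact: lE.
have [B Bm] : exists B, forall t : R, 0 <= t -> t <= 1 -> speed A g gamma t <= B.
  have [|c _ h] := @EVT_max R (speed A g gamma) 0 1 ler01; first exact: continuous_subspaceT.
  by exists (speed A g gamma c) => t t0 t1; apply: h; rewrite in_itv/= t0.
have B0 : 0 <= B by apply: le_trans (Bm 0 _ _) => //; exact: speed_ge0.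
have lB (s t : R) : 0 <= s -> s <= t -> t <= 1 -> l t - l s <= B * (t - s).
  move=> s0 st t1; have := @le0_derive_nonincreasing (fun x => l x - B * x)
    (fun x => speed A g gamma x - B * 1) s t st.
  have -> : (l t - l s <= B * (t - s)) = (l t - B * t <= l s - B * s) by lra.
  apply=> y sy yt.
    apply: is_deriveB; first by apply: dl; lra.
  by rewrite mulr1 subr_le0 Bm//; lra.
have l_mono (s t : R) : 0 <= s -> s <= t -> t <= 1 -> 0 <= l t - l s.
  move=> s0 st t1; have := @le0_derive_nonincreasing (fun x => - l x)
    (fun x => - speed A g gamma x) s t st.
  rewrite subr_ge0 -(lerN2 (l t)); apply=> y sy yt.
    by apply: is_deriveN; apply: dl; lra.
  by rewrite oppr_le0 speed_ge0.
(* Equal subdivision of [[0, 1]]: the speed is at most [B], so more than [B / theta] pieces are each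
   shorter than [theta]. *)
pose n := (Num.truncn (B / theta)).+1.
have n0 : 0 < n%:R :> R by rewrite ltr0n.
have nB : B / n%:R < theta.
  rewrite ltr_pdivrMr// mulrC -ltr_pdivrMr//.
  by apply: lt_le_trans (truncnS_gt _) _.
have step k : (k <= n)%N ->
    chain K W theta x (gamma (k%:R / n%:R)) (l0 + (l (k%:R / n%:R) - l 0)).
  elim: k => [_|k IH kn]; first by rewrite mul0r subrr addr0.
  pose s : R := k%:R / n%:R; pose t : R := k.+1%:R / n%:R.
  have s0 : 0 <= s by rewrite divr_ge0.
  have tsE : t - s = n%:R^-1 by rewrite /t /s -mulrBl -natrB// subSnn mul1r.
  have st : s <= t by rewrite -subr_ge0 tsE invr_ge0.
  have t1 : t <= 1 by rewrite ler_pdivrMr// mul1r ler_nat.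
  have -> : l0 + (l t - l 0) = (l0 + (l s - l 0)) + (l t - l s) by ring.
  apply: (chain_step (IH (ltnW kn))); first exact: l_mono.
    by apply: le_lt_trans (lB _ _ s0 st t1) _; rewrite tsE.
  have ct : continuous (fun r : R => s + r * (t - s)).
    by move=> r; apply: cvgD; [exact: cvg_cst|apply: cvgM; [exact: cvg_id|exact: cvg_cst]].
  exists (fun r => gamma (s + r * (t - s))); split.
  - move=> r; apply: (@continuous_comp _ _ _ (fun r : R => s + r * (t - s)) gamma); first exact: ct.
    exact: (smooth_path_continuous sg).
  - by rewrite mul0r addr0.
  - by rewrite mul1r addrC subrK.
  move=> w D w0 wW gD r r0 r1.
  have sr : s <= s + r * (t - s) by rewrite lerDl mulr_ge0// subr_ge0.
  have rt : s + r * (t - s) <= t.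
    by rewrite -lerBrDl ler_piMl// subr_ge0.
  apply: (@le_trans _ _ ((l (s + r * (t - s)) - l s) ^+ 2)).
    apply: speed_displacement => //.
      move=> y sy yr; apply: dl; first exact: lt_le_trans (ltrN10 R) (le_trans s0 sy).
      by apply: le_lt_trans (le_trans yr (le_trans rt t1)) _; rewrite ltr1n.
    move=> y i sy yr; apply: wW.
    have [ts|ts] := eqVneq t s; first by have := tsE; rewrite ts subrr => /esym/eqP; rewrite invr_eq0 gt_eqF.
    have ts0 : 0 < t - s by rewrite subr_gt0 lt_def ts.
    have -> : y = s + ((y - s) / (t - s)) * (t - s) by rewrite divfK ?gt_eqF// addrC subrK.
    apply: gD; first by rewrite divr_ge0 ?subr_ge0// ltW.
    by rewrite ler_pdivrMr// mul1r lerD2r; exact: le_trans yr rt.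
  have h1 : 0 <= l (s + r * (t - s)) - l s by apply: l_mono => //; exact: le_trans rt t1.
  rewrite ler_pXn2r ?nnegrE//; first by rewrite lerB//; rewrite -subr_ge0; exact: l_mono (le_trans s0 sr) rt t1.
  exact: l_mono.
by have := step n (leqnn n); rewrite divff ?gt_eqF.
Qed.

Lemma joined_chain theta x y L : 0 < theta -> joined A g x y L ->
  exists2 l, L = l%:E & chain K W theta x y l.
Proof.
move=> th0; elim=> [|gamma L' _ [l0 -> ch] sg]; first by exists 0 => //; exact: chain_refl.
have [l lE ch'] := path_chain th0 sg ch.
by exists (l0 + l) => //; rewrite lE EFinD.
Qed.

Lemma rball_chain theta x r y : 0 < theta -> rball A g x r y ->
  exists2 l, l < r & chain K W theta x y l.
Proof.
move=> th0; rewrite /rball /rdist /= => /ereal_inf_lt[L /= j Lr].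
have [l lE ch] := joined_chain th0 j.
by exists l => //; move: Lr; rewrite lE lte_fin.
Qed.

End Lengths.

End PathLength.

(** * Products of manifolds *)

Section RowBlocks.
Context {R : realType}.

Lemma Ck_row_mx (V : normedModType R) k (U : set V) N1 N2 (f1 : V -> 'rV[R]_N1) (f2 : V -> 'rV[R]_N2) :
  open U -> Ck k U f1 -> Ck k U f2 -> Ck k U (fun y => row_mx (f1 y) (f2 y)).
Proof.
move=> oU C1 C2; apply/Ck_mxP => // i j; rewrite ord1; case: (split_ordP j) => l ->.
  have /(Ck_mxP _ _ oU)/(_ 0 l) := C1; apply: Ck_ext => // u _ /=.
  by rewrite row_mxEl.
have /(Ck_mxP _ _ oU)/(_ 0 l) := C2; apply: Ck_ext => // u _ /=.
by rewrite row_mxEr.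
Qed.

Lemma Ck_lsubmx k n1 n2 (U : set 'rV[R]_(n1 + n2)) : open U -> Ck k U (@lsubmx R 1 n1 n2).
Proof.
move=> oU; apply/Ck_mxP => // i j; rewrite ord1.
by apply: (Ck_ext (f := fun u : 'rV[R]_(n1 + n2) => u 0 (lshift n2 j))) => // [u _|];
  [rewrite mxE|exact: Ck_coord].
Qed.

Lemma Ck_rsubmx k n1 n2 (U : set 'rV[R]_(n1 + n2)) : open U -> Ck k U (@rsubmx R 1 n1 n2).
Proof.
move=> oU; apply/Ck_mxP => // i j; rewrite ord1.
by apply: (Ck_ext (f := fun u : 'rV[R]_(n1 + n2) => u 0 (rshift n1 j))) => // [u _|];
  [rewrite mxE|exact: Ck_coord].
Qed.

Lemma lsubmx_continuous n1 n2 : continuous (@lsubmx R 1 n1 n2).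
Proof. by move=> u; have := @Ck_lsubmx 0 n1 n2 setT openT; apply. Qed.

Lemma rsubmx_continuous n1 n2 : continuous (@rsubmx R 1 n1 n2).
Proof. by move=> u; have := @Ck_rsubmx 0 n1 n2 setT openT; apply. Qed.

Lemma row_mx_continuous (T : topologicalType) n1 n2 (f1 : T -> 'rV[R]_n1) (f2 : T -> 'rV[R]_n2) x :
  {for x, continuous f1} -> {for x, continuous f2} ->
  {for x, continuous (fun y => row_mx (f1 y) (f2 y))}.
Proof.
move=> c1 c2; apply/mx_continuousP => i j; rewrite ord1; case: (split_ordP j) => l ->.
  rewrite (_ : (fun y => _) = (fun y => f1 y 0 l)); first exact: continuous_coord_comp.
  by apply/funext => y; rewrite row_mxEl.
rewrite (_ : (fun y => _) = (fun y => f2 y 0 l)); first exact: continuous_coord_comp.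
by apply/funext => y; rewrite row_mxEr.
Qed.

Lemma derive_comp_linear (V W Z : normedModType R) (L : {linear V -> W}) (f : W -> Z) u w :
  'D_w (f \o L) u = 'D_(L w) f (L u).
Proof.
rewrite /derive; set F := (X in X @ _); set G := (X in _ = lim (X @ _)).
suff -> : F = G by [].
apply/funext => h; rewrite /F /G /=.
by have -> : L (h *: w + u) = h *: L w + L u by exact: linearP.
Qed.

End RowBlocks.

Lemma openX (T1 T2 : topologicalType) (U : set T1) (V : set T2) :
  open U -> open V -> open (U `*` V).
Proof.
move=> oU oV; rewrite openE => -[x y] [/= Ux Vy]; exists (U, V) => //=.
by split; apply: open_nbhs_nbhs.
Qed.

Section ProductManifold.
Context {R : realType} {M1 M2 : topologicalType} {n1 n2 : nat}.
Variables (A : set (chart R M1 n1)) (B : set (chart R M2 n2)).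
Hypotheses (smA : smooth_manifold A) (smB : smooth_manifold B).

Lemma prod_cod (c : chart R M1 n1) (e : chart R M2 n2) :
  ccod (prod_chart c e) = [set u | ccod c (lsubmx u) /\ ccod e (rsubmx u)].
Proof.
apply/seteqP; split=> [_ [[x y] [cx ey] <-]|u [[x cx xu] [y ey yu]]].
  by rewrite /= row_mxKl row_mxKr; split; exact: chart_cod.
by exists (x, y) => //=; rewrite xu yu hsubmxK.
Qed.

Lemma prod_is_chart (c : chart R M1 n1) (e : chart R M2 n2) :
  is_chart c -> is_chart e -> is_chart (prod_chart c e).
Proof.
move=> [od oc cc ci cK] [od' oc' cc' ci' cK']; split.
- by apply: openX.
- rewrite prod_cod; apply: openI.
    by apply: open_comp => // u _; exact: lsubmx_continuous.
  by apply: open_comp => // u _; exact: rsubmx_continuous.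
- move=> [x y] [/= cx ey]; apply: row_mx_continuous.
    by apply: (@continuous_comp _ _ _ fst); [exact: cvg_fst|exact: cc].
  by apply: (@continuous_comp _ _ _ snd); [exact: cvg_snd|exact: cc'].
- move=> u; rewrite prod_cod => -[cu eu]; apply: cvg_pair => /=.
    exact: nbhs_filter.
    exact: (@continuous_comp _ _ _ (@lsubmx R 1 n1 n2) (cinv c) u (@lsubmx_continuous _ n1 n2 u) (ci _ cu)).
  exact: (@continuous_comp _ _ _ (@rsubmx R 1 n1 n2) (cinv e) u (@rsubmx_continuous _ n1 n2 u) (ci' _ eu)).
- by move=> [x y] [/= cx ey]; rewrite row_mxKl row_mxKr cK// cK'.
Qed.

Lemma prod_hausdorff (T1 T2 : topologicalType) :
  hausdorff_space T1 -> hausdorff_space T2 -> hausdorff_space (T1 * T2)%type.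
Proof.
move=> h1 h2 p q pq; rewrite (surjective_pairing p) (surjective_pairing q); congr (_, _).
  apply: h1 => U V pU qV; have [[x y] [/= xU xV]] :=
    pq (fst @^-1` U) (fst @^-1` V) (cvg_fst pU) (cvg_fst qV).
  by exists x.
apply: h2 => U V pU qV; have [[x y] [/= xU xV]] :=
  pq (snd @^-1` U) (snd @^-1` V) (cvg_snd pU) (cvg_snd qV).
by exists y.
Qed.

Lemma prod_second_countable (T1 T2 : topologicalType) :
  @second_countable T1 -> @second_countable T2 -> @second_countable (T1 * T2)%type.
Proof.
move=> [B1 c1 [p1 b1]] [B2 c2 [p2 b2]].
exists ((fun P => P.1 `*` P.2) @` (B1 `*` B2)).
  by apply: card_le_trans (card_image_le _ _) _; exact: countableX.
split=> [_ [[U V] [/= BU BV] <-]|[x y] W [[U V] [/= xU yV] UVW]].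
  by apply: openX; [exact: p1|exact: p2].
have [U' [BU' U'x] UU'] := b1 x U xU; have [V' [BV' V'y] VV'] := b2 y V yV.
exists (U' `*` V'); first by split=> //; exists (U', V').
by move=> [a b] [/= Ua Vb]; apply: UVW; split; [exact: UU'|exact: VV'].
Qed.

Lemma prod_transition_dom (c c' : chart R M1 n1) (e e' : chart R M2 n2) :
  cmap (prod_chart c e) @` (cdom (prod_chart c e) `&` cdom (prod_chart c' e')) =
  [set u | (cmap c @` (cdom c `&` cdom c')) (lsubmx u) /\
           (cmap e @` (cdom e `&` cdom e')) (rsubmx u)].
Proof.
apply/seteqP; split=> [_ [[x y] [[/= cx ey] [cx' ey']] <-]|u [[x [cx cx'] xu] [y [ey ey'] yu]]].
  by rewrite /= row_mxKl row_mxKr; split; [exists x|exists y].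
by exists (x, y) => //=; rewrite xu yu hsubmxK.
Qed.

Lemma prod_smooth_manifold : smooth_manifold (prod_atlas A B).
Proof.
have [hA scA cA covA tA] := smA; have [hB scB cB covB tB] := smB; split.
- exact: prod_hausdorff.
- exact: prod_second_countable.
- by move=> _ [c [e [Ac Be ->]]]; apply: prod_is_chart; [exact: cA|exact: cB].
- move=> [x y]; have [c Ac cx] := covA x; have [e Be ey] := covB y.
  by exists (prod_chart c e) => //; exists c, e.
move=> _ _ [c [e [Ac Be ->]]] [c' [e' [Ac' Be' ->]]] k.
have oU : open (cmap c @` (cdom c `&` cdom c')) by apply: (image_cmap_open smA) => //; exact: (chart_open_dom smA).
have oV : open (cmap e @` (cdom e `&` cdom e')) by apply: (image_cmap_open smB) => //; exact: (chart_open_dom smB).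
have oW : open (cmap (prod_chart c e) @` (cdom (prod_chart c e) `&` cdom (prod_chart c' e'))).
  rewrite prod_transition_dom; apply: openI.
    by apply: open_comp => // u _; exact: lsubmx_continuous.
  by apply: open_comp => // u _; exact: rsubmx_continuous.
apply: (Ck_row_mx (f1 := transition c c' \o lsubmx) (f2 := transition e e' \o rsubmx)) => //.
  apply: (@Ck_comp_mx _ _ _ _ _ _ _ _ _ _ oW oU); last exact: tA.
    by rewrite prod_transition_dom => u [].
  exact: Ck_lsubmx.
apply: (@Ck_comp_mx _ _ _ _ _ _ _ _ _ _ oW oV); last exact: tB.
  by rewrite prod_transition_dom => u [].
exact: Ck_rsubmx.
Qed.

Lemma prod_cod_open c e : A c -> B e -> open (ccod (prod_chart c e)).
Proof. by move=> Ac Be; apply: (chart_open_cod prod_smooth_manifold); exists c, e. Qed.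

Lemma smooth_fun_fst N (K : M1 -> 'rV[R]_N) : smooth_fun A K -> smooth_fun (prod_atlas A B) (K \o fst).
Proof.
move=> sK _ [c [e [Ac Be ->]]] k; have oc := prod_cod_open Ac Be.
rewrite (_ : _ \o _ = (K \o cinv c) \o lsubmx)//.
apply: (@Ck_comp_mx _ _ _ _ _ _ _ _ _ _ oc (chart_open_cod smA Ac)); last exact: sK.
  by rewrite prod_cod => u [].
exact: Ck_lsubmx.
Qed.

Lemma smooth_fun_snd N (K : M2 -> 'rV[R]_N) : smooth_fun B K -> smooth_fun (prod_atlas A B) (K \o snd).
Proof.
move=> sK _ [c [e [Ac Be ->]]] k; have oc := prod_cod_open Ac Be.
rewrite (_ : _ \o _ = (K \o cinv e) \o rsubmx)//.
apply: (@Ck_comp_mx _ _ _ _ _ _ _ _ _ _ oc (chart_open_cod smB Be)); last exact: sK.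
  by rewrite prod_cod => u [].
exact: Ck_rsubmx.
Qed.

Lemma immersive_prod N1 N2 (K1 : M1 -> 'rV[R]_N1) (K2 : M2 -> 'rV[R]_N2) p :
  smooth_fun A K1 -> smooth_fun B K2 -> immersive_at A K1 p.1 -> immersive_at B K2 p.2 ->
  immersive_at (prod_atlas A B) (fun q => row_mx (K1 q.1) (K2 q.2)) p.
Proof.
move=> s1 s2 i1 i2 g Ag gp; have [c [e [Ac Be gE]]] := Ag.
apply/row_free_mulmxP => w.
have d1 := smooth_fun_differentiable (smooth_fun_fst s1) Ag (chart_cod gp).
have d2 := smooth_fun_differentiable (smooth_fun_snd s2) Ag (chart_cod gp).
have [dr Dr] := derive_row_mx w d1 d2.
have /(smooth_fun_differentiable s1 Ac) dc : ccod c (cmap c p.1).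
  by move: gp; rewrite gE => -[]; exists p.1.
have /(smooth_fun_differentiable s2 Be) de : ccod e (cmap e p.2).
  by move: gp; rewrite gE => -[]; exists p.2.
rewrite -(deriveEjacobian w dr) [LHS]Dr -[RHS]row_mx0 => /eq_row_mx[].
rewrite gE (_ : (K1 \o fst) \o _ = (K1 \o cinv c) \o lsubmx)//.
rewrite (_ : (K2 \o snd) \o _ = (K2 \o cinv e) \o rsubmx)//.
rewrite !derive_comp_linear /= row_mxKl row_mxKr.
rewrite (deriveEjacobian _ dc) (deriveEjacobian _ de) => E1 E2.
move: gp; rewrite gE => -[/= cp ep].
have /row_free_mulmxP/(_ _ E1) w1 := i1 c Ac cp.
have /row_free_mulmxP/(_ _ E2) w2 := i2 e Be ep.
by rewrite -(hsubmxK w) w1 w2 row_mx0.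
Qed.

Section Slice.
Context {E : topologicalType} {e : nat}.
Variables (C : set (chart R E e)) (q : E -> M1) (x0 : M2).
Hypothesis chC : forall c, C c -> is_chart c.

(** A general [q] serves twice: with the identity for the slice itself, and with the projection from
    [Sigma * R] for its constant isotopy. *)
Lemma smooth_map_slice : smooth_map C A q -> smooth_map C (prod_atlas A B) (fun y => (q y, x0)).
Proof.
move=> sq; split=> [y _|c _ Cc [a [b [Aa Bb ->]]] k].
  by apply: cvg_pair => /=; [exact: (smooth_map_continuous sq)|exact: cvg_cst].
have [bx|nbx] := pselect (cdom b x0); last first.
  rewrite (_ : cmap c @` _ = set0); last by apply/seteqP; split=> // u [y [_ [_ /= bx]]].
  by apply: Ck_pointwise.
have -> : cmap c @` (cdom c `&` setT `&` (fun y => (q y, x0)) @^-1` cdom (prod_chart a b)) =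
   cmap c @` (cdom c `&` setT `&` q @^-1` cdom a).
  by congr (_ @` (_ `&` _)); apply/seteqP; split=> y //= [].
have oU := local_rep_dom_open smA chC (smooth_map_continuous sq) Cc Aa.
apply: (Ck_row_mx (f1 := local_rep q c a) (f2 := fun _ => cmap b x0)) => //.
  exact: (local_rep_smooth sq).
exact: Ck_cst.
Qed.

End Slice.

Lemma smooth_map_id : smooth_map A A id.
Proof.
split=> [x _|a b Aa Ab]; first exact: cvg_id.
rewrite (_ : cdom a `&` setT `&` _ = cdom a `&` cdom b); last by rewrite setIT.
exact: (transition_smooth smA).
Qed.

Lemma smooth_map_fst : (forall e, B e -> is_chart e) -> smooth_map (prod_atlas A B) A fst.
Proof.
move=> chB; split=> [x _|_ b [a [e [Aa Be ->]]] Ab k]; first exact: cvg_fst.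
have oU : open (cmap a @` (cdom a `&` cdom b)) by apply: (image_cmap_open smA) => //; exact: (chart_open_dom smA).
have oW : open (cmap (prod_chart a e) @` (cdom (prod_chart a e) `&` setT `&` fst @^-1` cdom b)).
  apply: (local_rep_dom_open smA _ _ (C := prod_atlas A B)) => //.
  - move=> _ [c [f [Ac Bf ->]]]; apply: prod_is_chart; last exact: chB.
    by have [_ _ h _ _] := smA; exact: h.
  - by move=> x; exact: cvg_fst.
  - by exists a, e.
apply: (@Ck_comp_mx _ _ _ _ _ _ _ _ (@lsubmx R 1 n1 n2) (transition a b) oW oU).
- by move=> _ [[x y] [[[/= ax _] _] bx] <-] /=; rewrite row_mxKl; exists x.
- exact: Ck_lsubmx.
- exact: (transition_smooth smA).
Qed.

Lemma slice_embedding x0 : embedding A (prod_atlas A B) (fun s => (s, x0)).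
Proof.
have cA : forall c, A c -> is_chart c by have [] := smA.
split.
- by apply: smooth_map_slice => //; exact: smooth_map_id.
- move=> a _ x Aa [b [e [Ab Be ->]]] ax [/= bx ex].
  have dt := transition_differentiable smA Aa Ab ax bx.
  have [dr Dr] := derive_row_mx 0 dt (@differentiable_cst _ _ _ (cmap e x0) (cmap a x)).
  apply/row_free_mulmxP => w; rewrite -(deriveEjacobian w dr).
  have [_ ->] := derive_row_mx w dt (@differentiable_cst _ _ _ (cmap e x0) (cmap a x)).
  rewrite -[RHS]row_mx0 => /eq_row_mx[+ _]; rewrite (deriveEjacobian w dt) => wJ.
  have ut := transition_jacobian_unit smA Aa Ab ax bx.
  by rewrite -(mulmxK ut w) wJ mul0mx.
- by move=> x y [].
- move=> U oU; exists (U `*` setT); first by apply: openX => //; exact: openT.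
  apply/seteqP; split=> [_ [x Ux <-]|[x y] [[/= Ux _] [z _ [zx xy]]]].
    by split=> //; exists x.
  by exists x => //; rewrite xy.
Qed.

End ProductManifold.

Section Line.
Context {R : realType}.

(** The small submanifold will itself be a slice, the one over the tip of the spike, so the isotopy
    can be constant in time. *)
Lemma slice_isotopic (M1 M2 : topologicalType) n1 n2 (A : set (chart R M1 n1)) (B : set (chart R M2 n2)) x0 :
  smooth_manifold A -> smooth_manifold B ->
  isotopic A (prod_atlas A B) (fun s => (s, x0)) (fun s => (s, x0)).
Proof.
move=> smA smB; exists (fun st => (st.1, x0)); split=> // [|t _]; last exact: slice_embedding.
have chL : forall c, prod_atlas A (@line_atlas R) c -> is_chart c.
  have [_ _ h _ _] := smA; move=> _ [c [e [Ac Le ->]]]; apply: prod_is_chart; first exact: h.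
  exact: line_is_chart.
apply: smooth_map_slice => //; apply: smooth_map_fst => // e; exact: line_is_chart.
Qed.

End Line.

(** * Lifting to coverings *)

Section ConvexSets.
Context {R : realType} {V : normedModType R}.

Definition convex_in (D : set V) := forall u v t, D u -> D v -> 0 <= t -> t <= 1 -> D (u + t *: (v - u)).

Lemma convex_connected (D : set V) : convex_in D -> connected D.
Proof.
move=> cD; have [[u0 Du0]|nD] := pselect (D !=set0); last first.
  rewrite (_ : D = set0); first exact: connected0.
  by apply/seteqP; split=> // u Du; apply: nD; exists u.
pose S u := (fun t : R => u0 + t *: (u - u0)) @` `[0, 1].
have -> : D = \bigcup_(u in D) S u.
  apply/seteqP; split=> [u Du|u [v Dv [t]]].
    exists u => //; exists 1; first by rewrite /= in_itv/= ler01 lexx.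
    by rewrite scale1r addrC subrK.
  by rewrite /= in_itv/= => /andP[t0 t1] <-; exact: cD.
apply: bigcup_connected.
  exists u0 => u Du; exists 0; first by rewrite /= in_itv/= ler01 lexx.
  by rewrite scale0r addr0.
move=> u Du; apply: connected_continuous_connected; first exact: segment_connected.
apply: continuous_subspaceT => t; apply: cvgD; first exact: cvg_cst.
by apply: cvgZr_tmp; exact: cvg_id.
Qed.

Definition sphere_ball (u0 : V) (r : R) : set V := [set u | `|u - u0| < r].

Lemma sphere_ball_convex u0 r : convex_in (sphere_ball u0 r).
Proof.
move=> u v t ur vr t0 t1; rewrite /sphere_ball /=.
have -> : u + t *: (v - u) - u0 = (1 - t) *: (u - u0) + t *: (v - u0).
  have -> : v - u = (v - u0) - (u - u0) by rewrite opprB addrA subrK.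
  by rewrite scalerBl scale1r scalerBr addrAC [_ - t *: (u - u0)]addrC addrA.
apply: le_lt_trans (ler_normD _ _) _; rewrite !normrZ !ger0_norm ?subr_ge0//.
have [t1'|t1'] := eqVneq t 1; first by rewrite t1' subrr mul0r add0r mul1r.
have h : (1 - t) * `|u - u0| < (1 - t) * r by rewrite ltr_pM2l// subr_gt0 lt_def eq_sym t1'.
have h' : t * `|v - u0| <= t * r by rewrite ler_wpM2l// ltW.
by have := ltr_leD h h'; rewrite -mulrDl subrK mul1r.
Qed.

Lemma sphere_ball_open u0 r : open (sphere_ball u0 r).
Proof.
have -> : sphere_ball u0 r = (fun u => `|u - u0|) @^-1` [set x | x < r] by [].
apply: open_comp => [u _|]; last exact: open_lt.
apply: (@continuous_comp _ _ _ (fun u => u - u0) (fun v => `|v|)); last exact: norm_continuous.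
by apply: cvgB; [exact: cvg_id|exact: cvg_cst].
Qed.

Lemma convex_inI (D D' : set V) : convex_in D -> convex_in D' -> convex_in (D `&` D').
Proof. by move=> cD cD' u v t [Du D'u] [Dv D'v] t0 t1; split; [exact: cD|exact: cD']. Qed.

(** Move from [b] toward the center by a fraction [t]: any positive fraction enters the open ball,
    and [t <= e / (2 * r)] keeps the point within [e] of [b]. *)
Lemma sphere_ball_meet u0 b r e : 0 < r -> 0 < e -> `|b - u0| <= r ->
  exists v, sphere_ball b e v /\ sphere_ball u0 r v.
Proof.
move=> r0 e0 br; pose t : R := Num.min (1 / 2) (e / (2 * r)).
have t0 : 0 < t by rewrite lt_min !divr_gt0// mulr_gt0.
have th : t <= 1 / 2 by rewrite ge_min lexx.
have te : t <= e / (2 * r) by rewrite ge_min lexx orbT.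
exists (b + t *: (u0 - b)); rewrite /sphere_ball /=; split.
  rewrite addrC addKr normrZ ger0_norm ?ltW//.
  apply: le_lt_trans (ler_wpM2l (ltW t0) (_ : _ <= r)) _; first by rewrite distrC.
  apply: le_lt_trans (ler_wpM2r (ltW r0) te) _.
  rewrite invfM mulrA mulfVK ?gt_eqF//.
  by rewrite ltr_pdivrMr// ltr_pMr// ltr1n.
have -> : b + t *: (u0 - b) - u0 = (1 - t) *: (b - u0).
  by rewrite scalerBl scale1r -[u0 - b]opprB scalerN addrAC.
rewrite normrZ ger0_norm; last lra.
apply: le_lt_trans (ler_wpM2l _ br) _; first lra.
by rewrite gtr_pMl//; lra.
Qed.

End ConvexSets.

Section Lifts.
Context {E M : topologicalType}.
Variable p : E -> M.
Hypothesis hE : hausdorff_space E.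

(** All that lifting uses of a covering: over a small [W], a continuous section through each given
    point above [W], inverse to [p] near that point. *)
Definition local_section (W : set M) (e : E) (s : M -> E) :=
  [/\ s (p e) = e, forall y, W y -> {for y, continuous s},
      forall y, W y -> p (s y) = y & \forall z \near e, s (p z) = z].

Hypothesis loc : forall x, exists W, open_nbhs x W /\ forall e, W (p e) -> exists s, local_section W e s.

(** The set where the lifts agree is open in [D], since near such a point both are recovered from
    their projection by one local section, and closed in [D] because [E] is Hausdorff. *)
Lemma lift_unique (T : topologicalType) (D : set T) (a b : T -> E) t0 : connected D -> D t0 ->
  (forall t, D t -> {for t, continuous a}) -> (forall t, D t -> {for t, continuous b}) ->
  (forall t, D t -> p (a t) = p (b t)) -> a t0 = b t0 -> forall t, D t -> a t = b t.
Proof.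
move=> cD Dt0 ca cb pab ab0.
suff DE : D `&` [set t | a t = b t] = D by move=> t; rewrite -{1}DE => -[].
apply: cD; first by exists t0.
  exists ([set t | D t -> a t = b t]^°); first exact: open_interior.
  apply/seteqP; split=> t [Dt].
    move=> abt; split=> //; have [W [[oW Wt] sW]] := loc (p (a t)).
    have [s [_ _ _ spz]] := sW _ Wt.
    have na := ca t Dt _ spz; have spzb := spz; rewrite abt in spzb; have nb := cb t Dt _ spzb.
    rewrite /interior /=; near=> t' => Dt'.
    have -> : a t' = s (p (a t')) by apply/esym; near: t'.
    by rewrite pab//; near: t'.
  by move/interior_subset => /(_ Dt).
exists (~` ([set t | D t -> a t <> b t]^°)); first by apply: open_closedC; exact: open_interior.
apply/seteqP; split=> t [Dt].
  by move=> abt; split=> // /interior_subset/(_ Dt).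
move=> h; split=> //; apply: contrapT => abt; apply: h.
have : a t != b t by apply/eqP.
have hE' := hE; rewrite open_hausdorff in hE'; move=> /hE'[[U V] /= [/set_mem Ua /set_mem Vb] [oU oV UV0]].
have na := ca t Dt _ (open_nbhs_nbhs (conj oU Ua)); have nb := cb t Dt _ (open_nbhs_nbhs (conj oV Vb)).
rewrite /interior /=; near=> t' => _ abt'.
have : (U `&` V) (a t') by split; [near: t'|rewrite abt'; near: t'].
by rewrite (eqP UV0).
Unshelve. all: by end_near. Qed.

Context {R : realType} {d : nat}.
Variable q : 'rV[R]_d -> M.

Definition is_lift (D : set 'rV[R]_d) (s : 'rV[R]_d -> E) :=
  (forall u, D u -> {for u, continuous s}) /\ forall u, D u -> p (s u) = q u.

Lemma is_liftS D D' s : D' `<=` D -> is_lift D s -> is_lift D' s.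
Proof. by move=> D'D [cs ps]; split=> u /D'D; [exact: cs|exact: ps]. Qed.

Lemma is_lift_unique D s s' u0 : convex_in D -> D u0 -> is_lift D s -> is_lift D s' ->
  s u0 = s' u0 -> forall u, D u -> s u = s' u.
Proof.
move=> cD Du0 [cs ps] [cs' ps']; apply: lift_unique => //; first exact: convex_connected.
by move=> t Dt; rewrite ps// ps'.
Qed.

Lemma lift_glue (I : pointedType) (D : I -> set 'rV[R]_d) (s : I -> 'rV[R]_d -> E) (P : set I) :
  (forall i, P i -> open (D i)) -> (forall i, P i -> is_lift (D i) (s i)) ->
  (forall i j u, P i -> P j -> D i u -> D j u -> s i u = s j u) ->
  exists t, is_lift (\bigcup_(i in P) D i) t /\ forall i u, P i -> D i u -> t u = s i u.
Proof.
move=> oD ls ag; pose k u : I := xget point [set i | P i /\ D i u].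
have kP i u : P i -> D i u -> P (k u) /\ D (k u) u.
  by move=> Pi Du; apply: (xgetPex point (P := [set i | P i /\ D i u])); exists i.
have tE i u : P i -> D i u -> s (k u) u = s i u.
  by move=> Pi Du; have [Pk Dk] := kP i u Pi Du; exact: ag.
exists (fun u => s (k u) u); split=> //; split=> u [i Pi Du].
  apply: (@continuous_near_eq _ _ (s i)); last by have [cs _] := ls i Pi; exact: cs.
  by apply: filterS (near_open (oD i Pi) Du) => v Dv; apply/esym/tE.
by rewrite (tE i)//; have [_ ps] := ls i Pi; exact: ps.
Qed.

Lemma local_lift (D : set 'rV[R]_d) b : open D -> D b -> (forall u, D u -> {for u, continuous q}) ->
  exists2 r : R, 0 < r & forall v e', sphere_ball b r v -> p e' = q v ->
    exists s, is_lift (sphere_ball b r) s /\ s v = e'.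
Proof.
move=> oD Db cq; have [W [[oW Wb] sW]] := loc (q b).
have : nbhs b (D `&` q @^-1` W).
  by apply: filterI; [exact: (near_open oD Db)|apply: (cq b Db); exact: open_nbhs_nbhs].
move=> /nbhs_ballP[r /= r0 rD]; exists r => // v e' vr pe'.
have {}rD u : sphere_ball b r u -> D u /\ W (q u).
  by move=> ur; apply: rD; rewrite mx_norm_ball /ball_ /= distrC.
have Wv : W (p e') by rewrite pe'; have [] := rD v vr.
have [s [se' cs ps _]] := sW e' Wv; exists (s \o q); split; last by rewrite /= -pe'.
split=> u /rD[Du Wu]; last exact: ps.
by apply: continuous_comp; [exact: cq|exact: cs].
Qed.

(** Around each point of the closed ball there is a local lift that agrees with [s] on the common
    part. These local lifts agree with one another, and by compactness their domains contain a
    larger ball. *)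
Lemma lift_extend u0 r r1 s : (0 < r)%R -> (r < r1)%R ->
  (forall u, sphere_ball u0 r1 u -> {for u, continuous q}) ->
  is_lift (sphere_ball u0 r) s ->
  exists r' t, [/\ r < r', is_lift (sphere_ball u0 r') t & t u0 = s u0].
Proof.
move=> r0 rr1 cq ls; pose cB : set 'rV[R]_d := [set b | `|b - u0| <= r].
have [cs ps] := ls.
have u0r : sphere_ball u0 r u0 by rewrite /sphere_ball /= subrr normr0.
(* Each lift lives on a ball three times as large as the one retained. If two retained balls meet,
   the smaller is inside the tripled larger one, where uniqueness compares the two lifts. *)
have /choice[F hF] : forall b, exists F : R * ('rV[R]_d -> E), cB b ->
    [/\ 0 < F.1, is_lift (sphere_ball b (3 * F.1)) F.2 &
       forall v, sphere_ball b (3 * F.1) v -> sphere_ball u0 r v -> F.2 v = s v].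
  move=> b; have [bB|nbB] := pselect (cB b); last by exists (0, s).
  have b1 : sphere_ball u0 r1 b by rewrite /sphere_ball /=; exact: le_lt_trans bB rr1.
  have [e e0 he] := local_lift (@sphere_ball_open _ _ u0 r1) b1 cq.
  have [v [vb vu]] := sphere_ball_meet r0 e0 bB.
  have [t [lt tv]] := he v (s v) vb (ps v vu).
  exists (e / 3, t) => _ /=; have -> : 3 * (e / 3) = e by rewrite mulrC divfK// pnatr_eq0.
  split=> //; first by rewrite divr_gt0.
  move=> w wb wu.
  have cI := convex_inI (@sphere_ball_convex _ _ b e) (@sphere_ball_convex _ _ u0 r).
  apply: (is_lift_unique (s := t) (s' := s) cI (u0 := v)) => //.
    by apply: is_liftS lt => x [].
  by apply: is_liftS ls => x [].
pose D b := sphere_ball b (F b).1.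
have DS b : cB b -> D b `<=` sphere_ball b (3 * (F b).1).
  by move=> /hF[F0 _ _] u; rewrite /D /sphere_ball /= => /lt_le_trans; apply; lra.
have agw b b' u : cB b -> cB b' -> (F b').1 <= (F b).1 -> D b u -> D b' u -> (F b).2 u = (F b').2 u.
  move=> Bb Bb' FF Du D'u; have [Fb lb ab] := hF b Bb; have [Fb' lb' ab'] := hF b' Bb'.
  have sub : D b' `<=` sphere_ball b (3 * (F b).1).
    move=> w; rewrite /D /sphere_ball /= => wb'; move: Du D'u; rewrite /D /sphere_ball /= => Du D'u.
    have -> : w - b = (w - b') + ((b' - u) + (u - b)) by rewrite !addrA !subrK.
    apply: le_lt_trans (ler_normD _ _) _; apply: le_lt_trans (lerD (lexx _) (ler_normD _ _)) _.
    by rewrite (distrC b'); lra.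
  have [v [vb' vu]] := sphere_ball_meet r0 Fb' Bb'.
  apply: (is_lift_unique (D := D b') (u0 := v)) => //.
  - exact: sphere_ball_convex.
  - exact: is_liftS lb.
  - by apply: is_liftS lb'; exact: DS.
  - by rewrite ab ?ab'//; [exact: DS|exact: sub].
have ag b b' u : cB b -> cB b' -> D b u -> D b' u -> (F b).2 u = (F b').2 u.
  move=> Bb Bb' Du D'u; have [FF|/ltW FF] := leP (F b').1 (F b).1; first exact: agw.
  by apply/esym/agw.
have [t [lt tE]] := @lift_glue 'rV[R]_d D (fun b => (F b).2) cB
  (fun b _ => @sphere_ball_open _ _ b (F b).1)
  (fun b Bb => let: And3 _ l _ := hF b Bb in is_liftS (DS b Bb) l) ag.
have cBc : compact cB by exact: closed_ball_compact.
have oU : open (\bigcup_(b in cB) D b) by apply: bigcup_open => b _; exact: sphere_ball_open.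
have BU : cB `<=` \bigcup_(b in cB) D b.
  by move=> b Bb; exists b => //; rewrite /D /sphere_ball /= subrr normr0; have [] := hF b Bb.
have [e e0 eU] : exists2 e : R, 0 < e & forall u, `|u - u0| < r + e -> (\bigcup_(b in cB) D b) u.
  have oFb b : cB b -> open (sphere_ball b ((F b).1 / 2)) /\ sphere_ball b ((F b).1 / 2) b.
    move=> Bb; split; first exact: sphere_ball_open.
    by rewrite /sphere_ball /= subrr normr0 divr_gt0//; have [] := hF b Bb.
  have [sq [sqB sqC]] := compact_finite_subcover cBc oFb.
  have [e e0 he] : exists2 e : R, 0 < e & forall b, b \in sq -> e <= (F b).1 / 2.
    elim: sq sqB {sqC} => [|b sq IH] sqB; first by exists 1.
    have [|e e0 he] := IH; first by move=> x xs; apply: sqB; rewrite inE xs orbT.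
    exists (Num.min e ((F b).1 / 2)).
      by rewrite lt_min e0 divr_gt0//; have [] := hF b (sqB b (mem_head _ _)).
    by move=> x; rewrite inE => /orP[/eqP ->|/he xe]; rewrite ge_min ?lexx ?orbT// xe.
  exists e => // u ur; have [ur'|ur'] := leP `|u - u0| r; first exact: BU.
  have un0 : 0 < `|u - u0| by exact: lt_trans ur'.
  (* The radial projection of [u] to the closed ball. *)
  pose b := u0 + (r / `|u - u0|) *: (u - u0).
  have Bb : cB b.
    rewrite /cB /b /= addrC addKr normrZ (@ger0_norm _ (r / _)).
      by rewrite divfK ?gt_eqF.
    by rewrite divr_ge0// ltW.
  have [c cs' bc] := sqC b Bb; exists c; first exact: sqB.
  have ub : `|u - b| < e.
    have -> : u - b = (1 - r / `|u - u0|) *: (u - u0) by rewrite /b scalerBl scale1r opprD addrA.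
    rewrite normrZ ger0_norm; last by rewrite subr_ge0 ler_pdivrMr// mul1r ltW.
    by rewrite mulrBl mul1r divfK ?gt_eqF//; lra.
  rewrite /D /sphere_ball /=; have := he c cs'; move: bc; rewrite /sphere_ball /= => bc ec.
  have -> : u - c = (u - b) + (b - c) by rewrite addrA subrK.
  by apply: le_lt_trans (ler_normD _ _) _; lra.
exists (r + e), t; split; first by rewrite ltrDl.
  by apply: is_liftS lt => u; exact: eU.
have B0 : cB u0 by rewrite /cB /= subrr normr0 ltW.
have D0 : D u0 u0 by rewrite /D /sphere_ball /= subrr normr0; have [] := hF u0 B0.
by rewrite (tE u0)//; have [_ _] := hF u0 B0; apply=> //; exact: DS.
Qed.

(* The supremum of the radii up to which a lift exists cannot lie strictly below [r1]. *)
Lemma ball_lift u0 r1 e : 0 < r1 -> (forall u, sphere_ball u0 r1 u -> {for u, continuous q}) ->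
  p e = q u0 -> exists s, is_lift (sphere_ball u0 r1) s /\ s u0 = e.
Proof.
move=> r10 cq pe.
pose P (r : R) := 0 < r /\ exists s, is_lift (sphere_ball u0 r) s /\ s u0 = e.
have ball0 (r : R) : 0 < r -> sphere_ball u0 r u0 by move=> r0; rewrite /sphere_ball /= subrr normr0.
have ballS (r r' : R) : r <= r' -> sphere_ball u0 r `<=` sphere_ball u0 r'.
  by move=> rr u; rewrite /sphere_ball /= => /lt_le_trans; apply.
have [r0 r00 hr0] := local_lift (@sphere_ball_open _ _ u0 r1) (ball0 r1 r10) cq.
have P0 : P r0 by split=> //; apply: hr0 => //; exact: ball0.
have [[r [r1r [_ [s [ls se]]]]]|nP] := pselect (exists r, r1 <= r /\ P r).
  by exists s; split=> //; apply: is_liftS ls; exact: ballS.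
have Pub r : P r -> r <= r1.
  by move=> Pr; apply: contrapT => /negP; rewrite -ltNge => /ltW r1r; apply: nP; exists r.
have hs : has_sup P by split; [exists r0|exists r1 => r; exact: Pub].
pose rs := sup P.
have rs0 : 0 < rs by apply: lt_le_trans r00 _; exact: sup_upper_bound.
have rs1 : rs <= r1 by apply: sup_le_ub; [exists r0|move=> r; exact: Pub].
have /choice[S hS] : forall r, exists s, P r -> is_lift (sphere_ball u0 r) s /\ s u0 = e.
  by move=> r; have [[_ [s hs']]|nPr] := pselect (P r); [exists s|exists (fun=> e)].
have agw r r' u : P r -> P r' -> r <= r' -> sphere_ball u0 r u -> S r u = S r' u.
  move=> Pr Pr' rr ur; have [lr er] := hS r Pr; have [lr' er'] := hS r' Pr'.
  apply: (is_lift_unique (D := sphere_ball u0 r) (u0 := u0)) => //.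
  - exact: sphere_ball_convex.
  - by apply: ball0; case: Pr.
  - by apply: is_liftS lr'; exact: ballS.
  - by rewrite er er'.
have ag r r' u : P r -> P r' -> sphere_ball u0 r u -> sphere_ball u0 r' u -> S r u = S r' u.
  move=> Pr Pr' ur ur'; have [rr|/ltW rr] := leP r r'; first exact: agw.
  by apply/esym/agw.
have [t [lt tE]] := @lift_glue R (fun r => sphere_ball u0 r) S P
  (fun r _ => @sphere_ball_open _ _ u0 r) (fun r Pr => (hS r Pr).1)
  ag.
have {}lt : is_lift (sphere_ball u0 rs) t.
  apply: is_liftS lt => u urs; have ur0 : 0 < rs - `|u - u0| by rewrite subr_gt0.
  have [r Pr ur] := sup_adherent ur0 hs.
  by exists r => //; move: ur; rewrite subKr.
have te : t u0 = e by rewrite (tE r0)//; [have [] := hS r0 P0|exact: ball0].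
have [rs1'|rs1'] := ltP rs r1; last first.
  by exists t; split=> //; apply: is_liftS lt; exact: ballS.
have [r' [t' [rr' lt' te']]] := lift_extend rs0 rs1' cq lt.
have : P r' by split; [exact: lt_trans rr'|exists t'; rewrite te'].
by move/(sup_upper_bound hs); rewrite leNgt rr'.
Qed.

End Lifts.

(** * Volumes *)

Section BorelSets.
Context {R : realType}.

Lemma borelC (M : topologicalType) (T : set M) : borel T -> borel (~` T).
Proof. by move=> bT; rewrite /borel -setTD; exact: sigma_algebraCD. Qed.

Lemma borelI (M : topologicalType) (S T : set M) : borel S -> borel T -> borel (S `&` T).
Proof.
move=> bS bT; rewrite -[S `&` T]setCK; apply: borelC; rewrite setCI -bigcup2E.
apply: sigma_algebra_bigcup => -[|[|i]] /=; [exact: borelC|exact: borelC|exact: sigma_algebra0].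
Qed.

Lemma borel_open (M : topologicalType) (T : set M) : open T -> borel T.
Proof. exact: sub_sigma_algebra. Qed.

(** The sets whose preimage within [U] is measurable form a sigma-algebra containing the open ones.
    Continuity is asked on [U] only, as chart inverses are continuous just on the image of the
    chart. *)
Lemma borel_preimage (M : topologicalType) d (U : set 'rV[R]_d) (h : 'rV[R]_d -> M) (T : set M) :
  open U -> (forall u, U u -> {for u, continuous h}) -> borel T ->
  measurable (U `&` h @^-1` T : set (@borelV R d)).
Proof.
move=> oU ch bT; have mU : measurable (U : set (@borelV R d)) by exact: measurable_open.
apply: (bT [set S | measurable (U `&` h @^-1` S : set (@borelV R d))]); split=> [|S oS]; last first.
  apply: measurable_open; rewrite openE => u [Uu Su]; apply: filterI; first exact: (near_open oU Uu).
  by apply: (ch u Uu); exact: open_nbhs_nbhs.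
split=> [|S mS|S mS] /=.
- by rewrite preimage_set0 setI0.
- rewrite setTD preimage_setC (_ : _ `&` _ = U `\` (U `&` h @^-1` S)); last first.
    apply/seteqP; split=> u [Uu h']; split=> //; first by move=> [_ /h'].
    by move=> Su; apply: h'.
  exact: measurableD.
- by rewrite preimage_bigcup setI_bigcupr; exact: bigcupT_measurable.
Qed.

End BorelSets.

Section CoveringMaps.
Context {R : realType} {E M : topologicalType} {d : nat}.
Variables (C : set (chart R E d)) (A : set (chart R M d)) (p : E -> M).
Hypotheses (smE : smooth_manifold C) (smA : smooth_manifold A) (cov : smooth_covering C A p).

Lemma covering_smooth : smooth_map C A p.
Proof. by case: cov. Qed.

Lemma covering_local_section x :
  exists W, open_nbhs x W /\ forall e, W (p e) -> exists s, local_section p W e s.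
Proof.
have [_ _ /(_ x)[W [F [Wx tF pF sh]]]] := cov.
exists W; split=> // e We; have [V FV Ve] : (\bigcup_(V in F) V) e by rewrite -pF.
have [oV [s [[cs _] _ ps sp]]] := sh V FV; exists s; split=> //; first exact: sp.
by apply: filterS (near_open oV Ve) => z Vz; exact: sp.
Qed.

(** The smooth section over the sheet has a local representative that inverts the one of [p] near
    the point. *)
Lemma covering_jacobian_unit c b e : C c -> A b -> cdom c e -> cdom b (p e) ->
  'J (local_rep p c b) (cmap c e) \in unitmx.
Proof.
move=> Cc Ab ce be.
have [_ _ /(_ (p e))[W [F [[oW Wx] tF pF sh]]]] := cov.
have [V FV Ve] : (\bigcup_(V in F) V) e by rewrite -pF.
have [oV [s [[cs ss] _ ps sp]]] := sh V FV.
have cc : ccod c (cmap c e) by exact: chart_cod.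
have chC : forall c, C c -> is_chart c by have [_ _ h _ _] := smE.
have be' : cdom b (p (cinv c (cmap c e))) by rewrite (chart_cmapK smE).
have dp := local_rep_differentiable chC covering_smooth Cc Ab cc be'.
have pE : local_rep p c b (cmap c e) = cmap b (p e) by rewrite /local_rep /= (chart_cmapK smE).
have ds : differentiable (local_rep s b c) (local_rep p c b (cmap c e)).
  have [+ _] := ss b c Ab Cc 1; apply; rewrite pE; exists (p e) => //; split=> //.
  by rewrite /preimage /= sp.
have [|_ E1] := @jacobian_comp_near _ _ _ _ (local_rep p c b) (local_rep s b c) id (cmap c e) dp ds.
  have oU := local_rep_dom_open smA chC (smooth_map_continuous covering_smooth) Cc Ab.
  have near1 := near_open oU (x := cmap c e); rewrite (local_rep_domE chC p Cc Ab) in near1.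
  have near2 := near_open (preimage_cinv_open smE Cc oV) (x := cmap c e).
  near=> v.
  have [cv bv] : (ccod c `&` cinv c @^-1` (p @^-1` cdom b)) v by near: v; exact: (near1 (conj cc be')).
  have [_ Vv] : (ccod c `&` cinv c @^-1` V) v.
    by near: v; apply: near2; split=> //; rewrite /preimage /= (chart_cmapK smE).
  by rewrite /local_rep /= (chart_cmapK smA)// sp//; have [] := chart_cinvP smE Cc cv.
apply: mulmx_eq1_unit E1 _.
by apply/row_matrixP => i; rewrite !rowE -deriveEjacobian// derive_id mulmx1.
Unshelve. all: by end_near. Qed.

(* Lift first the segment from [w] to the center, then the ball from there. *)
Lemma chart_ball_lift b u0 r w e : A b -> 0 < r -> sphere_ball u0 r `<=` ccod b ->
  sphere_ball u0 r w -> p e = cinv b w ->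
  exists s, is_lift p (cinv b) (sphere_ball u0 r) s /\ s w = e.
Proof.
move=> Ab r0 rb wr pe.
have hE : hausdorff_space E by have [] := smE.
have cq u : sphere_ball u0 r u -> {for u, continuous (cinv b)}.
  by move=> /rb ur; exact: (chart_cinv_continuous smA Ab ur).
(* The parameter runs over the ball of radius [2] around [0], which contains [1]. With the absolute
   value, [psi t - u0] is [w - u0] times [1 - |t|], of absolute value at most [1], so [psi] does not
   leave the ball. *)
pose psi (t : 'rV[R]_1) := w + `|t 0 0| *: (u0 - w).
have cpsi : continuous psi.
  have c1 : continuous (fun t : 'rV[R]_1 => `|t 0 0| *: (u0 - w)).
    move=> t; have ct : {for t, continuous (fun t : 'rV[R]_1 => t 0 0)} by exact: coord_continuous.
    by apply: cvgZr_tmp; [exact: nbhs_filter|exact: (cvg_norm ct)].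
  by move=> t; exact: (cvgD (cvg_cst w) (c1 t)).
have psir t : sphere_ball 0 2 t -> sphere_ball u0 r (psi t).
  rewrite /sphere_ball /= subr0 => t2.
  have t2' : `|t 0 0| < 2 by apply: le_lt_trans t2; exact: rV_coord_le.
  have -> : psi t - u0 = (1 - `|t 0 0|) *: (w - u0).
    by rewrite /psi -[u0 - w]opprB scalerN scalerBl scale1r addrAC.
  have h : `|1 - `|t 0 0| | <= 1 by rewrite ler_norml; have := normr_ge0 (t 0 0); lra.
  by rewrite normrZ; apply: le_lt_trans wr; rewrite ler_piMl.
have psi0 : psi 0 = w by rewrite /psi mxE normr0 scale0r addr0.
have psi1 : psi 1%:M = u0 by rewrite /psi mxE eqxx mulr1n normr1 scale1r addrC subrK.
have b1 : sphere_ball 0 2 (1%:M : 'rV[R]_1).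
  rewrite /sphere_ball /= subr0; apply/rV_norm_ltP => // i.
  by rewrite mxE ord1 eqxx mulr1n normr1 ltr1n.
have b0 : sphere_ball (0 : 'rV[R]_1) 2 0 by rewrite /sphere_ball /= subrr normr0.
have [|||s1 [l1 s1e]] := @ball_lift _ _ p hE covering_local_section R 1 (cinv b \o psi) 0 2 e.
- by [].
- by move=> t /psir pr; apply: continuous_comp; [exact: cpsi|exact: cq].
- by rewrite /= psi0.
have [|s [ls se]] := @ball_lift _ _ p hE covering_local_section R d (cinv b) u0 r (s1 1%:M) r0 cq.
  by have [_ ->] := l1 => //=; rewrite psi1.
exists s; split=> //.
have lpsi : is_lift p (cinv b \o psi) (sphere_ball 0 2) (s \o psi).
  have [cs ps] := ls; split=> t /psir pr; last exact: ps.
  by apply: continuous_comp; [exact: cpsi|exact: cs].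
rewrite -psi0 -s1e; apply: (is_lift_unique hE covering_local_section _ b1 lpsi l1) => //=.
  exact: sphere_ball_convex.
by rewrite psi1.
Qed.

End CoveringMaps.

Section Volumes.
Context {R : realType}.

(** Continuity of the density makes the integrands of [chart_volume] Borel, as additivity of the
    integral requires. *)
Definition continuous_density (M : topologicalType) d (A : set (chart R M d)) (g : tensor2 R M d) :=
  forall c u, A c -> ccod c u -> {for u, continuous (fun v => Num.sqrt (\det (g c v)))}.

Section Subadditivity.
Context {M : topologicalType} {d : nat}.
Variables (A : set (chart R M d)) (g : tensor2 R M d).
Hypotheses (smA : smooth_manifold A) (cg : continuous_density A g).

Lemma image_cmap_borel c (T : set M) : A c -> borel T -> T `<=` cdom c ->
  measurable (cmap c @` T : set (@borelV R d)).
Proof.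
move=> Ac bT Tc; have -> : T = cdom c `&` T by apply/esym/setIidPr.
rewrite (image_cmapE smA)//; apply: borel_preimage => //; first exact: (chart_open_cod smA).
by move=> u cu; exact: (chart_cinv_continuous smA Ac cu).
Qed.

Lemma measurable_density c (T : set M) : A c -> borel T -> T `<=` cdom c ->
  measurable_fun setT (fun u : @borelV R d => (\1_(cmap c @` T) u * Num.sqrt (\det (g c u)))%:E).
Proof.
move=> Ac bT Tc; have mT := image_cmap_borel Ac bT Tc.
have oc := chart_open_cod smA Ac.
have TcE : cmap c @` T `<=` ccod c by move=> _ [x Tx <-]; apply: chart_cod; exact: Tc.
apply/measurable_EFinP.
rewrite (_ : (fun u => _) = (fun u : @borelV R d => Num.sqrt (\det (g c u))) \_ (cmap c @` T)); last first.
  apply/funext => u; rewrite patchE indicE; case: ifPn => uT; rewrite ?mul1r ?mul0r//.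
apply/(measurable_restrictT _ mT).
apply: (measurability _ (measurable_realfun.RGenOpens.measurableE R)) => _ [_ [a [b' ->] <-]].
set Y := `]a, b'[%classic; rewrite (_ : _ `&` _ = cmap c @` T `&` (ccod c `&` (fun u => Num.sqrt (\det (g c u))) @^-1` Y)).
  apply: measurableI => //; apply: borel_preimage => //; first by move=> u cu; exact: cg.
  by apply: borel_open; exact: interval_open.
by apply/seteqP; split=> u [Tu]; [split=> //; split=> //; exact: TcE|move=> []].
Qed.

Lemma chart_volume_cover c (T : set M) K (Q : 'I_K -> set M) : A c -> borel T -> T `<=` cdom c ->
  (forall j, open (Q j)) -> T `<=` \bigcup_j Q j ->
  (chart_volume g c T <= \sum_(j < K) chart_volume g c (T `&` Q j))%E.
Proof.
move=> Ac bT Tc oQ TQ.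
have bTQ j : borel (T `&` Q j) by apply: borelI => //; exact: borel_open.
have TQc j : T `&` Q j `<=` cdom c by move=> x [/Tc].
pose F j (u : @borelV R d) := (\1_(cmap c @` (T `&` Q j)) u * Num.sqrt (\det (g c u)))%:E.
have mF j : measurable_fun setT (F j) by exact: measurable_density.
have F0 j u : (0 <= F j u)%E by rewrite lee_fin mulr_ge0// sqrtr_ge0.
rewrite /chart_volume; under eq_bigr => j _.
  rewrite (_ : lebesgue_int _ = lebesgue_int (F j : 'rV_d -> _))// (lebesgue_intE (mF j) (F0 j)).
  over.
rewrite -ge0_integral_sum//.
rewrite lebesgue_intE; [|exact: measurable_density|by move=> u; rewrite lee_fin mulr_ge0// sqrtr_ge0].
apply: ge0_le_integral => //.
- exact: measurable_density.
- exact: emeasurable_sum.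
move=> u _; rewrite sumEFin lee_fin; have [uT|uT] := boolP (u \in cmap c @` T); last first.
  by rewrite indicE (negbTE uT) mul0r sumr_ge0// => j _; rewrite mulr_ge0// sqrtr_ge0.
have [x Tx xu] := set_mem uT; have [j _ Qx] := TQ x Tx.
rewrite (bigD1 j)//= (_ : \1_(cmap c @` (T `&` Q j)) u = 1); last first.
  by rewrite indicE mem_set//; exists x.
rewrite indicE uT lerDl sumr_ge0// => i _; rewrite mulr_ge0// sqrtr_ge0.
Qed.

(** The volume is a supremum over disjoint Borel pieces: for each [j], the pieces cut down to [Q j]
    compete for the volume of [Q j]. *)
Lemma volume_cover K (S : set M) (Q : 'I_K -> set M) : (forall j, open (Q j)) ->
  S `<=` \bigcup_j Q j -> (volume A g S <= \sum_(j < K) volume A g (Q j))%E.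
Proof.
move=> oQ SQ; apply: ge_ereal_sup => _ [k [c [T [Ac bT tT ->]]]].
apply: (@le_trans _ _ (\sum_(i < k) \sum_(j < K) chart_volume g (c i) (T i `&` Q j))%E).
  apply: lee_sum => i _; have [bTi Ti] := bT i.
  apply: chart_volume_cover => // [x /Ti[]//|x /Ti[_ /SQ]//].
rewrite exchange_big; apply: lee_sum => j _; apply: ereal_sup_ubound.
exists k, c, (fun i => T i `&` Q j); split=> // [i|].
  have [bTi Ti] := bT i; split; first by apply: borelI => //; exact: borel_open.
  by move=> x [/Ti[cx _] Qx].
apply/trivIsetP => i i' _ _ ii'; have /trivIsetP/(_ i i' I I ii') := tT.
by move=> h; rewrite setIACA h set0I.
Qed.

End Subadditivity.

Lemma measure_disjoint_sum (disp : measure_display) (T : measurableType disp)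
    (mu : {measure set T -> \bar R}) (I : finType) (Y : I -> set T) :
  (forall i, measurable (Y i)) -> trivIset setT Y ->
  mu (\bigcup_i Y i) = (\sum_i mu (Y i))%E.
Proof.
move=> mY /trivIsetP tY.
rewrite (_ : \bigcup_i Y i = \bigcup_(i in [set` index_enum I]) Y i); last first.
  by congr (\bigcup_(i in _) _); apply/seteqP; split=> i _ //=; rewrite mem_index_enum.
elim: (index_enum I) (index_enum_uniq I) => [_|i s IH /= /andP[nis us]].
  by rewrite set_nil bigcup_set0 measure0 big_nil.
have -> : \bigcup_(j in [set` i :: s]) Y j = Y i `|` \bigcup_(j in [set` s]) Y j.
  apply/seteqP; split=> [x [j /=]|x [Yi|[j /= js Yj]]].
  - by rewrite inE => /orP[/eqP -> Yi|js Yj]; [left|right; exists j].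
  - by exists i => //=; rewrite mem_head.
  - by exists j => //=; rewrite inE js orbT.
have mB : measurable (\bigcup_(j in [set` s]) Y j) by exact: countable_bigcup_measurable.
have dB : Y i `&` \bigcup_(j in [set` s]) Y j = set0.
  apply/seteqP; split=> // x [Yi [j /= js Yj]].
  have ij : i != j by apply: contraNneq nis => ->.
  by have : (Y i `&` Y j) x by []; rewrite tY.
by rewrite big_cons -(IH us); exact: measureU.
Qed.

Section PieceVolume.
Context {E M : topologicalType} {d : nat}.
Variables (C : set (chart R E d)) (A : set (chart R M d)) (p : E -> M).
Hypotheses (smE : smooth_manifold C) (smA : smooth_manifold A) (sp : smooth_map C A p).
Hypothesis pJ : forall c b e, C c -> A b -> cdom c e -> cdom b (p e) ->
  'J (local_rep p c b) (cmap c e) \in unitmx.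
Variables (gE : tensor2 R E d) (gM : tensor2 R M d).
Hypothesis gEM : forall c b e, C c -> A b -> cdom c e -> cdom b (p e) ->
  Num.sqrt (\det (gE c (cmap c e))) =
  `|\det ('J (local_rep p c b) (cmap c e))| * Num.sqrt (\det (gM b (cmap b (p e)))).

(** The image of the section [s], that is, the part over [V] of one sheet: a point belongs to it
    when [s] gives it back from the coordinates of its projection. *)
Definition piece (b : chart R M d) (V : set 'rV[R]_d) (s : 'rV[R]_d -> E) : set E :=
  [set e | [/\ cdom b (p e), V (cmap b (p e)) & s (cmap b (p e)) = e]].

(** On the piece the coordinates of the projection are injective. So disjoint parts of it, seen in
    whatever charts of [E], have disjoint images in [V], and [area_inequality] bounds the volume of
    each by [D * K] times the measure of its image. The set [N] allows a density bound that holds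
    only on part of [V]. With [pJ] and [gEM] as assumptions on [p], the result applies to a covering
    and to an identity map alike. *)
Lemma piece_volume b (V : set 'rV[R]_d) s (N : set M) (D K : R) : A b -> open V -> V `<=` ccod b ->
  is_lift p (cinv b) V s -> open N -> 0 <= D -> 1 < K ->
  (forall w, V w -> N (cinv b w) -> Num.sqrt (\det (gM b w)) <= D) ->
  (volume C gE (piece b V s `&` p @^-1` N) <= (D * K)%:E * lebesgueV d (V `&` cinv b @^-1` N))%E.
Proof.
move=> Ab oV Vb [cs ps] oN D0 K1 gD; apply: ge_ereal_sup => _ [k [c [T [Cc bT tT ->]]]].
have chC : forall c, C c -> is_chart c by have [_ _ h _ _] := smE.
pose Y i : set (@borelV R d) := V `&` s @^-1` T i.
have mY i : measurable (Y i) by apply: borel_preimage => //; have [] := bT i.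
have mR : measurable (V `&` cinv b @^-1` N : set (@borelV R d)).
  apply: borel_preimage => //; last exact: borel_open.
  by move=> u /Vb bu; exact: (chart_cinv_continuous smA Ab bu).
have YE i : local_rep p (c i) b @` (cmap (c i) @` T i) = Y i.
  have [bTi Ti] := bT i; apply/seteqP; split=> [_ [_ [e Te <-] <-]|w [Vw Tw]].
    have [ce [[be Ve se] Ne]] := Ti e Te.
    by rewrite /local_rep /= (chart_cmapK smE)//; split=> //; rewrite /preimage /= se.
  have [ce _] := Ti _ Tw; exists (cmap (c i) (s w)); first by exists (s w).
  by rewrite /local_rep /= (chart_cmapK smE)// ps//; have [] := chart_cinvP smA Ab (Vb _ Vw).
have volY i : (chart_volume gE (c i) (T i) <= (D * K)%:E * lebesgueV d (Y i))%E.
  have [bTi Ti] := bT i; rewrite -YE.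
  have Tc : T i `<=` cdom (c i) by move=> e /Ti[].
  have Tp e : T i e -> [/\ cdom b (p e), V (cmap b (p e)) & s (cmap b (p e)) = e] by move=> /Ti[_ []].
  have sf u : (cmap (c i) @` T i) u -> s (local_rep p (c i) b u) = cinv (c i) u.
    by move=> [e Te <-]; rewrite /local_rep /= (chart_cmapK smE (Cc i) (Tc e Te)); have [] := Tp e Te.
  apply: (@area_inequality _ _ (cmap (c i) @` (cdom (c i) `&` setT `&` p @^-1` cdom b))) => //.
  - exact: (local_rep_dom_open smA chC (smooth_map_continuous sp)).
  - exact: (local_rep_smooth sp).
  - exact: (image_cmap_borel smE).
  - by move=> _ [e Te <-]; exists e => //; split; [split=> //; exact: Tc|have [] := Tp e Te].
  - by move=> _ [e Te <-]; apply: pJ => //; [exact: Tc|have [] := Tp e Te].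
  - move=> T' mT' T'T.
    have -> : local_rep p (c i) b @` T' =
        (V `&` s @^-1` cdom (c i)) `&` (cmap (c i) \o s) @^-1` T'.
      apply/seteqP; split=> [_ [u T'u <-]|w [[Vw cw] T'w]].
        have [e Te eu] := T'T u T'u; have := sf u (T'T u T'u); rewrite -eu (chart_cmapK smE)//; last exact: Tc.
        rewrite /local_rep /= (chart_cmapK smE)//; last exact: Tc.
        have [be Ve se] := Tp e Te => _; split; first by split=> //; rewrite /preimage /= se; exact: Tc.
        by rewrite /preimage /= se eu.
      exists (cmap (c i) (s w)) => //; rewrite /local_rep /= (chart_cmapK smE)// ps//.
      by have [] := chart_cinvP smA Ab (Vb _ Vw).
    apply: (@borel_preimage R 'rV[R]_d d (V `&` s @^-1` cdom (c i)) (cmap (c i) \o s) T').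
    - rewrite openE => w [Vw cw]; apply: filterI; first exact: (near_open oV Vw).
      by apply: (cs w Vw); apply: open_nbhs_nbhs; split=> //; exact: (chart_open_dom smE).
    - move=> w [Vw cw]; apply: continuous_comp; first exact: cs.
      exact: (chart_cmap_continuous smE (Cc i) cw).
    - exact: mT'.
  - move=> u v uT vT uv; have := sf u uT; rewrite uv sf// => cuv.
    have cod x : (cmap (c i) @` T i) x -> ccod (c i) x by move=> [e Te <-]; apply: chart_cod; exact: Tc.
    by have [_ <-] := chart_cinvP smE (Cc i) (cod _ uT); rewrite -cuv; have [_ ->] := chart_cinvP smE (Cc i) (cod _ vT).
  - move=> _ [e Te <-]; have [be Ve se] := Tp e Te; rewrite sqrtr_ge0 (gEM (Cc i) Ab (Tc e Te) be)/=.
    rewrite mulrC ler_wpM2r//; apply: gD => //; rewrite (chart_cmapK smA)//.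
    by have [_ []] := Ti e Te.
apply: (@le_trans _ _ ((D * K)%:E * \sum_(i < k) lebesgueV d (Y i))%E).
  rewrite ge0_sume_distrr//; exact: lee_sum.
apply: lee_wpmul2l; first by rewrite lee_fin mulr_ge0// ltW// (lt_trans ltr01).
rewrite -measure_disjoint_sum//; last first.
  by apply/trivIsetP => i j _ _ ij; have /trivIsetP/(_ i j I I ij) := tT => h;
    apply/seteqP; split=> // w [[_ Ti] [_ Tj]]; have : (T i `&` T j) (s w) by []; rewrite h.
have mU : measurable (\bigcup_(i in [set: 'I_k]) Y i) by exact: countable_bigcup_measurable.
apply: le_measure; [exact: mem_set|exact: mem_set|].
move=> w [i _ [Vw Tw]]; split=> //; have [bTi Ti] := bT i.
by rewrite /preimage /= -ps//; have [_ []] := Ti _ Tw.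
Qed.

End PieceVolume.

End Volumes.

(** * Euclidean coordinates *)

Section UnitBall.
Context {R : realType}.

Definition euclidean_ball d : set 'rV[R]_d := [set u | sqnorm u < 1].

Lemma sqnorm_continuous d : continuous (@sqnorm R d).
Proof.
move=> u; rewrite (_ : @sqnorm R d = fun u => \sum_(i < d) u 0 i ^+ 2); last first.
  by apply/funext => v; rewrite sqnormE.
apply: continuous_at_sum => i _.
rewrite (_ : (fun x : 'rV[R]_d => _) = (fun x => x 0 i * x 0 i)); last first.
  by apply/funext => x; rewrite expr2.
by apply: continuousM; exact: coord_continuous.
Qed.

Lemma euclidean_ball_open d : open (@euclidean_ball d).
Proof.
have -> : @euclidean_ball d = @sqnorm R d @^-1` [set x | x < 1] by [].
by apply: open_comp => [u _|]; [exact: sqnorm_continuous|exact: open_lt].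
Qed.

Lemma norm2_lt1 d (u : 'rV[R]_d) : (norm2 u < 1) = (sqnorm u < 1).
Proof.
by rewrite -[X in _ < X](sqrtr1 R) ltr_sqrt.
Qed.

Lemma euclidean_ball_volume d : exists2 w : R, 0 < w & lebesgueV d (@euclidean_ball d) = w%:E.
Proof.
have mB : measurable (@euclidean_ball d : set (@borelV R d)) by exact: measurable_open (@euclidean_ball_open d).
have up : (lebesgueV d (@euclidean_ball d) <= (\prod_(i < d) (1 - -1 : R))%:E)%E.
  rewrite -(@lebesgueV_box R d (fun _ => -1) (fun _ => 1)); last by move=> i; lra.
  apply: le_measure; [exact: mem_set|apply: mem_set; exact: measurable_box|].
  move=> u; rewrite /euclidean_ball /= -norm2_lt1 => u1 i.
  have := le_lt_trans (le_trans (rV_coord_le u i) (norm_le_norm2 u)) u1.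
  by rewrite ltr_norml => /andP[/ltW -> ->].
have d0 : 0 < d.+1%:R^-1 :> R by rewrite invr_gt0.
have lo : ((\prod_(i < d) (d.+1%:R^-1 - 0 : R))%:E <= lebesgueV d (@euclidean_ball d))%E.
  rewrite -(@lebesgueV_box R d (fun _ => 0) (fun _ => d.+1%:R^-1)); last by move=> i; exact: ltW.
  apply: le_measure; [apply: mem_set; exact: measurable_box|exact: mem_set|].
  move=> u /= ui; rewrite /euclidean_ball /= sqnormE.
  apply: (@le_lt_trans _ _ (\sum_(i < d) d.+1%:R^-1)).
    apply: ler_sum => i _; have /andP[u0 u1] := ui i; apply: le_trans (ltW u1).
    rewrite expr2 ler_piMl//; apply: le_trans (ltW u1) _.
    by rewrite invf_le1// ler1n.
  by rewrite sumr_const card_ord -[_ *+ d]mulr_natl ltr_pdivrMr// mul1r ltr_nat.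
have fin : lebesgueV d (@euclidean_ball d) \is a fin_num.
  by rewrite ge0_fin_numE//; apply: le_lt_trans up _; exact: ltry.
exists (fine (lebesgueV d (@euclidean_ball d))); last by rewrite fineK.
rewrite -lte_fin fineK//; apply: lt_le_trans lo; rewrite lte_fin.
by apply: prodr_gt0 => i _; rewrite subr0.
Qed.

Lemma ellipsoid_volume d (S : 'M[R]_d) (w0 : 'rV[R]_d) (r : R) : S \in unitmx -> 0 < r ->
  lebesgueV d [set w : 'rV[R]_d | norm2 ((w - w0) *m S) < r] =
  ((r ^+ d / `|\det S|)%:E * lebesgueV d (@euclidean_ball d))%E.
Proof.
move=> uS r0; have mB : measurable (@euclidean_ball d : set (@borelV R d)) by exact: measurable_open (@euclidean_ball_open d).
have dS : 0 < `|\det S| by rewrite normr_gt0 -unitfE -unitmxE.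
have uS' : r^-1 *: S \in unitmx by rewrite unitmxZ// unitfE invr_neq0// gt_eqF.
have mB' : measurable ([set u | euclidean_ball (u *m (r^-1 *: S))] : set (@borelV R d)).
  by apply: measurable_preimage_continuous mB; exact: mulmx_continuous.
rewrite -(unitmx_scales_volume uS' mB) muleA -EFinM detZ normrM ger0_norm; last first.
  by rewrite exprn_ge0// invr_ge0 ltW.
rewrite exprVn mulrACA mulVf ?gt_eqF// ?exprn_gt0//.
rewrite [X in (X%:E * _)%E](_ : _ = 1) ?mul1e; last first.
  by rewrite divff ?expf_neq0 ?gt_eqF// mulr1.
rewrite -(lebesgueV_translate (- w0) mB'); congr (lebesgueV d _).
apply/seteqP; split=> u; rewrite /euclidean_ball /= -norm2_lt1 -scalemxAr norm2Z ger0_norm ?invr_ge0 ?(ltW r0)//;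
  by rewrite ltr_pdivrMl// mulr1.
Qed.

Lemma norm2_mulmx_bound d (S : 'M[R]_d) : S \in unitmx ->
  exists2 C, 0 < C & forall v : 'rV[R]_d, `|v| <= C * norm2 (v *m S).
Proof.
move=> uS; have [C C0 hC] := mulmx_norm_le (invmx S); exists C => // v.
rewrite -[v in `|v|](mulmxK uS); apply: le_trans (hC _) _.
by rewrite ler_pM2l// norm_le_norm2.
Qed.

Lemma norm2_gram d N (J : 'M[R]_(d, N)) (S : 'M[R]_d) v : J *m J^T = S *m S^T ->
  norm2 (v *m J) = norm2 (v *m S).
Proof.
move=> JS; rewrite /norm2 /sqnorm; suff -> : v *m J *m (v *m J)^T = v *m S *m (v *m S)^T by [].
by rewrite !trmx_mul !mulmxA -(mulmxA v) JS mulmxA.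
Qed.

Lemma gram_posdef d N (J : 'M[R]_(d, N)) : row_free J -> posdef (J *m J^T).
Proof.
move=> rJ; split=> [|v v0]; first by rewrite trmx_mul trmxK.
have -> : v *m (J *m J^T) *m v^T = (v *m J) *m (v *m J)^T by rewrite trmx_mul !mulmxA.
rewrite -/(sqnorm _) lt_def sqnorm_ge0 andbT; apply: contra v0 => /eqP h.
have : norm2 (v *m J) = 0 by rewrite /norm2 h sqrtr0.
move=> n0; have : `|v *m J| <= 0 by rewrite -n0 norm_le_norm2.
rewrite normr_le0 => /eqP vJ; apply/eqP.
by have /row_free_mulmxP/(_ v vJ) := rJ.
Qed.

(** [S] is the Cholesky factor of the Gram matrix at [u0], so [norm2 (v *m S)] is the norm of the
    image of [v] under the differential, and [|\det S|] is the density at [u0]. Strict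
    differentiability and continuity extend both to a neighbourhood, up to [k]. *)
Lemma euclidean_coordinates d N (U : set 'rV[R]_d) (h : 'rV[R]_d -> 'rV[R]_N) u0 (k : R) :
  open U -> Ck 1 U h -> U u0 -> row_free ('J h u0) -> 0 < k ->
  exists r (S : 'M[R]_d), [/\ 0 < r, S \in unitmx, (forall u, `|u - u0| < r -> U u),
    forall u v, `|u - u0| < r -> `|v - u0| < r -> (1 - k) * norm2 ((u - v) *m S) <= norm2 (h u - h v) &
    forall u, `|u - u0| < r -> Num.sqrt (\det ('J h u *m ('J h u)^T)) <= (1 + k) * `|\det S|].
Proof.
move=> oU Ch Uu0 rJ k0.
have [S uS JS] := posdef_cholesky (gram_posdef rJ).
have dS : 0 < `|\det S| by rewrite normr_gt0 -unitfE -unitmxE.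
have [C C0 hC] := norm2_mulmx_bound uS.
(* [C] bounds the sup norm of [v] by [norm2 (v *m S)], and [N] bounds the Euclidean norm in the
   target by the sup norm; [N.+1] is there to divide by a nonzero number. *)
have e0 : 0 < k / (C * N.+1%:R) by rewrite divr_gt0// mulr_gt0.
have [r1 r10 [r1U hr1]] := strict_differentiability oU Ch Uu0 e0.
have detE : Num.sqrt (\det ('J h u0 *m ('J h u0)^T)) = `|\det S|.
  by rewrite JS det_mulmx det_tr -expr2 sqrtr_sqr.
have cdet : {for u0, continuous (fun u => Num.sqrt (\det ('J h u *m ('J h u)^T)))}.
  apply: (@continuous_comp _ _ _ (fun u => \det ('J h u *m ('J h u)^T)) Num.sqrt); last exact: sqrt_continuous.
  apply: continuous_det => i j.
  rewrite (_ : (fun u => _) = (fun u => \sum_l 'J h u i l * 'J h u j l)); last first.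
    by apply/funext => u; rewrite -{1}(mulmx1 ('J h u)) -[1%:M]diag_const_mx weighted_gramE;
      apply: eq_bigr => l _; rewrite mxE mul1r.
  have cJ (a : 'I_d) (l : 'I_N) : {for u0, continuous (fun v => 'J h v a l)} by exact: Ck1_continuous_jacobian oU Ch Uu0.
  by apply: continuous_at_sum => l _; exact: (@continuousM _ _ (fun u => 'J h u i l) (fun u => 'J h u j l) u0 (cJ i l) (cJ j l)).
have : \forall u \near u0, Num.sqrt (\det ('J h u *m ('J h u)^T)) < (1 + k) * `|\det S|.
  by apply: (cvgr_lt _ cdet); rewrite detE ltr_pMl// ltrDl.
move=> /nbhs_ballP[r2 /= r20 hr2].
exists (Num.min r1 r2), S; split=> //.
- by rewrite lt_min r10.
- by move=> u; rewrite lt_min distrC => /andP[/r1U].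
- move=> u v; rewrite !lt_min => /andP[ur _] /andP[vr _].
  rewrite distrC in ur; rewrite distrC in vr; have := hr1 u v ur vr.
  set w := h u - h v - _ => wle.
  have E : (u - v) *m 'J h u0 = (h u - h v) + - w by rewrite /w subKr.
  have n1 : norm2 ((u - v) *m S) <= norm2 (h u - h v) + norm2 w.
    rewrite -(norm2_gram _ JS) E; apply: le_trans (norm2_triangle _ _) _.
    by rewrite norm2N.
  have n2 : norm2 w <= k * norm2 ((u - v) *m S).
    apply: le_trans (norm2_le_norm w) _.
    apply: le_trans (ler_wpM2l (ler0n _ _) wle) _.
    apply: (@le_trans _ _ (N%:R * (k / (C * N.+1%:R) * (C * norm2 ((u - v) *m S))))).
      by rewrite ler_wpM2l// ler_wpM2l// ltW.
    have -> : N%:R * (k / (C * N.+1%:R) * (C * norm2 ((u - v) *m S))) =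
        (N%:R / N.+1%:R) * (k * norm2 ((u - v) *m S)).
      have : N.+1%:R != 0 :> R by rewrite pnatr_eq0.
      by move: (N.+1%:R : R) (N%:R : R) => a b a0; field; rewrite a0 gt_eqF.
    rewrite ler_piMl// ?mulr_ge0 ?norm2_ge0 ?(ltW k0)//.
    by rewrite ler_pdivrMr// mul1r ler_nat.
  by rewrite mulrBl mul1r lerBlDr (le_trans n1)// lerD2l.
- move=> u; rewrite lt_min => /andP[_ ur]; apply: ltW; apply: hr2.
  by rewrite mx_norm_ball /ball_ /= distrC.
Qed.

End UnitBall.

Section CompactCovers.
Context {R : realType}.

Lemma seq_min_pos (T : eqType) (s : seq T) (g : T -> R) : (forall x, x \in s -> 0 < g x) ->
  exists2 e : R, 0 < e & forall x, x \in s -> e <= g x.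
Proof.
elim: s => [|x s IH] g0; first by exists 1.
have [|e e0 he] := IH; first by move=> y ys; apply: g0; rewrite inE ys orbT.
exists (Num.min e (g x)); first by rewrite lt_min e0 g0// mem_head.
by move=> y; rewrite inE => /orP[/eqP ->|/he ey]; rewrite ge_min ?lexx ?orbT// ey.
Qed.

(** Off [Q] the distance from [f y] to [f x] is positive, hence bounded below by compactness: a
    quantitative form of the continuity of the inverse of [f]. *)
Lemma compact_separation (M : topologicalType) N (f : M -> 'rV[R]_N) (Q : set M) x :
  compact [set: M] -> continuous f -> injective f -> open Q -> Q x ->
  exists2 e : R, 0 < e & forall y, `|f y - f x| < e -> Q y.
Proof.
move=> cM cf fi oQ Qx.
have cQ : compact (~` Q).
  by apply: (subclosed_compact _ cM) => //; exact: open_closedC.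
pose g y : R := `|f y - f x|.
have cg : continuous g.
  move=> y; apply: (@continuous_comp _ _ _ (fun y => f y - f x) (fun v => `|v|)); last exact: norm_continuous.
  by apply: continuousB; [exact: cf|exact: cst_continuous].
have g0 y : (~` Q) y -> 0 < g y.
  by move=> nQy; rewrite normr_gt0 subr_eq0; apply/eqP => /fi yx; apply: nQy; rewrite yx.
have [|s [sQ sC]] := @compact_finite_subcover M _ (fun y => [set y' | g y / 2 < g y']) cQ.
  move=> y /g0 gy; split; last by rewrite /= ltr_pdivrMr// ltr_pMr// ltr1n.
  have -> : [set y' | g y / 2 < g y'] = g @^-1` [set t | g y / 2 < t] by [].
  by apply: open_comp => [z _|]; [exact: cg|exact: open_gt].
have [e e0 he] := @seq_min_pos _ s (fun y => g y / 2) (fun y ys => divr_gt0 (g0 y (sQ y ys)) (ltr0n R 2)).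
exists e => // y ye; apply: contrapT => /sC[z zs /= zy].
by have := he z zs; rewrite leNgt (lt_trans zy ye).
Qed.

End CompactCovers.

(** * Multiplicity of the unit balls *)

Section GoodCovers.
Context {R : realType} {M : topologicalType} {d N : nat}.
Variables (A : set (chart R M d)) (f : M -> 'rV[R]_N).
Hypotheses (smA : smooth_manifold A) (cM : compact [set: M]).
Hypotheses (sf : smooth_fun A f) (fi : injective f) (imf : forall x, immersive_at A f x).

Definition chart_ball_set (c : chart R M d) (u : 'rV[R]_d) (r : R) : set M :=
  [set y | cdom c y /\ sphere_ball u r (cmap c y)].

(* [c] restricted to the ball around [u] of radius [r] almost is an isometric and
   volume-preserving chart after the linear change of coordinates [S]. *)
Definition euclidean_chart (k : R) (c : chart R M d) (u : 'rV[R]_d) (r : R) :=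
  [/\ A c, 0 < r, forall v, `|v - u| <= r -> ccod c v &
    exists S : 'M[R]_d, [/\ S \in unitmx,
      forall v w, sphere_ball u r v -> sphere_ball u r w ->
        (1 - k) * norm2 ((v - w) *m S) <= norm2 (f (cinv c v) - f (cinv c w)) &
      forall v, sphere_ball u r v ->
        Num.sqrt (\det ('J (f \o cinv c) v *m ('J (f \o cinv c) v)^T)) <= (1 + k) * `|\det S|]].

Lemma euclidean_chart_exists k x : 0 < k -> exists c u r, euclidean_chart k c u r /\
  chart_ball_set c u r x.
Proof.
move=> k0; have [c Ac cx] := chart_covers smA x.
have [r [S [r0 uS rc h1 h2]]] := euclidean_coordinates (chart_open_cod smA Ac) (sf Ac 1) (chart_cod cx) (imf Ac cx) k0.
have r2 : r / 2 < r by rewrite ltr_pdivrMr// ltr_pMr// ltr1n.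
have hr u : sphere_ball (cmap c x) (r / 2) u -> `|u - cmap c x| < r by move=> /lt_trans; apply.
exists c, (cmap c x), (r / 2); split; last first.
  by split=> //; rewrite /sphere_ball /= subrr normr0 divr_gt0.
split=> //; first by rewrite divr_gt0.
  by move=> v vr; apply: rc; exact: le_lt_trans vr r2.
by exists S; split=> // [v w /hr vr /hr wr|v /hr vr]; [exact: h1|exact: h2].
Qed.

Lemma chart_ball_set_open c u r : A c -> open (chart_ball_set c u r).
Proof. by move=> Ac; exact: (preimage_cmap_open smA Ac (@sphere_ball_open _ _ u r)). Qed.

Lemma small_connected_nbhs x (e : R) : 0 < e -> exists b : set M,
  [/\ open b, connected b, b x & forall y, b y -> `|f y - f x| < e].
Proof.
move=> e0; have [c Ac cx] := chart_covers smA x.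
have cf : {for cmap c x, continuous (f \o cinv c)}.
  apply: continuous_comp; first exact: (chart_cinv_continuous smA Ac (chart_cod cx)).
  exact: (smooth_fun_continuous smA sf).
have : \forall u \near cmap c x, ccod c u /\ `|f (cinv c u) - f x| < e.
  apply: filterI; first exact: (near_open (chart_open_cod smA Ac) (chart_cod cx)).
  have /cvgrPdist_lt/(_ e e0) := cf; apply: filterS => u.
  by rewrite /= (chart_cmapK smA)// distrC.
move=> /nbhs_ballP[r /= r0 hr].
have {}hr u : sphere_ball (cmap c x) r u -> ccod c u /\ `|f (cinv c u) - f x| < e.
  by move=> ur; apply: hr; rewrite mx_norm_ball /ball_ /= distrC.
exists (cinv c @` sphere_ball (cmap c x) r); split.
- by apply: (image_cinv_open smA Ac); [exact: sphere_ball_open|move=> u /hr[]].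
- apply: connected_continuous_connected; first by apply: convex_connected; exact: sphere_ball_convex.
  apply: continuous_in_subspaceT => u /set_mem /hr[cu _].
  exact: (chart_cinv_continuous smA Ac cu).
- by exists (cmap c x); [rewrite /sphere_ball /= subrr normr0|exact: (chart_cmapK smA)].
- by move=> _ [u /hr[_ h] <-].
Qed.

Definition good_cover (k lam : R) (s : seq M) (c : M -> chart R M d) (u : M -> 'rV[R]_d) (r : M -> R)
    (b : M -> set M) :=
  [/\ forall z, z \in s -> euclidean_chart k (c z) (u z) (r z),
      forall z, [/\ open (b z), connected (b z) & b z z],
      forall y, exists2 z, z \in s & b z y,
      forall z x y, b z x -> `|f y - f x| < lam -> chart_ball_set (c z) (u z) (r z) y &
      forall z z' x x', b z x -> b z' x' -> `|f x' - f x| < lam ->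
        b z' `<=` chart_ball_set (c z) (u z) (r z)].

Lemma good_cover_exists k : 0 < k ->
  exists lam s c u r b, 0 < lam /\ good_cover k lam s c u r b.
Proof.
move=> k0; have cf := smooth_fun_continuous smA sf.
(* A margin of [3 * D]: one [D] for the distance from [z] to the center of its ball, and [2 * D] for
   [2 * e], which exceeds [lam = e] plus the three radii [e / 4] of small sets met in the last
   condition. *)
have /choice[D hD] : forall x, exists D : chart R M d * 'rV[R]_d * R * R,
    [/\ euclidean_chart k D.1.1.1 D.1.1.2 D.1.2, 0 < D.2 &
      forall y, `|f y - f x| < 3 * D.2 -> chart_ball_set D.1.1.1 D.1.1.2 D.1.2 y].
  move=> x; have [c [u [r [ec xc]]]] := euclidean_chart_exists x k0.
  have oQ : open (chart_ball_set c u r) by case: ec => Ac _ _ _; exact: chart_ball_set_open.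
  have [e e0 he] := compact_separation cM cf fi oQ xc.
  exists (c, u, r, e / 3); split=> //=; first by rewrite divr_gt0.
  by move=> y; rewrite mulrC divfK ?pnatr_eq0//; exact: he.
have oF (e : R) x : open [set y | `|f y - f x| < e].
  have -> : [set y | `|f y - f x| < e] = (fun y => `|f y - f x|) @^-1` [set t | t < e] by [].
  apply: open_comp => [y _|]; last exact: open_lt.
  apply: (@continuous_comp _ _ _ (fun y => f y - f x) (fun v => `|v|)); last exact: norm_continuous.
  by apply: continuousB; [exact: cf|exact: cst_continuous].
have [|s1 [_ s1C]] := @compact_finite_subcover M _ (fun x => [set y | `|f y - f x| < (D x).2]) cM.
  by move=> x _; split=> //=; rewrite subrr normr0; have [] := hD x.
have [e e0 he] := @seq_min_pos R _ s1 (fun x => (D x).2) (fun x _ => let: And3 _ h _ := hD x in h).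
have /choice[i hi] : forall z, exists x, x \in s1 /\ `|f z - f x| < (D x).2.
  by move=> z; have [x xs zx] := s1C z I; exists x.
have Qi z y : `|f y - f z| < 2 * e -> chart_ball_set (D (i z)).1.1.1 (D (i z)).1.1.2 (D (i z)).1.2 y.
  move=> yz; have [is1 zi] := hi z; have [_ _] := hD (i z); apply.
  have := he _ is1; have := ler_normD (f y - f z) (f z - f (i z)).
  by rewrite addrA subrK => h1 h2; apply: le_lt_trans h1 _; lra.
have /choice[b hb] : forall z, exists b : set M,
    [/\ open b, connected b, b z & forall y, b y -> `|f y - f z| < e / 4].
  by move=> z; apply: small_connected_nbhs; rewrite divr_gt0.
have [|s2 [_ s2C]] := @compact_finite_subcover M _ b cM; first by move=> z _; have [] := hb z.
exists e, s2, (fun z => (D (i z)).1.1.1), (fun z => (D (i z)).1.1.2), (fun z => (D (i z)).1.2), b.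
split=> //; split.
- by move=> z _; have [] := hD (i z).
- by move=> z; have [] := hb z.
- by move=> y; exact: s2C.
- move=> z x y bx yx; apply: Qi; have [_ _ _ /(_ x bx)] := hb z.
  have := ler_normD (f y - f x) (f x - f z); rewrite addrA subrK => h1 h2.
  by apply: le_lt_trans h1 _; lra.
- move=> z z' x x' bx bx' xx' y by'; apply: Qi.
  have [_ _ _ hz] := hb z; have [_ _ _ hz'] := hb z'.
  have := hz x bx; have := hz' x' bx'; have := hz' y by'; rewrite (distrC (f x')).
  have := ler_normD (f y - f z') ((f z' - f x') + ((f x' - f x) + (f x - f z))).
  have := ler_normD (f z' - f x') ((f x' - f x) + (f x - f z)).
  have := ler_normD (f x' - f x) (f x - f z).
  have -> : (f y - f z') + ((f z' - f x') + ((f x' - f x) + (f x - f z))) = f y - f z.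
    by rewrite !addrA !subrK.
  move=> h1 h2 h3 h4 h5 h6; apply: le_lt_trans h3 _; lra.
Qed.

End GoodCovers.

Section Words.
Context {T : eqType}.

(** Lists all words of length at most [n], some of them repeatedly. They label the sheets that a
    path of bounded length can reach. *)
Fixpoint words (s : seq T) (n : nat) : seq (seq T) :=
  if n is n'.+1 then words s n' ++ [seq z :: w | z <- s, w <- words s n'] else [:: [::]].

Lemma mem_words s n w : (size w <= n)%N -> all (mem s) w -> w \in words s n.
Proof.
elim: n w => [|n IH] [|z w] //= wn.
  by move=> _; rewrite mem_cat IH.
by move=> /andP[zs ws]; rewrite mem_cat (allpairs_f (fun z w => z :: w)) ?orbT// IH.
Qed.

Lemma words_all s n w : w \in words s n -> all (mem s) w.
Proof.
elim: n w => [|n IH] w /=; first by rewrite inE => /eqP ->.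
by rewrite mem_cat => /orP[/IH//|/allpairsP[[z v] /= [zs /IH vs ->]]] /=; rewrite zs.
Qed.

End Words.

Section Multiplicity.
Context {R : realType} {E M : topologicalType} {d N : nat}.
Variables (C : set (chart R E d)) (A : set (chart R M d)) (p : E -> M) (f : M -> 'rV[R]_N).
Hypotheses (smE : smooth_manifold C) (smA : smooth_manifold A) (cov : smooth_covering C A p).
Variables (k lam : R) (sq : seq M) (c : M -> chart R M d) (u : M -> 'rV[R]_d) (r : M -> R)
  (b : M -> set M).
Hypotheses (lam0 : 0 < lam) (gc : good_cover A f k lam sq c u r b).

Let Q z := chart_ball_set (c z) (u z) (r z).

Definition lifted_piece (P : M * ('rV[R]_d -> E)) : set E :=
  piece p (c P.1) (sphere_ball (u P.1) (r P.1)) P.2.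

Definition good_piece (P : M * ('rV[R]_d -> E)) :=
  P.1 \in sq /\ is_lift p (cinv (c P.1)) (sphere_ball (u P.1) (r P.1)) P.2.

Lemma cover_chart z : z \in sq ->
  [/\ A (c z), 0 < r z & sphere_ball (u z) (r z) `<=` ccod (c z)].
Proof.
move=> zs; have [/(_ z zs)[Ac r0 rc _] _ _ _ _] := gc; split=> // v /ltW.
exact: rc.
Qed.

Lemma b_sub_Q z : b z `<=` Q z.
Proof. by move=> y bzy; have [_ _ _ h _] := gc; apply: h bzy _; rewrite subrr normr0. Qed.

Lemma piece_section_continuous P y : good_piece P -> Q P.1 y ->
  {for y, continuous (fun x => P.2 (cmap (c P.1) x))} /\ p (P.2 (cmap (c P.1) y)) = y.
Proof.
move=> [Ps [cs ps]] [cy uy]; have [Ac _ _] := cover_chart Ps; split.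
  by apply: continuous_comp; [exact: (chart_cmap_continuous smA Ac cy)|exact: cs].
by rewrite ps// (chart_cmapK smA).
Qed.

Lemma hausdorff_cover : hausdorff_space E.
Proof. by have [] := smE. Qed.

Lemma piece_through z e : z \in sq -> Q z (p e) ->
  exists s, good_piece (z, s) /\ lifted_piece (z, s) e.
Proof.
move=> zs [cz uz]; have [Ac r0 rc] := cover_chart zs.
have [|s [ls se]] := chart_ball_lift smE smA cov Ac r0 rc uz (e := e).
  by rewrite (chart_cmapK smA).
by exists s; split=> //; split.
Qed.

(** [P'] is the sheet over the chart ball of [z] through the point of [P] above [z]. When the
    connected set [b z] lies in both chart balls, unique lifting makes the two sheets agree over all
    of it; otherwise [P] itself is the default. *)
Lemma piece_next P z : good_piece P -> z \in sq -> exists P', [/\ good_piece P', P'.1 = z \/ P' = P &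
  b z `<=` Q P.1 -> P'.1 = z /\ forall e, b z (p e) -> lifted_piece P e -> lifted_piece P' e].
Proof.
move=> gP zs; have [bQ|nbQ] := pselect (b z `<=` Q P.1); last by exists P; split=> //; right.
have [_ /(_ z)[ob cb bzz] _ _ _] := gc.
have [_ pz] := piece_section_continuous gP (bQ z bzz).
pose e' := P.2 (cmap (c P.1) z).
have [s [gs [_ _ se]]] : exists s, good_piece (z, s) /\ lifted_piece (z, s) e'.
  by apply: piece_through => //; rewrite /e' pz; exact: b_sub_Q.
exists (z, s); split=> //; [by left|move=> _; split=> // e be [cP uP Pe]].
have [cz uz] := b_sub_Q be; split=> //=.
rewrite -[RHS]Pe; apply/esym.
apply: (lift_unique hausdorff_cover (covering_local_section cov) (D := b z)
  (a := fun x => P.2 (cmap (c P.1) x)) (b := fun x => s (cmap (c z) x)) (t0 := z)) => //.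
- by move=> y /bQ /(piece_section_continuous gP)[].
- by move=> y /b_sub_Q /(piece_section_continuous gs)[].
- by move=> y bzy; have [_ ->] := piece_section_continuous gP (bQ y bzy);
    have [_ ->] := piece_section_continuous gs (b_sub_Q bzy).
- by move: se => /=; rewrite /e' pz.
Qed.

(** The section of [P] along the projected path is a second lift of it, equal to [g] at time [0],
    hence at all times. *)
Lemma piece_stay P (g : R -> E) : good_piece P -> continuous g -> lifted_piece P (g 0) ->
  (forall t : R, 0 <= t -> t <= 1 -> Q P.1 (p (g t))) -> lifted_piece P (g 1).
Proof.
move=> gP cg [_ _ P0] gQ; have [c1 u1] := gQ 1 ler01 (lexx 1); split=> //.
have cp := smooth_map_continuous (covering_smooth cov).
have in01 (t : R) : `[0, 1]%classic t -> Q P.1 (p (g t)).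
  by rewrite /= in_itv/= => /andP[t0 t1]; exact: gQ.
suff h : forall t : R, `[0, 1]%classic t -> P.2 (cmap (c P.1) (p (g t))) = g t.
  by apply: h; rewrite /= in_itv/= ler01 lexx.
have ca (t : R) : `[0, 1]%classic t -> {for t, continuous (fun t => P.2 (cmap (c P.1) (p (g t))))}.
  move=> /in01 Qt; have [cP _] := piece_section_continuous gP Qt.
  apply: (@continuous_comp _ _ _ (p \o g) (fun x => P.2 (cmap (c P.1) x))) => //.
  by apply: continuous_comp; [exact: cg|exact: cp].
have pa (t : R) : `[0, 1]%classic t -> p (P.2 (cmap (c P.1) (p (g t)))) = p (g t).
  by move=> /in01 Qt; have [_ ->] := piece_section_continuous gP Qt.
have i0 : `[0, 1]%classic (0 : R) by rewrite /= in_itv/= lexx ler01.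
exact: (lift_unique hausdorff_cover (covering_local_section cov) (@segment_connected R 0 1) i0 ca (fun t _ => cg t) pa P0).
Qed.

(* In the time in which the length grows by [del * lam / 2] a path cannot leave the chart ball
   where it started; each time that this much has been used up, the path is assigned a new
   piece, among [size sq] possible ones. *)
Lemma multiplicity_bound N' (K W : E -> 'rV[R]_N') (del : R) e0 : 0 < del ->
  (forall y y' a, controlled K W y y' a -> 0 <= a -> exists g : R -> E,
    [/\ continuous g, g 0 = y, g 1 = y' &
      forall t : R, 0 <= t -> t <= 1 -> `|f (p (g t)) - f (p y)| <= a / del]) ->
  exists P : seq M -> M * ('rV[R]_d -> E), (forall w, all (mem sq) w -> good_piece (P w)) /\
    forall y l, chain K W (del * lam / 2) e0 y l -> l < 1 ->
      exists w, [/\ w \in words sq (Num.truncn (2 / (del * lam))).+2, lifted_piece (P w) y & b (P w).1 (p y)].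
Proof.
move=> del0 ctrl; have [eucl hb cb lamQ lamb] := gc.
have /choice[nx hnx] : forall Pz : (M * ('rV[R]_d -> E)) * M, exists P', good_piece Pz.1 -> Pz.2 \in sq ->
    [/\ good_piece P', P'.1 = Pz.2 \/ P' = Pz.1 &
     b Pz.2 `<=` Q Pz.1.1 -> P'.1 = Pz.2 /\ forall e, b Pz.2 (p e) -> lifted_piece Pz.1 e -> lifted_piece P' e].
  move=> [P z]; have [[gP zs]|n] := pselect (good_piece P /\ z \in sq).
    by have [P' h] := piece_next gP zs; exists P'.
  by exists P => gP zs; case: n.
have [z0 z0s bz0] := cb (p e0).
have [s0 [gs0 ls0]] := piece_through z0s (b_sub_Q bz0).
(* The sheet depends on [e0] and the word alone, whose last letter is read first. Paths from [e0]
   with the same word end in the same sheet, so counting words bounds the number of sheets. *)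
pose P w := foldr (fun z Q => nx (Q, z)) (z0, s0) w.
have gP w : all (mem sq) w -> good_piece (P w).
  by elim: w => [//|z w IH] /= /andP[zs ws]; have [] := hnx (P w, z) (IH ws) zs.
exists P; split=> // y l ch l1.
set th := del * lam / 2 in ch; have th0 : 0 < th by rewrite divr_gt0// mulr_gt0.
have thd : th / del = lam / 2 by rewrite /th; field; rewrite gt_eqF.
have dl : del * lam = 2 * th by rewrite /th; field.
clearbody th.
(* [x] is the point of the base where the last letter was added. Each letter pays for a length [th];
   the unpaid length is less than [2 * th = del * lam], so the displacement of [f] since [x] is less
   than [lam]. *)
have inv : exists w x, [/\ all (mem sq) w, (size w)%:R * th <= l, b (P w).1 x, lifted_piece (P w) y &
    `|f (p y) - f x| <= (l - (size w)%:R * th) / del /\ l - (size w)%:R * th < 2 * th].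
  elim: ch {l1} => [|y1 y2 l1 a ch [w [x [ws wl bx ly [yx lt2]]]] a0 ath ctl].
    exists [::], (p e0); split=> //=; rewrite ?mul0r ?subrr ?normr0 ?mul0r//.
    by rewrite mulr_gt0.
  have [g [cg g0 g1 gf]] := ctrl _ _ _ ctl a0.
  have ad : a / del < lam / 2 by rewrite -thd ltr_pM2r// invr_gt0.
  (* Once the unpaid length reaches [2 * th], a letter is added at [y1], before the step. What then
     remains unpaid is at least [th], which covers the step, and again less than [2 * th]. *)
  have [lt2'|ge2] := ltP (l1 + a - (size w)%:R * th) (2 * th).
    exists w, x; split=> //; first by apply: le_trans wl _; rewrite lerDl.
      rewrite -g1; apply: piece_stay => //; [exact: gP|by rewrite g0|move=> t t0 t1].
      apply: lamQ bx _; have := ler_normD (f (p (g t)) - f (p y1)) (f (p y1) - f x).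
      rewrite addrA subrK => /le_lt_trans; apply; have := gf t t0 t1 => gt.
      apply: le_lt_trans (lerD gt yx) _; rewrite -mulrDl.
      by rewrite ltr_pdivrMr// [lam * del]mulrC dl; lra.
    split=> //; have := gf 1 ler01 (lexx 1); rewrite g1 => gt.
    have := ler_normD (f (p y2) - f (p y1)) (f (p y1) - f x); rewrite addrA subrK => h.
    by apply: le_trans h (le_trans (lerD gt yx) _); rewrite -mulrDl ler_pM2r ?invr_gt0//; lra.
  have [z zs bz] := cb (p y1).
  have yxl : `|f (p y1) - f x| < lam.
    by apply: le_lt_trans yx _; rewrite ltr_pdivrMr// [lam * del]mulrC dl.
  have bQ : b z `<=` Q (P w).1 by exact: lamb bx bz yxl.
  have [gP' _ /(_ bQ)[Pz lP']] := hnx (P w, z) (gP w ws) zs.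
  have PzE : P (z :: w) = nx (P w, z) by [].
  exists (z :: w), (p y1); rewrite PzE Pz; split=> //=.
  - by rewrite zs.
  - by rewrite -natr1 mulrDl mul1r; lra.
  - rewrite -g1; apply: piece_stay => //; first by rewrite g0; apply: lP'.
    move=> t t0 t1; rewrite Pz; apply: lamQ bz _.
    apply: le_lt_trans (gf t t0 t1) (lt_trans ad _).
    by rewrite ltr_pdivrMr// ltr_pMr// ltr1n.
  - split; last by rewrite -natr1 mulrDl mul1r; lra.
    have := gf 1 ler01 (lexx 1); rewrite g1 => gt; apply: le_trans gt _.
    by rewrite ler_pM2r ?invr_gt0// -natr1 mulrDl mul1r; lra.
have [w [x [ws wl bx ly [yx lt2]]]] := inv.
(* One more letter at the endpoint, so that [p y] lies in the small set of the final sheet and not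
   merely close to such a set. *)
have [z zs bz] := cb (p y).
have yxl : `|f (p y) - f x| < lam.
  by apply: le_lt_trans yx _; rewrite ltr_pdivrMr// [lam * del]mulrC dl.
have bQ : b z `<=` Q (P w).1 by exact: lamb bx bz yxl.
have [gP' _ /(_ bQ)[Pz lP']] := hnx (P w, z) (gP w ws) zs.
exists (z :: w); split.
- apply: mem_words; last by rewrite /= zs.
  rewrite /= ltnS; apply: ltnW; rewrite ltnS -(ler_nat R).
  have h1 : (size w)%:R <= 2 / (del * lam).
    have -> : 2 / (del * lam) = th^-1 by rewrite dl invfM mulrA divff ?mul1r.
    by rewrite -[th^-1]mul1r ler_pdivlMr// (le_trans wl)// ltW.
  by rewrite ler_nat truncn_ge_nat// (le_trans _ h1).
- exact: lP'.
- by rewrite [P (z :: w)]/= Pz.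
Qed.

End Multiplicity.

(** * The spike *)

Section DeterminantBounds.
Context {R : realType}.

Lemma det_entries_le d (A : 'M[R]_d) (C : R) : (forall i j, `|A i j| <= C) ->
  `|\det A| <= (d`!)%:R * C ^+ d.
Proof.
move=> AC; rewrite /determinant; apply: le_trans (ler_norm_sum _ _ _) _.
rewrite -card_Sn -sum1_card natr_sum mulr_suml; apply: ler_sum => s _.
rewrite normrM normrX normrN1 expr1n !mul1r normr_prod -[d in C ^+ d]card_ord -prodr_const.
by apply: ler_prod => i _; rewrite normr_ge0 AC.
Qed.

(** By the rank one formula the determinant increases by [v *m \adj G *m v^T]. Passing to the
    adjugate removes the inverse of [G], so that bounds on the entries of [G] and [v] suffice. *)
Lemma det_rank_one_entries_le d (G : 'M[R]_d) (v : 'rV[R]_d) (C B : R) : G \in unitmx ->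
  (forall i j, `|G i j| <= C) -> (forall i, `|v 0 i| <= B) -> 0 <= B ->
  \det (G + v^T *m v) <= (d`!)%:R * C ^+ d + (d%:R * d%:R * ((d.-1)`!)%:R * C ^+ d.-1) * B ^+ 2.
Proof.
move=> uG GC vB B0; have C0 (i : 'I_d) : 0 <= C by apply: le_trans (GC i i).
rewrite det_rank_one_le// mulrDr mulr1; apply: lerD.
  by apply: le_trans (ler_norm _) _; exact: det_entries_le.
have -> : \det G * (v *m invmx G *m v^T) 0 0 = (v *m \adj G *m v^T) 0 0.
  rewrite /invmx uG -scalemxAr -scalemxAl mxE mulrA divff ?mul1r//.
  by rewrite -unitfE -unitmxE.
rewrite mxE; apply: (@le_trans _ _ (\sum_(j < d) (\sum_(i < d) ((d.-1)`!)%:R * C ^+ d.-1 * B) * B)).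
  apply: ler_sum => j _; rewrite [v^T j 0]mxE; apply: le_trans (ler_norm _) _; rewrite normrM.
  apply: ler_pM; rewrite ?normr_ge0// mxE; apply: le_trans (ler_norm_sum _ _ _) _.
  apply: ler_sum => i _; rewrite normrM mulrC ler_pM ?normr_ge0//.
  rewrite mxE /cofactor normrM normrX normrN1 expr1n mul1r; apply: det_entries_le => a b.
  by rewrite !mxE; exact: GC.
rewrite sumr_const card_ord -[X in X <= _]mulr_natl sumr_const card_ord -[(_ * B) *+ d]mulr_natl.
move: (d%:R : R) ((d.-1)`!%:R : R) (C ^+ d.-1) => x y z.
by rewrite le_eqVlt; apply/orP; left; apply/eqP; ring.
Qed.

Lemma compact_bound d (K : set 'rV[R]_d) (g : 'rV[R]_d -> R) : compact K ->
  (forall u, K u -> {for u, continuous g}) -> exists2 C, 0 <= C & forall u, K u -> `|g u| <= C.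
Proof.
move=> cK cg; have [K0|K0] := pselect (K !=set0); last first.
  by exists 0 => // u Ku; case: K0; exists u.
have [|c Kc hc] := @EVT_max_rV R d (fun u => `|g u|) K K0 cK.
  apply: continuous_in_subspaceT => u /set_mem Ku.
  by apply: (@continuous_comp _ _ _ g (fun x => `|x|)); [exact: cg|exact: norm_continuous].
by exists `|g c| => // u Ku; apply: hc; exact: mem_set.
Qed.

Lemma jacobian_bound d N (U K : set 'rV[R]_d) (h : 'rV[R]_d -> 'rV[R]_N) : open U -> compact K ->
  K `<=` U -> Ck 1 U h -> exists2 C, 0 <= C & forall u i j, K u -> `|'J h u i j| <= C.
Proof.
move=> oU cK KU Ch.
have /choice[C hC] : forall ij : 'I_d * 'I_N, exists C : R, 0 <= C /\ forall u, K u -> `|'J h u ij.1 ij.2| <= C.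
  move=> [i j]; have [|C C0 hC] := @compact_bound d K (fun u => 'J h u i j) cK; last by exists C.
  by move=> u /KU Uu; exact: Ck1_continuous_jacobian oU Ch Uu.
have CS0 : 0 <= \sum_ij C ij by apply: sumr_ge0 => ij _; have [] := hC ij.
exists (\sum_ij C ij) => // u i j Ku; have [_ /(_ u Ku) h1] := hC (i, j).
apply: le_trans h1 _; rewrite (bigD1 (i, j))//= lerDl sumr_ge0// => ij _.
by have [] := hC ij.
Qed.

Lemma jacobian_row_mx d N1 N2 (f1 : 'rV[R]_d -> 'rV[R]_N1) (f2 : 'rV[R]_d -> 'rV[R]_N2) u :
  differentiable f1 u -> differentiable f2 u ->
  'J (fun y => row_mx (f1 y) (f2 y)) u = row_mx ('J f1 u) ('J f2 u).
Proof.
move=> d1 d2; apply/row_matrixP => i; rewrite row_row_mx !rowE.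
have [dr Dr] := derive_row_mx (delta_mx 0 i) d1 d2.
by rewrite -(deriveEjacobian _ d1) -(deriveEjacobian _ d2) -(deriveEjacobian _ dr).
Qed.

Lemma jacobian_rsubmx d1 d2 N (h : 'rV[R]_d2 -> 'rV[R]_N) w (B : R) :
  differentiable h (rsubmx w) -> 0 <= B -> (forall i j, `|'J h (rsubmx w) i j| <= B) ->
  forall i j, `|'J (h \o @rsubmx R 1 d1 d2) w i j| <= B.
Proof.
move=> dh B0 hB i j.
have dr : differentiable (@rsubmx R 1 d1 d2) w.
  by have [+ _] := @Ck_rsubmx R 1 d1 d2 setT openT; apply.
have dc : differentiable (h \o @rsubmx R 1 d1 d2) w by exact: differentiable_comp.
rewrite (jacobian_row _ _ dc) derive_comp_linear (deriveEjacobian _ dh).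
rewrite [X in X *m _](_ : _ = rsubmx (delta_mx 0 i))//.
case: (split_ordP i) => l ->.
  have -> : rsubmx (delta_mx 0 (lshift d2 l) : 'rV[R]_(d1 + d2)) = 0.
    apply/rowP => a; rewrite !mxE eqxx /=; case: eqP => // /(congr1 val) /= E.
    by have := ltn_ord l; rewrite -E ltnNge leq_addr.
  by rewrite mul0mx mxE normr0.
have -> : rsubmx (delta_mx 0 (rshift d1 l) : 'rV[R]_(d1 + d2)) = delta_mx 0 l.
  apply/rowP => a; rewrite !mxE eqxx /=; congr (_%:R); congr nat_of_bool.
  by apply/eqP/eqP => [/rshift_inj|->].
by rewrite -rowE mxE.
Qed.

Lemma jacobian_affine d N (h : 'rV[R]_d -> 'rV[R]_N) (a : R) (v0 v : 'rV[R]_d) i j :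
  differentiable h (a *: (v - v0)) ->
  'J (h \o (fun w => a *: (w - v0))) v i j = a * 'J h (a *: (v - v0)) i j.
Proof.
move=> dh.
have da : differentiable (fun w : 'rV[R]_d => a *: (w - v0)) v.
  by apply: differentiableZ; apply: differentiableB.
have Ja : 'J (fun w : 'rV[R]_d => a *: (w - v0)) v = a%:M.
  apply/row_matrixP => l; rewrite !rowE -(deriveEjacobian _ da).
  rewrite deriveZ; last by apply: diff_derivable; apply: differentiableB.
  by rewrite deriveB// derive_id derive_cst subr0 mul_mx_scalar.
have [|_ ->] := @jacobian_comp_near _ _ _ _ (fun w : 'rV[R]_d => a *: (w - v0)) h
    (h \o (fun w => a *: (w - v0))) v da dh; first by near=> w.
by rewrite Ja mul_scalar_mx mxE.
Unshelve. all: by end_near.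
Qed.

Lemma wtensor_row_mx (M : Type) d N1 N2 (K1 : M -> 'rV[R]_N1) (K2 : M -> 'rV[R]_N2)
    (W1 : M -> 'rV[R]_N1) (W2 : M -> 'rV[R]_N2) (c : chart R M d) u :
  differentiable (K1 \o cinv c) u -> differentiable (K2 \o cinv c) u ->
  wtensor (fun x => row_mx (K1 x) (K2 x)) (fun x => row_mx (W1 x) (W2 x)) c u =
  wtensor K1 W1 c u + wtensor K2 W2 c u.
Proof.
move=> d1 d2; rewrite /wtensor (jacobian_row_mx d1 d2).
move: ('J _ _) ('J _ _) (W1 _) (W2 _) => J1 J2 w1 w2.
apply/matrixP => a b; rewrite [RHS]mxE !weighted_gramE big_split_ord /=.
by congr (_ + _); apply: eq_bigr => l _; rewrite ?row_mxEl ?row_mxEr.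
Qed.

End DeterminantBounds.

Section Spike.
Context {R : realType} {m : nat}.

(** Normalized by the lower bound of [bump_half], so that the spike reaches [3] on the ball of
    radius [rho / 2]. *)
Definition spike_height : R := 3 / flat 0 (3 / 4) ^+ m.

Definition spike_profile (v0 : 'rV[R]_m) (rho : R) (v : 'rV[R]_m) : 'rV[R]_1 :=
  (spike_height * bump_fun (rho^-1 *: (v - v0)))%:M.

(** The radius [rho / 2] places the support where the spike is at least [3]. Division by the maximum
    of the bump makes the value at the center [1]. *)
Definition cutoff_profile (v0 : 'rV[R]_m) (rho : R) (v : 'rV[R]_m) : 'rV[R]_1 :=
  (bump_fun ((rho / 2)^-1 *: (v - v0)) / bump_fun (0 : 'rV[R]_m))%:M.

Lemma scalar_mx_Cinfty (g : 'rV[R]_m -> R) : (forall k, Ck k setT g) ->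
  Cinfty setT (fun v => (g v)%:M : 'rV[R]_1).
Proof.
move=> Cg k; apply/Ck_mxP; first exact: openT.
move=> i j; rewrite !ord1; apply: (Ck_ext (f := g)) => // [|v _]; first exact: openT.
by rewrite mxE eqxx mulr1n.
Qed.

Lemma spike_profile_smooth v0 rho : Cinfty setT (spike_profile v0 rho).
Proof.
apply: scalar_mx_Cinfty => k; apply: CkM; [exact: openT|exact: Ck_cst|exact: Cinfty_scaled_bump].
Qed.

Lemma cutoff_profile_smooth v0 rho : Cinfty setT (cutoff_profile v0 rho).
Proof.
apply: scalar_mx_Cinfty => k; apply: CkM; [exact: openT|exact: Cinfty_scaled_bump|exact: Ck_cst].
Qed.

Lemma spike_profile_out v0 rho v : 0 < rho -> rho <= `|v - v0| -> spike_profile v0 rho v = 0.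
Proof.
by move=> r0 vr; rewrite /spike_profile scaled_bump_eq0// mulr0; exact: raddf0.
Qed.

Lemma cutoff_profile_out v0 rho v : 0 < rho -> rho / 2 <= `|v - v0| -> cutoff_profile v0 rho v = 0.
Proof.
move=> r0 vr; rewrite /cutoff_profile scaled_bump_eq0//; last by rewrite divr_gt0.
by rewrite mul0r; exact: raddf0.
Qed.

Lemma bump0_gt0 : 0 < bump_fun (0 : 'rV[R]_m).
Proof. by apply: bump_gt0; rewrite normr0. Qed.

Lemma cutoff_profile_bounds v0 rho v : 0 <= cutoff_profile v0 rho v 0 0 <= 1.
Proof.
rewrite /cutoff_profile mxE eqxx mulr1n divr_ge0 ?bump_ge0//=.
by rewrite ler_pdivrMr ?bump0_gt0// mul1r bump_le.
Qed.

Lemma cutoff_profile_center v0 rho : cutoff_profile v0 rho v0 = 1%:M.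
Proof. by rewrite /cutoff_profile subrr scaler0 divff// gt_eqF// bump0_gt0. Qed.

Lemma spike_profile_high v0 rho v : 0 < rho -> `|v - v0| <= rho / 2 ->
  3 <= spike_profile v0 rho v 0 0.
Proof.
move=> r0 vr; rewrite /spike_profile mxE eqxx mulr1n /spike_height.
have f0 : 0 < flat 0 (3 / 4 : R) ^+ m by rewrite exprn_gt0// flat_gt0.
rewrite mulrAC ler_pdivlMr// ler_pM2l//; apply: bump_half.
rewrite normrZ ger0_norm ?invr_ge0 ?(ltW r0)// ler_pdivrMl//.
by rewrite mulrA mulr1.
Qed.

(* Scaling: the derivative of the spike is that of a fixed function, divided by [rho]. *)
Lemma spike_profile_jacobian : exists2 B, 0 <= B & forall v0 rho v i j, 0 < rho ->
  `|v - v0| <= 2 * rho -> `|'J (spike_profile v0 rho) v i j| <= B / rho.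
Proof.
pose h := @spike_profile 0 1.
have Ch : Ck 1 setT h by exact: spike_profile_smooth.
have cK : compact [set u : 'rV[R]_m | `|u - 0| <= 2] by exact: closed_ball_compact.
have [B B0 hB] := jacobian_bound openT cK (@subsetT _ _) Ch.
exists B => // v0 rho v i j r0 vr.
pose u := rho^-1 *: (v - v0).
have dh : differentiable h u by have [+ _] := Ch; apply.
have E : spike_profile v0 rho = h \o (fun w => rho^-1 *: (w - v0)).
  by apply/funext => w; rewrite /h /spike_profile /= invr1 scale1r subr0.
rewrite E (jacobian_affine _ _ dh) normrM ger0_norm; last by rewrite invr_ge0 ltW.
rewrite mulrC ler_pM2r ?invr_gt0//; apply: hB.
rewrite /= subr0 normrZ ger0_norm; last by rewrite invr_ge0 ltW.
by rewrite ler_pdivrMl// mulrC.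
Qed.

End Spike.

Section DensityFacts.
Context {R : realType}.

Lemma jacobian_near_eq d N (h g : 'rV[R]_d -> 'rV[R]_N) u : differentiable h u ->
  (\forall v \near u, h v = g v) -> 'J g u = 'J h u.
Proof.
move=> dh hg; have dg : differentiable g u by exact: near_eq_differentiable hg dh.
apply/matrixP => i j; have E := near_eq_derive (delta_mx 0 i) hg.
apply: (etrans (jacobian_row i j dg)); apply: (etrans _ (esym (jacobian_row i j dh))).
exact: (congr1 (fun y : 'rV[R]_N => y 0 j) (esym E)).
Qed.

Lemma jacobian_cst d N (a : 'rV[R]_N) (u : 'rV[R]_d) : 'J (fun _ : 'rV[R]_d => a) u = 0.
Proof.
apply/matrixP => i j; rewrite (jacobian_row i j (@differentiable_cst _ _ _ a u)).
by rewrite derive_cst !mxE.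
Qed.

(** The Jacobian of [q] occurs on both sides of the matrix of the metric, so the square root of the
    determinant gains the factor [|\det J|] once. *)
Lemma pullback_density (M E : topologicalType) d (A : set (chart R M d)) (C : set (chart R E d))
    (q : E -> M) N (K W : M -> 'rV[R]_N) g c b e :
  smooth_manifold A -> smooth_manifold C -> smooth_map C A q -> smooth_fun A K ->
  is_wtensor A K W g -> C c -> A b -> cdom c e -> cdom b (q e) ->
  Num.sqrt (\det (pullback A g q c (cmap c e))) =
  `|\det ('J (local_rep q c b) (cmap c e))| * Num.sqrt (\det (g b (cmap b (q e)))).
Proof.
move=> smA smC sq sK gE Cc Ab ce be.
have chC : forall c, C c -> is_chart c by have [_ _ h _ _] := smC.
have cc := chart_cod ce; have ceE := chart_cmapK smC Cc ce.
have be' : cdom b (q (cinv c (cmap c e))) by rewrite ceE.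
rewrite (pullback_wtensor smA chC sq sK gE Cc cc) gE// /wtensor.
rewrite (jacobian_pullback smA chC sq sK Cc Ab cc be') weighted_gram_mul /= ceE (chart_cmapK smA Ab be).
move: ('J (local_rep q c b) _) (_ *m diag_mx _ *m _) => J G.
by rewrite !det_mulmx det_tr mulrAC -expr2 sqrtrM ?sqr_ge0// sqrtr_sqr.
Qed.

Lemma pullback_continuous_density (M E : topologicalType) d (A : set (chart R M d))
    (C : set (chart R E d)) (q : E -> M) N (K W : M -> 'rV[R]_N) g :
  smooth_manifold A -> smooth_manifold C -> smooth_map C A q -> smooth_fun A K -> smooth_fun A W ->
  is_wtensor A K W g -> continuous_density C (pullback A g q).
Proof.
move=> smA smC sq sK sW gE c u Cc cu.
have chC : forall c, C c -> is_chart c by have [_ _ h _ _] := smC.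
have sKq := smooth_fun_comp smA chC sq sK; have sWq := smooth_fun_comp smA chC sq sW.
apply: (@continuous_near_eq _ _ (fun v => Num.sqrt (\det (wtensor (K \o q) (W \o q) c v)))).
  apply: filterS (near_open (chart_open_cod smC Cc) cu) => v cv.
  by rewrite (pullback_wtensor smA chC sq sK gE Cc cv).
apply: (@continuous_comp _ _ _ (fun v => \det (wtensor (K \o q) (W \o q) c v)) Num.sqrt); last exact: sqrt_continuous.
apply: continuous_det => i j; apply: continuous_coord_comp.
by have := wtensor_smooth smC sKq sWq Cc 0; apply.
Qed.

Lemma volume_le (T : topologicalType) d (A : set (chart R T d)) g (S S' : set T) :
  S `<=` S' -> (volume A g S <= volume A g S')%E.
Proof.
move=> SS'; apply: ge_ereal_sup => _ [k [c [U [Ac bU tU ->]]]]; apply: ereal_sup_ubound.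
exists k, c, U; split=> // i; have [bUi Ui] := bU i; split=> // x /Ui[cx Sx].
by split=> //; exact: SS'.
Qed.

Lemma is_wtensor_refl (M : Type) d (A : set (chart R M d)) N (K W : M -> 'rV[R]_N) :
  is_wtensor A K W (wtensor K W).
Proof. by []. Qed.

Lemma wtensor_const_weight (M : Type) d N (K W : M -> 'rV[R]_N) (c : chart R M d) u (t : R) :
  0 <= t -> (forall i, W (cinv c u) 0 i = t ^+ 2) ->
  Num.sqrt (\det (wtensor K W c u)) =
  t ^+ d * Num.sqrt (\det ('J (K \o cinv c) u *m ('J (K \o cinv c) u)^T)).
Proof.
move=> t0 Wt; have WE : W (cinv c u) = const_mx (t ^+ 2) by apply/rowP => i; rewrite mxE Wt.
rewrite /wtensor WE diag_const_mx mul_mx_scalar -scalemxAl detZ -exprM mulnC exprM.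
by rewrite sqrtrM ?sqr_ge0// sqrtr_sqr ger0_norm// exprn_ge0.
Qed.

(** Near [e], the values of [s \o cmap b \o p] lie where a local section inverts [p]. Having the
    same projection as the points themselves, they are equal to them. *)
Lemma piece_open (E M : topologicalType) d (C : set (chart R E d)) (A : set (chart R M d)) (p : E -> M)
    (b : chart R M d) (V : set 'rV[R]_d) s :
  smooth_manifold A -> smooth_covering C A p -> A b -> open V -> is_lift p (cinv b) V s ->
  open (piece p b V s).
Proof.
move=> smA cov Ab oV [cs ps]; have cp := smooth_map_continuous (covering_smooth cov).
rewrite openE => e [be Ve se].
have [W [[oW We] /(_ e We)[sW [_ _ _ sWp]]]] := covering_local_section cov (p e).
have cb : {for e, continuous (fun e' => cmap b (p e'))}.
  by apply: (@continuous_comp _ _ _ p (cmap b)); [exact: cp|exact: (chart_cmap_continuous smA Ab be)].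
have csb : {for e, continuous (fun e' => s (cmap b (p e')))}.
  by apply: (@continuous_comp _ _ _ (fun e' => cmap b (p e')) s) => //; exact: cs.
have n1 : \forall e' \near e, cdom b (p e').
  by apply: cp; apply: open_nbhs_nbhs; split=> //; exact: (chart_open_dom smA).
have n2 : \forall e' \near e, V (cmap b (p e')) by apply: cb; exact: open_nbhs_nbhs.
have n3 : \forall e' \near e, sW (p (s (cmap b (p e')))) = s (cmap b (p e')).
  move: csb; rewrite /prop_for /continuous_at se => csb; exact: (csb _ sWp).
rewrite /interior; near=> e'.
have be' : cdom b (p e') by near: e'.
have Ve' : V (cmap b (p e')) by near: e'.
split=> //; have <- : sW (p (s (cmap b (p e')))) = s (cmap b (p e')) by near: e'.
by rewrite ps// (chart_cmapK smA)//; near: e'.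
Unshelve. all: by end_near. Qed.

End DensityFacts.

(** * Volume of a compact manifold *)

Section CompactVolume.
Context {R : realType} {M : topologicalType} {d : nat}.
Variable A : set (chart R M d).
Hypotheses (smA : smooth_manifold A) (cM : compact [set: M]).

Lemma sphere_ball_volume (u : 'rV[R]_d) (r : R) : 0 <= r ->
  (lebesgueV d (sphere_ball u r) <= ((2 * r) ^+ d)%:E)%E.
Proof.
move=> r0; have -> : (2 * r) ^+ d = \prod_(i < d) ((u 0 i + r) - (u 0 i - r)).
  by rewrite -[d in LHS]card_ord -prodr_const; apply: eq_bigr => i _; ring.
have lohi i : u 0 i - r <= u 0 i + r by lra.
rewrite -(lebesgueV_box lohi); apply: le_measure; [|apply: mem_set; exact: measurable_box|].
  by apply: mem_set; apply: measurable_open; exact: sphere_ball_open.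
move=> w wr /= i; have := le_lt_trans (rV_coord_le (w - u) i) wr.
by rewrite mxE [(- u) 0 i]mxE ltr_norml => /andP[h1 h2]; apply/andP; split; lra.
Qed.

(** [V] precedes the metric and the factor [t], which lets [del] be chosen after it. On each of
    finitely many chart balls, [piece_volume] is applied to the identity as a covering. *)
Lemma compact_volume (h : chart R M d -> 'rV[R]_d -> R) :
  (forall c u, A c -> ccod c u -> {for u, continuous (h c)}) ->
  exists2 V, 0 <= V & forall N (K W : M -> 'rV[R]_N) g t, smooth_fun A K -> smooth_fun A W ->
    is_wtensor A K W g -> 0 <= t ->
    (forall c u, A c -> ccod c u -> Num.sqrt (\det (g c u)) <= t * h c u) ->
    (volume A g setT <= (t * V)%:E)%E.
Proof.
move=> ch; have chA : forall c, A c -> is_chart c by have [_ _ hA _ _] := smA.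
have /choice[c hc] : forall x, exists c : chart R M d * R, [/\ A c.1, cdom c.1 x, 0 < c.2 &
    forall u, `|u - cmap c.1 x| <= c.2 -> ccod c.1 u].
  by move=> x; have [c [r h']] := chart_ball smA x; exists (c, r).
pose F x := chart_ball_set (c x).1 (cmap (c x).1 x) (c x).2.
have oF x : open (F x) by apply: (chart_ball_set_open smA); have [] := hc x.
have [s [_ sF]] : exists s : seq M, (forall x, x \in s -> [set: M] x) /\
    forall x, [set: M] x -> exists2 y, y \in s & F y x.
  apply: compact_finite_subcover => // x _; split=> //; have [_ cx r0 _] := hc x.
  by split=> //; rewrite /sphere_ball /= subrr normr0.
have /choice[D hD] : forall x, exists D : R, 0 <= D /\
    forall u, `|u - cmap (c x).1 x| <= (c x).2 -> `|h (c x).1 u| <= D.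
  move=> x; have [Ac _ _ rc] := hc x.
  have [|D D0 hD] := compact_bound (g := h (c x).1) (@closed_ball_compact R d (cmap (c x).1 x) (c x).2).
    by move=> u /rc cu; exact: ch.
  by exists D.
have r0 x : 0 < (c x).2 by have [] := hc x.
(* The bound for one chart ball: [D x] for the density, [2] for the constant [K] of [piece_volume],
   and the volume of a box of side twice the radius. *)
pose v x := D x * 2 * (2 * (c x).2) ^+ d.
have v0 x : 0 <= v x.
  by have [D0 _] := hD x; rewrite !mulr_ge0// exprn_ge0// mulr_ge0// ltW.
exists (\sum_(j < size s) v (tnth (in_tuple s) j)); first by apply: sumr_ge0.
move=> N K W g t sK sW gW t0 gt.
have pid c' e : A c' -> cdom c' e -> pullback A g id c' (cmap c' e) = g c' (cmap c' e).
  move=> Ac ce.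
  by rewrite (pullback_wtensor smA chA (smooth_map_id smA) sK gW Ac (chart_cod ce)) gW.
have gcont : continuous_density A g.
  move=> c' u Ac cu.
  have := pullback_continuous_density smA smA (smooth_map_id smA) sK sW gW Ac cu.
  apply: continuous_near_eq; apply: filterS (near_open (chart_open_cod smA Ac) cu) => w cw.
  by have [cw' wE] := chart_cinvP smA Ac cw; rewrite -wE pid.
have gEM c' b e : A c' -> A b -> cdom c' e -> cdom b e ->
    Num.sqrt (\det (g c' (cmap c' e))) =
    `|\det ('J (local_rep id c' b) (cmap c' e))| * Num.sqrt (\det (g b (cmap b e))).
  by move=> Ac Ab ce be; rewrite -(pullback_density smA smA (smooth_map_id smA) sK gW Ac Ab ce be) pid.
have Jun c' b e : A c' -> A b -> cdom c' e -> cdom b e -> 'J (local_rep id c' b) (cmap c' e) \in unitmx.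
  exact: (transition_jacobian_unit smA).
apply: le_trans (volume_cover smA gcont (Q := fun j : 'I_(size s) => F (tnth (in_tuple s) j)) _ _) _ => //.
  move=> x _; have [y ys Fy] := sF x Logic.I.
  by have /tnthP[j yE] : y \in in_tuple s by []; exists j => //; rewrite -yE.
rewrite mulr_sumr -sumEFin; apply: lee_sum => j _; move: (tnth _ j) => x {j}.
have [Ac cx _ rc] := hc x; have [D0 hDx] := hD x.
have lV : is_lift id (cinv (c x).1) (sphere_ball (cmap (c x).1 x) (c x).2) (cinv (c x).1).
  by split=> // u ur; apply: (chart_cinv_continuous smA Ac); apply: rc; exact: ltW.
have tD0 : 0 <= t * D x by rewrite mulr_ge0.
have K1 : 1 < 2 :> R by rewrite ltr1n.
have bnd w : sphere_ball (cmap (c x).1 x) (c x).2 w -> [set: M] (cinv (c x).1 w) ->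
    Num.sqrt (\det (g (c x).1 w)) <= t * D x.
  move=> wr _; have wc := rc w (ltW wr); apply: le_trans (gt _ _ Ac wc) _.
  by apply: ler_wpM2l => //; apply: le_trans (ler_norm _) _; apply: hDx; exact: ltW.
have rc' : sphere_ball (cmap (c x).1 x) (c x).2 `<=` ccod (c x).1 by move=> u /ltW; exact: rc.
have pv := piece_volume smA smA (smooth_map_id smA) Jun gEM Ac (@sphere_ball_open _ _ _ _) rc' lV openT tD0 K1 bnd.
apply: le_trans (volume_le _ _ _) (le_trans pv _).
  by move=> y [cy uy]; split=> //; split=> //; rewrite (chart_cmapK smA).
rewrite preimage_setT setIT; apply: le_trans (lee_wpmul2l _ (sphere_ball_volume _ (ltW (r0 x)))) _.
  by rewrite lee_fin mulr_ge0.
by rewrite -EFinM /v -!mulrA.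
Qed.

End CompactVolume.

Lemma weighted_sum_row_mx {R : realType} N (b : R) (u u' : 'rV[R]_N) (s s' : 'rV[R]_1) :
  \sum_i row_mx (const_mx b : 'rV[R]_N) (const_mx 1 : 'rV[R]_1) 0 i *
    (row_mx u s 0 i - row_mx u' s' 0 i) ^+ 2 = b * sqnorm (u - u') + (s 0 0 - s' 0 0) ^+ 2.
Proof.
rewrite big_split_ord /= big_ord1 !row_mxEr [const_mx 1 0 _]mxE mul1r; congr (_ + _).
  rewrite sqnormE mulr_sumr; apply: eq_bigr => i _.
  by rewrite !row_mxEl !mxE.
Qed.

(** * The spiked metric on the product *)

Section SpikedMetric.
Context {R : realType} {Sigma X : topologicalType} {n m N1 N2 : nat}.
Variables (A : set (chart R Sigma n)) (B : set (chart R X m)).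
Hypotheses (smA : smooth_manifold A) (smB : smooth_manifold B).
Variables (fS : Sigma -> 'rV[R]_N1) (fX : X -> 'rV[R]_N2).
Hypotheses (sfS : smooth_fun A fS) (sfX : smooth_fun B fX).
Hypotheses (ifS : injective fS) (ifX : injective fX).
Hypotheses (mfS : forall x, immersive_at A fS x) (mfX : forall x, immersive_at B fX x).
Variables (c0 : chart R X m) (v0 : 'rV[R]_m) (r0 : R).
Hypotheses (Bc0 : B c0) (r00 : 0 < r0) (rc0 : forall v, `|v - v0| <= r0 -> ccod c0 v).
Variables (del Lam : R).
Hypotheses (del0 : 0 < del) (delLam : del <= Lam).

Notation M := (Sigma * X)%type.
Notation P := (prod_atlas A B).

Definition product_map (q : M) : 'rV[R]_(N1 + N2) := row_mx (fS q.1) (fX q.2).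
Notation f := product_map.

Definition spike rho : X -> 'rV[R]_1 := chart_extend c0 (spike_profile v0 rho).
Definition cutoff rho : X -> 'rV[R]_1 := chart_extend c0 (cutoff_profile v0 rho).

Definition slice_weight rho (x : X) : 'rV[R]_N1 :=
  const_mx (Lam ^+ 2 - (Lam ^+ 2 - del ^+ 2) * cutoff rho x 0 0).

(** The height is one more coordinate, of constant weight [1], hence it varies along a path by at
    most the length of the path. *)
Definition spiked_map rho (q : M) : 'rV[R]_((N1 + N2) + 1) := row_mx (f q) (spike rho q.2).

Definition spiked_weight rho (q : M) : 'rV[R]_((N1 + N2) + 1) :=
  row_mx (row_mx (slice_weight rho q.2) (const_mx (Lam ^+ 2))) (const_mx 1).

Definition spiked_metric rho : tensor2 R M (n + m) := wtensor (spiked_map rho) (spiked_weight rho).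

Let smP : smooth_manifold P. Proof. exact: prod_smooth_manifold. Qed.

Lemma Lam_gt0 : 0 < Lam. Proof. exact: lt_le_trans delLam. Qed.

Lemma del_Lam_sqr : del ^+ 2 <= Lam ^+ 2.
Proof. by rewrite ler_pXn2r// nnegrE ltW// Lam_gt0. Qed.

Lemma product_map_smooth : smooth_fun P f.
Proof.
by apply: smooth_fun_row_mx; [exact: prod_smooth_manifold|exact: smooth_fun_fst|exact: smooth_fun_snd].
Qed.

Lemma product_map_inj : injective f.
Proof. by move=> [s x] [s' x'] /eq_row_mx[/= /ifS -> /ifX ->]. Qed.

Lemma product_map_immersive q : immersive_at P f q.
Proof. exact: immersive_prod. Qed.

Section Rho.
Variable rho : R.
Hypotheses (rho0 : 0 < rho) (rhor : 2 * rho <= r0).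

Lemma rho_r0 v : `|v - v0| <= 2 * rho -> ccod c0 v.
Proof. by move=> vr; apply: rc0; exact: le_trans vr rhor. Qed.

Lemma rho_le v : `|v - v0| <= rho -> `|v - v0| <= 2 * rho.
Proof. by move=> vr; apply: le_trans vr _; rewrite ler_peMl ?ler1n// ltW. Qed.

Lemma spike_smooth : smooth_fun B (spike rho).
Proof.
apply: (chart_extend_smooth smB Bc0 (u0 := v0) (r := rho)).
- by move=> v /rho_le; exact: rho_r0.
- exact: spike_profile_smooth.
- by move=> v; exact: spike_profile_out.
Qed.

Lemma cutoff_smooth : smooth_fun B (cutoff rho).
Proof.
apply: (chart_extend_smooth smB Bc0 (u0 := v0) (r := rho)).
- by move=> v /rho_le; exact: rho_r0.
- exact: cutoff_profile_smooth.
- move=> v vr; apply: cutoff_profile_out => //; apply: le_trans vr.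
  by rewrite ler_pdivrMr// ler_peMr ?ler1n// ltW.
Qed.

Lemma cutoff_bounds x : 0 <= cutoff rho x 0 0 <= 1.
Proof.
by rewrite /cutoff /chart_extend; case: asboolP => _; [exact: cutoff_profile_bounds|rewrite mxE lexx ler01].
Qed.

Lemma spike_cutoff x : spike rho x 0 0 < 3 -> cutoff rho x 0 0 = 0.
Proof.
rewrite /spike /cutoff /chart_extend; case: asboolP => _; last by rewrite mxE.
move=> F3; rewrite cutoff_profile_out ?mxE//; rewrite leNgt; apply/negP => /ltW /(spike_profile_high rho0).
by rewrite leNgt F3.
Qed.

Lemma spike_gt0 x : 0 < spike rho x 0 0 -> chart_ball_set c0 v0 (2 * rho) x.
Proof.
rewrite /spike /chart_extend; case: asboolP => [cx|_]; last by rewrite mxE ltxx.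
move=> F0; split=> //; rewrite /sphere_ball /= ltNge; apply/negP => vr.
move: F0; rewrite spike_profile_out ?mxE ?ltxx//; apply: le_trans vr.
by rewrite ler_peMl ?ler1n// ltW.
Qed.

Lemma spike_out x : ~ (cinv c0 @` [set v | `|v - v0| <= rho]) x -> spike rho x = 0.
Proof.
rewrite /spike /chart_extend; case: asboolP => // cx nx; apply: spike_profile_out => //.
rewrite leNgt; apply/negP => vr; apply: nx; exists (cmap c0 x); first exact: ltW.
exact: (chart_cmapK smB).
Qed.

Lemma slice_weight_bounds x i : del ^+ 2 <= slice_weight rho x 0 i <= Lam ^+ 2.
Proof.
rewrite mxE; have /andP[c1 c2] := cutoff_bounds x; have dL := del_Lam_sqr.
move: (cutoff rho x 0 0) (del ^+ 2) (Lam ^+ 2) c1 c2 dL => t a b; nra.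
Qed.

Lemma slice_weight_low x i : spike rho x 0 0 < 3 -> slice_weight rho x 0 i = Lam ^+ 2.
Proof. by move=> /spike_cutoff; rewrite mxE => ->; rewrite mulr0 subr0. Qed.

Lemma slice_weight_smooth : smooth_fun B (slice_weight rho).
Proof.
move=> c Bc k; have oc := chart_open_cod smB Bc; apply/Ck_mxP => // i j.
apply: (Ck_ext (f := fun u => Lam ^+ 2 + - (Lam ^+ 2 - del ^+ 2) * cutoff rho (cinv c u) 0 0)) => //.
  by move=> u _; rewrite /= mxE mulNr.
apply: CkD => //; first exact: Ck_cst.
apply: CkM => //; first exact: Ck_cst.
by have /(Ck_mxP _ _ oc)/(_ 0 0) := cutoff_smooth Bc k.
Qed.

Lemma smooth_fun_cst N (a : 'rV[R]_N) : smooth_fun P (fun _ => a).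
Proof. by move=> c _ k; exact: Ck_cst. Qed.

Lemma spiked_map_smooth : smooth_fun P (spiked_map rho).
Proof.
apply: (smooth_fun_row_mx smP); first exact: product_map_smooth.
exact: (smooth_fun_snd smA smB spike_smooth).
Qed.

Lemma spiked_weight_smooth : smooth_fun P (spiked_weight rho).
Proof.
apply: (smooth_fun_row_mx smP); last exact: smooth_fun_cst.
apply: (smooth_fun_row_mx smP); last exact: smooth_fun_cst.
exact: (smooth_fun_snd smA smB slice_weight_smooth).
Qed.

Lemma spiked_weight_left q i : del ^+ 2 <= spiked_weight rho q 0 (lshift 1 i) <= Lam ^+ 2.
Proof.
rewrite /spiked_weight row_mxEl; case: (split_ordP i) => j ->.
  by rewrite row_mxEl slice_weight_bounds.
by rewrite row_mxEr mxE lexx del_Lam_sqr.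
Qed.

Lemma spiked_weight_low q i : spike rho q.2 0 0 < 3 -> spiked_weight rho q 0 (lshift 1 i) = Lam ^+ 2.
Proof.
move=> F3; rewrite /spiked_weight row_mxEl; case: (split_ordP i) => j ->.
  by rewrite row_mxEl slice_weight_low.
by rewrite row_mxEr mxE.
Qed.

Lemma spiked_weight_right q j : spiked_weight rho q 0 (rshift _ j) = 1.
Proof. by rewrite /spiked_weight row_mxEr mxE. Qed.

Lemma spiked_weight_gt0 q i : 0 < spiked_weight rho q 0 i.
Proof.
case: (split_ordP i) => j ->; last by rewrite spiked_weight_right.
by have /andP[+ _] := spiked_weight_left q j; apply: lt_le_trans; rewrite exprn_gt0.
Qed.

Lemma spiked_metric_riemannian : riemannian_metric P (spiked_metric rho).
Proof.
apply: (wtensor_riemannian smP); [exact: spiked_map_smooth|exact: spiked_weight_smooth|exact: spiked_weight_gt0|].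
move=> q; apply: immersive_row_mx; first exact: product_map_smooth.
- exact: (smooth_fun_snd smA smB spike_smooth).
- by left; exact: product_map_immersive.
Qed.

Section Covering.
Context {E : topologicalType}.
Variables (C : set (chart R E (n + m))) (p : E -> M).

(** Two constant weights are tested: [del ^+ 2], dominated everywhere, which bounds the displacement
    and the height at once; and [Lam ^+ 2], dominated below the height [3], where the cutoff
    vanishes. *)
Lemma controlled_bounds y y' a : 0 <= a ->
  controlled (spiked_map rho \o p) (spiked_weight rho \o p) y y' a -> exists g : R -> E,
  [/\ continuous g, g 0 = y, g 1 = y',
    forall t : R, 0 <= t -> t <= 1 -> `|f (p (g t)) - f (p y)| <= a / del /\
       `|spike rho (p (g t)).2 0 0 - spike rho (p y).2 0 0| <= a &
    (forall t : R, 0 <= t -> t <= 1 -> spike rho (p (g t)).2 0 0 < 3) ->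
      forall t : R, 0 <= t -> t <= 1 -> norm2 (f (p (g t)) - f (p y)) <= a / Lam].
Proof.
move=> a0 [g [cg g0 g1 gK]]; exists g.
pose w b : 'rV[R]_((N1 + N2) + 1) := row_mx (const_mx (b ^+ 2)) (const_mx 1).
have w0 b i : 0 <= w b 0 i.
  by rewrite /w; case: (split_ordP i) => j ->; rewrite ?row_mxEl ?row_mxEr mxE// sqr_ge0.
have sumE b (t : R) : \sum_i w b 0 i * ((spiked_map rho \o p) (g t) 0 i - (spiked_map rho \o p) y 0 i) ^+ 2 =
    b ^+ 2 * sqnorm (f (p (g t)) - f (p y)) + (spike rho (p (g t)).2 0 0 - spike rho (p y).2 0 0) ^+ 2.
  exact: weighted_sum_row_mx.
have bound b (t : R) : b ^+ 2 * sqnorm (f (p (g t)) - f (p y)) + (spike rho (p (g t)).2 0 0 - spike rho (p y).2 0 0) ^+ 2 <= a ^+ 2 ->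
    0 < b -> norm2 (f (p (g t)) - f (p y)) <= a / b /\ `|spike rho (p (g t)).2 0 0 - spike rho (p y).2 0 0| <= a.
  move: (f _ - f _) (spike _ _ _ _ - _) => u x; rewrite -norm2_sqr -exprMn => h b0.
  have h1 : (b * norm2 u) ^+ 2 <= a ^+ 2 by apply: le_trans h; rewrite lerDl sqr_ge0.
  have h2 : x ^+ 2 <= a ^+ 2 by apply: le_trans h; rewrite lerDr sqr_ge0.
  split; first by rewrite ler_pdivlMr// mulrC -(@ler_pXn2r _ 2)// nnegrE ?mulr_ge0 ?norm2_ge0// ltW.
  by rewrite -(@ler_pXn2r _ 2) ?nnegrE// real_normK// num_real.
split=> // [t t0 t1|F3 t t0 t1].
  have := gK (w del) setT (w0 del) _ _ t t0 t1; rewrite sumE => h.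
  have [|h1 h2] := bound del t _ del0; last first.
    by split=> //; apply: le_trans h1; exact: norm_le_norm2.
  apply: h => // q i _; rewrite /w /=; case: (split_ordP i) => j ->.
    by rewrite row_mxEl mxE; have /andP[] := spiked_weight_left (p q) j.
  by rewrite row_mxEr mxE spiked_weight_right.
have := gK (w Lam) [set q | spike rho (p q).2 0 0 < 3] (w0 Lam) _ F3 t t0 t1; rewrite sumE => h.
have [|h1 _] := bound Lam t _ Lam_gt0; last exact: h1.
apply: h => q i /= q3; rewrite /w /=; case: (split_ordP i) => j ->.
  by rewrite row_mxEl mxE spiked_weight_low.
by rewrite row_mxEr mxE spiked_weight_right.
Qed.

Lemma chain_spike theta e0 y l : chain (spiked_map rho \o p) (spiked_weight rho \o p) theta e0 y l ->
  `|spike rho (p y).2 0 0 - spike rho (p e0).2 0 0| <= l.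
Proof.
elim=> [|y1 y2 l1 a ch IH a0 _ ctl]; first by rewrite subrr normr0.
have [g [_ _ g1 gF _]] := controlled_bounds a0 ctl.
have [_] := gF 1 ler01 (lexx 1); rewrite g1 => F1.
rewrite -[X in `|X|](subrKA (spike rho (p y1).2 0 0)) addrC.
exact: le_trans (ler_normD _ _) (lerD IH F1).
Qed.

End Covering.

End Rho.

Section SpikeDensity.

Lemma spiked_metric_split rho c u : 0 < rho -> 2 * rho <= r0 -> P c -> ccod c u ->
  spiked_metric rho c u =
  wtensor f (fun q => row_mx (slice_weight rho q.2) (const_mx (Lam ^+ 2))) c u +
  wtensor (spike rho \o snd) (fun _ => const_mx 1) c u.
Proof.
move=> rho0 rhor Pc cu; apply: wtensor_row_mx.
  exact: (smooth_fun_differentiable product_map_smooth Pc cu).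
have sF := smooth_fun_snd smA smB (spike_smooth rho0 rhor).
exact: (smooth_fun_differentiable sF Pc cu).
Qed.

(* The spike adds a rank one matrix with entries of order [rho^-2] to a bounded matrix. *)
Lemma spike_density_bound a u1 r1 : A a -> (forall v, `|v - u1| <= r1 -> ccod a v) ->
  exists2 D, 0 <= D & forall rho w, 0 < rho -> 2 * rho <= r0 -> rho <= 1 ->
    `|lsubmx w - u1| <= r1 -> `|rsubmx w - v0| <= 2 * rho ->
    Num.sqrt (\det (spiked_metric rho (prod_chart a c0) w)) <= D / rho.
Proof.
move=> Aa ra; pose b' := prod_chart a c0.
have Pb' : P b' by exists a, c0.
have ob' : open (ccod b') by exact: (chart_open_cod smP Pb').
(* A compact set that does not depend on [rho], so that one constant bounds the derivatives of the
   embedding. *)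
pose Kc : set 'rV[R]_(n + m) := [set w | `|lsubmx w - u1| <= r1 /\ `|rsubmx w - v0| <= r0].
have cKc : compact Kc.
  have cb : compact [set w : 'rV[R]_(n + m) | `|w - row_mx u1 v0| <= Num.max r1 r0] by exact: closed_ball_compact.
  apply: (subclosed_compact _ cb).
    have -> : Kc = (fun w : 'rV[R]_(n + m) => `|lsubmx w - u1|) @^-1` [set x | x <= r1] `&`
      (fun w : 'rV[R]_(n + m) => `|rsubmx w - v0|) @^-1` [set x | x <= r0] by [].
    have cl : continuous (fun w : 'rV[R]_(n + m) => `|lsubmx w - u1|).
      move=> w; apply: (@continuous_comp _ _ _ (fun w : 'rV[R]_(n + m) => lsubmx w - u1) (fun v => `|v|)); last exact: norm_continuous.
      by apply: continuousB; [exact: lsubmx_continuous|exact: cst_continuous].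
    have cr : continuous (fun w : 'rV[R]_(n + m) => `|rsubmx w - v0|).
      move=> w; apply: (@continuous_comp _ _ _ (fun w : 'rV[R]_(n + m) => rsubmx w - v0) (fun v => `|v|)); last exact: norm_continuous.
      by apply: continuousB; [exact: rsubmx_continuous|exact: cst_continuous].
    apply: closedI; apply: closed_comp; try exact: closed_le.
      by move=> w _; exact: cl.
    by move=> w _; exact: cr.
  move=> w [wl wr]; have m0 : 0 <= Num.max r1 r0 by rewrite le_max (ltW r00) orbT.
  have wE : w - row_mx u1 v0 = row_mx (lsubmx w - u1) (rsubmx w - v0).
    by rewrite -{1}(hsubmxK w) opp_row_mx add_row_mx.
  apply/rV_norm_leP => // i; rewrite wE; case: (split_ordP i) => j ->.
    by rewrite row_mxEl; apply: le_trans (rV_coord_le _ _) (le_trans wl _); rewrite le_max lexx.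
  by rewrite row_mxEr; apply: le_trans (rV_coord_le _ _) (le_trans wr _); rewrite le_max lexx orbT.
have Kcb : Kc `<=` ccod b'.
  by move=> w [wl wr]; rewrite prod_cod; split; [exact: ra|exact: rc0].
have [Cf Cf0 hCf] := jacobian_bound ob' cKc Kcb (product_map_smooth Pb' 1).
have [Bs Bs0 hBs] := @spike_profile_jacobian R m.
pose d := (n + m)%N; pose G0 := \sum_(l < N1 + N2) Lam ^+ 2 * (Cf * Cf).
pose a1 := (d`!)%:R * G0 ^+ d; pose a2 := d%:R * d%:R * ((d.-1)`!)%:R * G0 ^+ d.-1.
have G00 : 0 <= G0 by apply: sumr_ge0 => l _; rewrite mulr_ge0 ?sqr_ge0// mulr_ge0.
have a10 : 0 <= a1 by rewrite mulr_ge0// exprn_ge0.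
have a20 : 0 <= a2 by rewrite !mulr_ge0// exprn_ge0.
exists (Num.sqrt (a1 + a2 * Bs ^+ 2)); first exact: sqrtr_ge0.
move=> rho w rho0 rhor rho1 wl wr.
have wK : Kc w by split=> //; exact: le_trans wr rhor.
have wb := Kcb w wK.
rewrite spiked_metric_split//.
set G := wtensor f _ _ _.
have uG : G \in unitmx.
  suff /posdef_unit[] : posdef G by [].
  have [||||_ h1 h2 _] := wtensor_riemannian smP (K := f)
      (W := fun q => row_mx (slice_weight rho q.2) (const_mx (Lam ^+ 2))).
  - exact: product_map_smooth.
  - apply: (smooth_fun_row_mx smP); last exact: smooth_fun_cst.
    exact: (smooth_fun_snd smA smB (slice_weight_smooth rho0 rhor)).
  - move=> q i; have := spiked_weight_gt0 rho q (lshift 1 i); by rewrite /spiked_weight row_mxEl.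
  - exact: product_map_immersive.
  - by split; [exact: h1|move=> v v1; exact: h2].
have GC i j : `|G i j| <= G0.
  rewrite /G /wtensor weighted_gramE; apply: le_trans (ler_norm_sum _ _ _) _.
  apply: ler_sum => l _; rewrite !normrM ler_pM ?mulr_ge0//.
    have /andP[w1 w2] := spiked_weight_left rho (cinv b' w) l.
    move: w1 w2; rewrite /spiked_weight row_mxEl => w1 w2.
    by rewrite ger0_norm// (le_trans _ w1)// sqr_ge0.
  by rewrite ler_pM// hCf.
set JF := 'J ((spike rho \o snd) \o cinv b') w.
have -> : wtensor (spike rho \o snd) (fun _ => const_mx 1) b' w = (JF^T)^T *m JF^T.
  by rewrite /wtensor diag_const_mx mulmx1 trmxK.
have rc : ccod c0 (rsubmx w) by move: wb; rewrite prod_cod => -[].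
have dsp : differentiable (spike_profile v0 rho) (rsubmx w).
  by have [+ _] := @spike_profile_smooth R m v0 rho 1; apply.
have nsp : \forall v \near rsubmx w, spike_profile v0 rho v = (spike rho \o cinv c0) v.
  apply: filterS (near_open (chart_open_cod smB Bc0) rc) => v cv.
  by have [cv' vE] := chart_cinvP smB Bc0 cv; rewrite /spike /= /chart_extend asboolT// vE.
have JFB i : `|JF^T 0 i| <= Bs / rho.
  rewrite mxE; apply: (@jacobian_rsubmx _ _ _ _ (spike rho \o cinv c0)).
  - exact: near_eq_differentiable nsp dsp.
  - by rewrite divr_ge0// ltW.
  - by move=> i' j'; rewrite (jacobian_near_eq dsp nsp) hBs.
have h := det_rank_one_entries_le uG GC JFB (divr_ge0 Bs0 (ltW rho0)).
(* As [rho <= 1], the bounded term [a1] is absorbed into the one of order [rho^-2]. *)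
apply: (@le_trans _ _ (Num.sqrt ((a1 + a2 * Bs ^+ 2) / rho ^+ 2))).
  apply: ler_wsqrtr; apply: le_trans h _; rewrite mulrDl.
  rewrite -/d -/a1 -/a2 expr_div_n mulrA lerD2r ler_peMr//.
  by rewrite invf_ge1 ?exprn_gt0// expr_le1// ltW.
have s0 : 0 <= a1 + a2 * Bs ^+ 2 by rewrite addr_ge0// mulr_ge0// sqr_ge0.
by rewrite -exprVn (sqrtrM _ s0) sqrtr_sqr ger0_norm// invr_ge0 ltW.
Qed.

End SpikeDensity.

Section Slice.
Variable rho : R.
Hypotheses (rho0 : 0 < rho) (rhor : 2 * rho <= r0).

Notation x0 := (cinv c0 v0).

Lemma slice_weight_center : slice_weight rho x0 = const_mx (del ^+ 2).
Proof.
have [cx xE] := chart_cinvP smB Bc0 (rc0 (v := v0) ltac:(by rewrite subrr normr0 ltW)).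
apply/rowP => i; rewrite !mxE /cutoff /chart_extend asboolT// xE cutoff_profile_center.
by rewrite mxE eqxx mulr1n mulr1 opprB addrC subrK.
Qed.

Lemma slice_smooth : smooth_map A P (fun s => (s, x0)).
Proof.
apply: smooth_map_slice => //; first by have [_ _ h _ _] := smA.
exact: smooth_map_id.
Qed.

(** Along the slice [fX] and the spike are constant and contribute zero; the block of [fS] has
    weight [del ^+ 2], since the cutoff is [1] over the tip. *)
Lemma slice_density c u : A c -> ccod c u ->
  Num.sqrt (\det (pullback P (spiked_metric rho) (fun s => (s, x0)) c u)) =
  del ^+ n * Num.sqrt (\det ('J (fS \o cinv c) u *m ('J (fS \o cinv c) u)^T)).
Proof.
move=> Ac cu; have chA : forall c, A c -> is_chart c by have [_ _ h _ _] := smA.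
rewrite (pullback_wtensor smP chA slice_smooth (spiked_map_smooth rho0 rhor) (@is_wtensor_refl _ _ _ _ _ _ _) Ac cu).
have cst N (a : 'rV[R]_N) (W : Sigma -> 'rV[R]_N) : wtensor (fun _ => a) W c u = 0.
  by rewrite /wtensor (_ : 'J _ u = 0) ?mul0mx//; exact: jacobian_cst.
have dS := smooth_fun_differentiable sfS Ac cu.
rewrite (_ : wtensor _ _ c u = wtensor fS (fun _ => const_mx (del ^+ 2)) c u).
  by apply: wtensor_const_weight => [|i]; [exact: ltW|rewrite mxE].
rewrite -slice_weight_center.
have dX N (a : 'rV[R]_N) : differentiable ((fun _ : Sigma => a) \o cinv c) u by exact: differentiable_cst.
have dSX : differentiable ((fun s => row_mx (fS s) (fX x0)) \o cinv c) u.
  by have [] := derive_row_mx 0 dS (dX _ (fX x0)).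
have E1 := wtensor_row_mx (K1 := fun s => row_mx (fS s) (fX x0)) (K2 := fun _ => spike rho x0)
  (fun _ => row_mx (slice_weight rho x0) (const_mx (Lam ^+ 2))) (fun _ => const_mx 1) dSX (dX _ _).
have E2 := wtensor_row_mx (K1 := fS) (K2 := fun _ => fX x0)
  (fun _ => slice_weight rho x0) (fun _ => const_mx (Lam ^+ 2)) dS (dX _ _).
rewrite !cst !addr0 in E1 E2; apply: etrans E1 _; exact: E2.
Qed.

End Slice.

(** * Unit balls in a covering *)

Section Estimates.
Variables (k lam : R) (sq : seq M) (c : M -> chart R M (n + m)) (u : M -> 'rV[R]_(n + m))
  (r : M -> R) (b : M -> set M).
Hypotheses (k0 : 0 < k) (k1 : k < 1) (lam0 : 0 < lam) (gc : good_cover P f k lam sq c u r b).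

(** The radius is [2 * rho], and [rho] in [spike_free], so that both sets are open and still cover
    the manifold; [volume_cover] asks for open sets and tolerates the overlap. *)
Definition spike_zone rho : set M := [set q | chart_ball_set c0 v0 (2 * rho) q.2].

Definition spike_free rho : set M :=
  [set q | ~ (cinv c0 @` [set v | `|v - v0| <= rho]) q.2].

Lemma spike_zone_open rho : open (spike_zone rho).
Proof.
have -> : spike_zone rho = snd @^-1` chart_ball_set c0 v0 (2 * rho) by [].
by apply: open_comp => [q _|]; [exact: cvg_snd|exact: (chart_ball_set_open smB)].
Qed.

Lemma spike_free_open rho : 0 < rho -> 2 * rho <= r0 -> open (spike_free rho).
Proof.
move=> rho0 rhor; have hX : hausdorff_space X by have [] := smB.
have -> : spike_free rho = snd @^-1` (~` (cinv c0 @` [set v | `|v - v0| <= rho])) by [].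
apply: open_comp => [q _|]; first exact: cvg_snd.
apply: closed_openC; apply: compact_closed => //; apply: (cinv_compact smB Bc0) => v vr.
by apply: rc0; apply: le_trans vr (le_trans _ rhor); rewrite ler_peMl ?ler1n// ltW.
Qed.

Lemma spike_zone_or_free rho q : 0 < rho -> 2 * rho <= r0 -> spike_zone rho q \/ spike_free rho q.
Proof.
move=> rho0 rhor; have [[v vr vq]|nq] := pselect ((cinv c0 @` [set v | `|v - v0| <= rho]) q.2); [left|by right].
have v2 : `|v - v0| <= 2 * rho by apply: le_trans vr _; rewrite ler_peMl ?ler1n// ltW.
have [cv vE] := chart_cinvP smB Bc0 (rc0 (le_trans v2 rhor)).
rewrite /spike_zone /= -vq; split=> //; rewrite /sphere_ball /= vE.
by apply: le_lt_trans vr _; rewrite ltr_pMl// ltr1n.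
Qed.

Section OnCover.
Context {E : topologicalType}.
Variables (C : set (chart R E (n + m))) (p : E -> M) (rho : R).
Hypotheses (smE : smooth_manifold C) (cov : smooth_covering C P p).
Hypotheses (rho0 : 0 < rho) (rhor : 2 * rho <= r0).

Let gE : tensor2 R E (n + m) := pullback P (spiked_metric rho) p.

Lemma cover_density c' b' e : C c' -> P b' -> cdom c' e -> cdom b' (p e) ->
  Num.sqrt (\det (gE c' (cmap c' e))) =
  `|\det ('J (local_rep p c' b') (cmap c' e))| * Num.sqrt (\det (spiked_metric rho b' (cmap b' (p e)))).
Proof.
apply: (pullback_density smP smE (covering_smooth cov) (spiked_map_smooth rho0 rhor)).
exact: is_wtensor_refl.
Qed.

Lemma cover_continuous_density : continuous_density C gE.
Proof.
apply: (pullback_continuous_density smP smE (covering_smooth cov) (spiked_map_smooth rho0 rhor)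
  (spiked_weight_smooth rho0 rhor)).
exact: is_wtensor_refl.
Qed.

Lemma cover_ball_chain theta e0 y : 0 < theta -> rball C gE e0 1 y ->
  exists2 l, l < 1 & chain (spiked_map rho \o p) (spiked_weight rho \o p) theta e0 y l.
Proof.
have chC : forall c', C c' -> is_chart c' by have [_ _ h _ _] := smE.
have sp := covering_smooth cov.
apply: (rball_chain smE).
- exact: (smooth_fun_comp smP chC sp (spiked_map_smooth rho0 rhor)).
- exact: (smooth_fun_comp smP chC sp (spiked_weight_smooth rho0 rhor)).
- by apply: (is_wtensor_pullback smP chC sp (spiked_map_smooth rho0 rhor)); exact: is_wtensor_refl.
Qed.

(* Far from the spike the metric is [Lam ^ 2] times the one pulled back by [f], so that a unit
   ball which does not climb the spike stays in a single sheet. *)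
Lemma chain_near z Pz theta e0 y l : good_piece p sq c u r Pz -> Pz.1 = z ->
  lifted_piece p c u r Pz e0 -> b z (p e0) -> Lam^-1 <= lam -> spike rho (p e0).2 0 0 <= 2 ->
  chain (spiked_map rho \o p) (spiked_weight rho \o p) theta e0 y l -> l < 1 ->
  lifted_piece p c u r Pz y /\ norm2 (f (p y) - f (p e0)) <= l / Lam.
Proof.
move=> gP Pz1 le0 be0 Ll F2; have Lp := Lam_gt0.
(* The center is at height at most [2] and the total length is less than [1], so the path stays
   below [3], where all the weights of [f] are [Lam ^+ 2]. *)
have climb (x x1 x2 l' a : R) : `|x1 - x2| <= l' -> `|x - x1| <= a -> x2 <= 2 -> l' + a < 1 -> x < 3.
  by rewrite !ler_norml => /andP[_ h1] /andP[_ h2] h3 h4; lra.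
elim=> [_|y1 y2 l1 a ch IH a0 _ ctl la1]; first by rewrite subrr norm2_0 mul0r.
have [|ly1 ny1] := IH; first by apply: le_lt_trans la1; rewrite lerDl.
have [g [cg g0 g1 gF gL]] := controlled_bounds rho0 a0 ctl.
have Fy1 := chain_spike rho0 ch.
have F3 (t : R) : 0 <= t -> t <= 1 -> spike rho (p (g t)).2 0 0 < 3.
  move=> t0 t1; have [_] := gF t t0 t1.
  by move=> F; exact: (climb _ _ _ _ _ Fy1 F F2 la1).
have dist (t : R) : 0 <= t -> t <= 1 -> norm2 (f (p (g t)) - f (p e0)) <= (l1 + a) / Lam.
  move=> t0 t1; have -> : f (p (g t)) - f (p e0) = (f (p y1) - f (p e0)) + (f (p (g t)) - f (p y1)).
    by rewrite [RHS]addrC subrKA.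
  rewrite mulrDl; apply: le_trans (norm2_triangle _ _) _; apply: lerD; first exact: ny1.
  by apply: gL.
split; last by rewrite -g1; exact: dist.
rewrite -g1; apply: (piece_stay smE smP cov gc gP cg); first by rewrite g0.
move=> t t0 t1; have [_ _ _ lamQ _] := gc; rewrite Pz1; apply: lamQ be0 _.
apply: le_lt_trans (norm_le_norm2 _) _; apply: le_lt_trans (dist t t0 t1) _.
apply: lt_le_trans Ll; rewrite ltr_pdivrMr// mulVf// gt_eqF//.
Qed.

(** The spike vanishes on an open set there, hence so does its Jacobian, and what remains has the
    constant weight [Lam ^+ 2]. *)
Lemma spike_free_density z w (d := (n + m)%N) : P z -> ccod z w -> spike_free rho (cinv z w) ->
  Num.sqrt (\det (spiked_metric rho z w)) =
  Lam ^+ d * Num.sqrt (\det ('J (f \o cinv z) w *m ('J (f \o cinv z) w)^T)).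
Proof.
move=> Pz zw Nw; have [zd wE] := chart_cinvP smP Pz zw.
rewrite (spiked_metric_split rho0 rhor Pz zw) [X in _ + X](_ : _ = 0) ?addr0; last first.
  rewrite /wtensor (@jacobian_near_eq _ _ _ (fun _ => 0)) ?jacobian_cst ?mul0mx//.
  have oN := spike_free_open rho0 rhor.
  apply: filterS (near_open (preimage_cinv_open smP Pz oN) (conj zw Nw)) => v [_ Nv].
  by rewrite /= spike_out.
apply: wtensor_const_weight => [|i]; first by rewrite ltW// Lam_gt0.
have := spiked_weight_low rho0 (q := cinv z w) i; rewrite /spiked_weight row_mxEl; apply.
by rewrite spike_out// mxE.
Qed.

(** In the chart the set lies in the ellipsoid where [norm2 ((w - w0) *m S)] is less than
    [1 / (Lam * (1 - k))]. Its volume carries the factors [Lam^-(n + m)] and [1 / |\det S|], which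
    cancel against the density, at most [Lam ^+ (n + m) * (1 + k) * |\det S|]. The factor [9 / 8] is
    the loss in [piece_volume]. *)
Lemma near_piece_volume z Pz e0 : good_piece p sq c u r Pz -> Pz.1 = z -> lifted_piece p c u r Pz e0 ->
  (volume C gE ([set e | lifted_piece p c u r Pz e /\ (norm2 (f (p e) - f (p e0)) < Lam^-1)%R] `&`
      p @^-1` spike_free rho) <=
    ((1 + k) / (1 - k) ^+ (n + m) * (9 / 8))%:E * lebesgueV (n + m) (@euclidean_ball R (n + m)))%E.
Proof.
move=> gP Pz1 [ce0 ue0 _]; have [zs [cs ps]] := gP; rewrite Pz1 in ce0 ue0 zs cs ps.
have [Pc rz0 rzc] := cover_chart gc zs; have Lp := Lam_gt0.
have [/(_ z zs)[_ _ _ [S [uS hS1 hS2]]] _ _ _ _] := gc.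
have dS : 0 < `|\det S| by rewrite normr_gt0 -unitfE -unitmxE.
pose V : set 'rV[R]_(n + m) := [set w | sphere_ball (u z) (r z) w /\ norm2 (f (cinv (c z) w) - f (p e0)) < Lam^-1].
have Vb w : V w -> ccod (c z) w by move=> [/rzc].
have cfi w : ccod (c z) w -> {for w, continuous (fun w => norm2 (f (cinv (c z) w) - f (p e0)))}.
  move=> cw; apply: (@continuous_comp _ _ _ (fun w => sqnorm (f (cinv (c z) w) - f (p e0))) Num.sqrt); last exact: sqrt_continuous.
  apply: (@continuous_comp _ _ _ (fun w => f (cinv (c z) w) - f (p e0)) (@sqnorm R _)); last exact: sqnorm_continuous.
  apply: continuousB; last exact: cst_continuous.
  apply: (@continuous_comp _ _ _ (cinv (c z)) f); first exact: (chart_cinv_continuous smP Pc cw).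
  exact: (smooth_fun_continuous smP product_map_smooth).
have oV : open V.
  rewrite openE => w [wr wl]; apply: filterI.
    exact: (near_open (@sphere_ball_open _ _ (u z) (r z)) wr).
  exact: (cvgr_lt _ (cfi w (rzc _ wr))).
have oN := spike_free_open rho0 rhor.
pose D := Lam ^+ (n + m) * ((1 + k) * `|\det S|).
have D0 : 0 <= D by rewrite !mulr_ge0// ?exprn_ge0 ?addr_ge0 ?ltW.
have lV : is_lift p (cinv (c z)) V Pz.2.
  by apply: is_liftS (conj cs ps) => w [].
have hD w : V w -> spike_free rho (cinv (c z) w) -> Num.sqrt (\det (spiked_metric rho (c z) w)) <= D.
  move=> [wr wl] Nw; rewrite (spike_free_density Pc (rzc _ wr) Nw).
  by apply: ler_wpM2l; [rewrite exprn_ge0// ltW|exact: hS2].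
have K1 : 1 < 9 / 8 :> R by lra.
apply: (@le_trans _ _ (volume C gE (piece p (c z) V Pz.2 `&` p @^-1` spike_free rho))).
  apply: volume_le => e [[[ce ue se] ne] Ne]; rewrite Pz1 in ce ue se; split=> //; split=> //.
  by split=> //; rewrite (chart_cmapK smP).
have Jun c' b' e : C c' -> P b' -> cdom c' e -> cdom b' (p e) -> 'J (local_rep p c' b') (cmap c' e) \in unitmx.
  exact: (covering_jacobian_unit smE smP cov).
apply: le_trans (piece_volume smE smP (covering_smooth cov) Jun cover_density Pc oV Vb lV oN D0 K1 hD) _.
pose w0 := cmap (c z) (p e0).
have mV : measurable (V `&` cinv (c z) @^-1` spike_free rho : set (@borelV R (n + m))).
  apply: borel_preimage => //; last exact: borel_open.
  by move=> w /Vb cw; exact: (chart_cinv_continuous smP Pc cw).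
have k1' : 0 < 1 - k by rewrite subr_gt0.
have R0 : 0 < (Lam * (1 - k))^-1 by rewrite invr_gt0 mulr_gt0.
have cS : continuous (fun w : 'rV[R]_(n + m) => norm2 ((w - w0) *m S)).
  move=> w; apply: (@continuous_comp _ _ _ (fun w : 'rV[R]_(n + m) => sqnorm ((w - w0) *m S)) Num.sqrt); last exact: sqrt_continuous.
  apply: (@continuous_comp _ _ _ (fun w : 'rV[R]_(n + m) => (w - w0) *m S) (@sqnorm R (n + m))); last exact: sqnorm_continuous.
  apply: (@continuous_comp _ _ _ (fun w : 'rV[R]_(n + m) => w - w0) (fun v : 'rV[R]_(n + m) => v *m S)); last exact: mulmx_continuous.
  by apply: continuousB; [exact: cvg_id|exact: cst_continuous].
have mE : measurable ([set w | norm2 ((w - w0) *m S) < (Lam * (1 - k))^-1] : set (@borelV R (n + m))).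
  apply: measurable_open.
  have -> : [set w : 'rV[R]_(n + m) | norm2 ((w - w0) *m S) < (Lam * (1 - k))^-1] =
     (fun w => norm2 ((w - w0) *m S)) @^-1` [set x | x < (Lam * (1 - k))^-1] by [].
  by apply: open_comp => [w _|]; [exact: cS|exact: open_lt].
have le1 : (lebesgueV (n + m) (V `&` cinv (c z) @^-1` spike_free rho) <=
    ((Lam * (1 - k))^-1 ^+ (n + m) / `|\det S|)%:E * lebesgueV (n + m) (@euclidean_ball R (n + m)))%E.
  rewrite -(ellipsoid_volume w0 uS R0); apply: le_measure; [exact: mem_set|exact: mem_set|].
  move=> w [[wr wl] _] /=.
  have e0E : cinv (c z) w0 = p e0 by rewrite /w0 (chart_cmapK smP).
  have := hS1 w w0 wr ue0; rewrite e0E => h.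
  by rewrite invfM mulrC ltr_pdivlMl//; apply: le_lt_trans h wl.
apply: le_trans (lee_wpmul2l _ le1) _; first by rewrite lee_fin mulr_ge0// ltW// (lt_trans ltr01).
rewrite muleA -EFinM; apply: lee_wpmul2r => //; rewrite lee_fin le_eqVlt; apply/orP; left; apply/eqP.
rewrite /D exprVn exprMn; move: (Lam ^+ _) ((1 - k) ^+ _) `|\det S| (exprn_gt0 (n + m) Lp) (exprn_gt0 (n + m) k1') dS => x y s x0 y0 s0.
by field; rewrite !gt_eqF.
Qed.

End OnCover.

(** A box of volume of order [rho ^+ m] and a density of order [1 / rho] give at most a multiple of
    [rho], as [m >= 2] and [rho <= 1]. One [D] has to serve all coverings, sheets and values of
    [rho], so it comes first. *)
Lemma spike_piece_volume z : (2 <= m)%N -> z \in sq -> exists2 D, 0 <= D & forall rho (E : topologicalType)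
    (C : set (chart R E (n + m))) (p : E -> M) Pz,
  0 < rho -> 2 * rho <= r0 -> rho <= 1 -> smooth_manifold C -> smooth_covering C P p ->
  good_piece p sq c u r Pz -> Pz.1 = z ->
  (volume C (pullback P (spiked_metric rho) p)
     ((lifted_piece p c u r Pz `&` p @^-1` b z) `&` p @^-1` spike_zone rho) <= (D * rho)%:E)%E.
Proof.
move=> m2 zs; have [[a [e [Aa Be cE]]] rz0 rzc] := cover_chart gc zs.
have [/(_ z zs)[_ _ rcl _] /(_ z)[ob _ _] _ _ _] := gc.
pose u1 := lsubmx (u z).
have ra v : `|v - u1| <= r z -> ccod a v.
  move=> vr; have : ccod (c z) (row_mx v (rsubmx (u z))).
    apply: rcl; have -> : row_mx v (rsubmx (u z)) - u z = row_mx (v - u1) 0.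
      by rewrite -{2}(hsubmxK (u z)) opp_row_mx add_row_mx subrr.
    apply/rV_norm_leP => [|i]; first exact: ltW.
    case: (split_ordP i) => j ->; first by rewrite row_mxEl; apply: le_trans (rV_coord_le _ _) vr.
    by rewrite row_mxEr mxE normr0 ltW.
  by rewrite cE prod_cod => -[/=]; rewrite row_mxKl.
have [D D0 hD] := spike_density_bound Aa ra.
exists (D * (9 / 8) * ((2 * r z) ^+ n * 4 ^+ m)).
  by rewrite !mulr_ge0// exprn_ge0// mulr_ge0// ltW.
move=> rho E C p Pz rho0 rhor rho1 smE cov gP Pz1.
have [Pzs [cs ps]] := gP; rewrite Pz1 in Pzs cs ps.
(* The spike is known in the chart [c0], so the second factor of the product chart [c z] is
   exchanged for [c0]; the first one is kept. *)
pose b' := prod_chart a c0.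
have Pb' : P b' by exists a, c0.
pose V : set 'rV[R]_(n + m) := (ccod b' `&` cinv b' @^-1` (b z `&` spike_zone rho)).
have oV : open V by apply: (preimage_cinv_open smP Pb'); apply: openI => //; exact: spike_zone_open.
have Vb : V `<=` ccod b' by move=> w [].
have bQ : b z `<=` chart_ball_set (c z) (u z) (r z) by exact: (b_sub_Q lam0 gc).
have lV : is_lift p (cinv b') V (fun w => Pz.2 (cmap (c z) (cinv b' w))).
  split=> w [bw [/bQ[cw uw] _]].
    apply: (@continuous_comp _ _ _ (fun w => cmap (c z) (cinv b' w)) Pz.2); last exact: cs.
    apply: (@continuous_comp _ _ _ (cinv b') (cmap (c z))); first exact: (chart_cinv_continuous smP Pb' bw).
    by apply: (chart_cmap_continuous smP _ cw); have [] := cover_chart gc zs.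
  by rewrite ps// (chart_cmapK smP)//; have [] := cover_chart gc zs.
have wfacts w : V w -> `|lsubmx w - u1| < r z /\ `|rsubmx w - v0| < 2 * rho.
  move=> [+ [/bQ[]]]; rewrite prod_cod cE => -[wa wc] [/= aw ew]; rewrite /sphere_ball /= => uw [_].
  have [_ aE] := chart_cinvP smA Aa wa; have [_ cE'] := chart_cinvP smB Bc0 wc.
  rewrite /sphere_ball /= cE'; split=> //; apply: le_lt_trans uw.
  rewrite aE; apply/rV_norm_leP => // j; apply: le_trans (rV_coord_le _ (lshift m j)).
  by rewrite -[u z in leRHS]hsubmxK opp_row_mx add_row_mx row_mxEl.
have hD' w : V w -> setT (cinv b' w) -> Num.sqrt (\det (spiked_metric rho b' w)) <= D / rho.
  by move=> /wfacts[wl wr] _; apply: hD => //; exact: ltW.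
have K1 : 1 < 9 / 8 :> R by lra.
have Jun c' b'' e' : C c' -> P b'' -> cdom c' e' -> cdom b'' (p e') -> 'J (local_rep p c' b'') (cmap c' e') \in unitmx.
  exact: (covering_jacobian_unit smE smP cov).
apply: (@le_trans _ _ (volume C (pullback P (spiked_metric rho) p)
    (piece p b' V (fun w => Pz.2 (cmap (c z) (cinv b' w))) `&` p @^-1` setT))).
  apply: volume_le => y [[[cy uy sy] by'] Zy]; rewrite Pz1 in cy uy sy; split=> //.
  have by1 : cdom b' (p y).
    move: cy; rewrite cE => -[cy1 cy2]; split=> //; by have [] := Zy.
  split=> //; last by rewrite (chart_cmapK smP Pb' by1).
  by split; [exact: chart_cod|rewrite /preimage /mkset (chart_cmapK smP Pb' by1)].
apply: le_trans (piece_volume smE smP (covering_smooth cov) Jun (cover_density smE cov rho0 rhor) Pb' oV Vb lV openT (divr_ge0 D0 (ltW rho0)) K1 hD') _.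
rewrite preimage_setT setIT.
pose lo (i : 'I_(n + m)) : R := match fintype.split i with inl j => u1 0 j - r z | inr j => v0 0 j - 2 * rho end.
pose hi (i : 'I_(n + m)) : R := match fintype.split i with inl j => u1 0 j + r z | inr j => v0 0 j + 2 * rho end.
have spl j : fintype.split (lshift m j : 'I_(n + m)) = inl j by exact: (unsplitK (inl j)).
have spr j : fintype.split (rshift n j : 'I_(n + m)) = inr j by exact: (unsplitK (inr j)).
have lohi i : lo i <= hi i.
  by rewrite /lo /hi; case: fintype.split => j; [have := rz0; lra|have := rho0; lra].
have le1 : (lebesgueV (n + m) V <= ((2 * r z) ^+ n * (4 * rho) ^+ m)%:E)%E.
  have -> : (2 * r z) ^+ n * (4 * rho) ^+ m = \prod_(i < n + m) (hi i - lo i).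
    rewrite big_split_ord /=; congr (_ * _).
      rewrite -[n in LHS]card_ord -prodr_const; apply: eq_bigr => i _.
      by rewrite /lo /hi spl; ring.
    rewrite -[m in LHS]card_ord -prodr_const; apply: eq_bigr => i _.
    by rewrite /lo /hi spr; ring.
  rewrite -(lebesgueV_box lohi); apply: le_measure; [|apply: mem_set; exact: measurable_box|].
    by apply: mem_set; exact: measurable_open.
  move=> w /wfacts[wl wr] /= i; rewrite /lo /hi.
  have wE : w = row_mx (lsubmx w) (rsubmx w) by rewrite hsubmxK.
  case: (split_ordP i) => j ->; rewrite wE ?spl ?spr ?row_mxEl ?row_mxEr.
    have := le_lt_trans (rV_coord_le (lsubmx w - u1) j) wl; rewrite mxE [(- u1) 0 j]mxE ltr_norml.
    by move=> /andP[h1 h2]; apply/andP; split; lra.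
  have := le_lt_trans (rV_coord_le (rsubmx w - v0) j) wr; rewrite mxE [(- v0) 0 j]mxE ltr_norml.
  by move=> /andP[h1 h2]; apply/andP; split; lra.
have DK0 : 0 <= D / rho * (9 / 8) by rewrite !mulr_ge0// invr_ge0 ltW.
apply: le_trans (lee_wpmul2l _ le1) _; first by rewrite lee_fin.
rewrite -EFinM lee_fin [(4 * rho) ^+ m]exprMn.
have -> : D / rho * (9 / 8) * ((2 * r z) ^+ n * (4 ^+ m * rho ^+ m)) =
    D * (9 / 8) * ((2 * r z) ^+ n * 4 ^+ m) * (rho ^+ m / rho) by ring.
apply: ler_wpM2l; first by rewrite !mulr_ge0// exprn_ge0// mulr_ge0// ltW.
rewrite ler_pdivrMr// -expr2 -(subnK m2) exprD ler_piMl ?sqr_ge0//.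
by apply: exprn_ile1 => //; exact: ltW.
Qed.

Lemma unit_ball_volume (w e : R) : (2 <= m)%N -> lebesgueV (n + m) (@euclidean_ball R (n + m)) = w%:E ->
  0 < w -> 0 < e -> Lam^-1 <= lam ->
  exists rho, [/\ 0 < rho, 2 * rho <= r0 & forall (E : topologicalType) (C : set (chart R E (n + m))) (p : E -> M) e0,
    smooth_manifold C -> smooth_covering C P p ->
    (volume C (pullback P (spiked_metric rho) p) (rball C (pullback P (spiked_metric rho) p) e0 1) <=
      ((1 + k) / (1 - k) ^+ (n + m) * (9 / 8) * w + e)%:E)%E].
Proof.
move=> m2 wE w0 e_gt0 Ll.
have /choice[D hD] : forall z, exists D, z \in sq -> 0 <= D /\ forall rho (E : topologicalType)
    (C : set (chart R E (n + m))) (p : E -> M) Pz,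
    0 < rho -> 2 * rho <= r0 -> rho <= 1 -> smooth_manifold C -> smooth_covering C P p ->
    good_piece p sq c u r Pz -> Pz.1 = z ->
    (volume C (pullback P (spiked_metric rho) p)
     ((lifted_piece p c u r Pz `&` p @^-1` b z) `&` p @^-1` spike_zone rho) <= (D * rho)%:E)%E.
  move=> z; have [zs|nz] := boolP (z \in sq); last by exists 0.
  by have [D D0 hD] := spike_piece_volume m2 zs; exists D.
pose L := words sq (Num.truncn (2 / (del * lam))).+2.
(* [D1] dominates the constants of all the charts and [size L] bounds the number of sheets, so the
   part of a ball over the spike has volume at most [T * rho]. *)
pose D1 := \sum_(z <- sq | z \in sq) D z; pose T := (size L)%:R * D1.
have D10 : 0 <= D1 by apply: sumr_ge0 => z /hD[].
have DD1 z : z \in sq -> D z <= D1.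
  by move=> zs; rewrite /D1 (big_rem z)//= zs lerDl big_seq_cond sumr_ge0// => y /andP[_ /hD[]].
have T0 : 0 <= T by rewrite mulr_ge0.
have T1 : 0 < T + 1 by rewrite ltr_wpDl.
pose rho := Num.min (Num.min 1 (r0 / 2)) (e / (T + 1)).
have rho0 : 0 < rho by rewrite !lt_min ltr01 !divr_gt0.
have rho1 : rho <= 1 by rewrite !ge_min lexx.
have rhor : 2 * rho <= r0 by rewrite mulrC -ler_pdivlMr// !ge_min lexx orbT.
have Trho : T * rho <= e.
  apply: (@le_trans _ _ ((T + 1) * rho)); first by rewrite ler_wpM2r ?lerDl// ltW.
  by rewrite mulrC -ler_pdivlMr// !ge_min lexx !orbT.
clearbody rho; exists rho; split=> // E C p e0 smE cov.
set gE := pullback P (spiked_metric rho) p.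
have cp := smooth_map_continuous (covering_smooth cov).
have th0 : 0 < del * lam / 2 by rewrite divr_gt0// mulr_gt0.
have [|PP [gP hP]] := multiplicity_bound smE smP cov lam0 gc (K := spiked_map rho \o p)
    (W := spiked_weight rho \o p) e0 del0.
  move=> y y' a ctl a0; have [g [cg g0 g1 gF _]] := controlled_bounds rho0 a0 ctl.
  by exists g; split=> // t t0 t1; have [] := gF t t0 t1.
rewrite -/L in hP.
pose Pw (j : 'I_(size L)) := PP (tnth (in_tuple L) j).
have gPw j : good_piece p sq c u r (Pw j).
  by apply: gP; apply: (words_all (n := (Num.truncn (2 / (del * lam))).+2)); exact: mem_tnth.
have lifted_open Pz : good_piece p sq c u r Pz -> open (lifted_piece p c u r Pz).
  move=> [Ps lP]; have [Pc _ _] := cover_chart gc Ps.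
  exact: (piece_open smP cov Pc (@sphere_ball_open _ _ _ _) lP).
pose Z j := (lifted_piece p c u r (Pw j) `&` p @^-1` b (Pw j).1) `&` p @^-1` spike_zone rho.
have preim_open (V : set M) : open V -> open (p @^-1` V) by apply: open_comp => x _; exact: cp.
have oZ j : open (Z j).
  have [_ /(_ (Pw j).1)[ob _ _] _ _ _] := gc.
  apply: openI; last by apply: preim_open; exact: spike_zone_open.
  by apply: openI; [exact: lifted_open|exact: preim_open].
have cgE := cover_continuous_density smE cov rho0 rhor; rewrite -/gE in cgE.
have zone S : S `<=` \bigcup_j Z j -> (volume C gE S <= e%:E)%E.
  move=> SZ; apply: le_trans (volume_cover smE cgE oZ SZ) _.
  apply: (@le_trans _ _ (\sum_(j < size L) (D1 * rho)%:E)%E).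
    apply: lee_sum => j _; have [Ps _] := gPw j; have [_ h] := hD _ Ps.
    apply: le_trans (h rho E C p (Pw j) rho0 rhor rho1 smE cov (gPw j) erefl) _.
    by rewrite lee_fin ler_wpM2r// ?DD1// ltW.
  by rewrite sumEFin sumr_const card_ord lee_fin -mulr_natl mulrA.
have in_zone y l : chain (spiked_map rho \o p) (spiked_weight rho \o p) (del * lam / 2) e0 y l -> l < 1 ->
    spike_zone rho (p y) -> (\bigcup_j Z j) y.
  move=> ch l1 Zy; have [w' [wL ly by']] := hP y l ch l1.
  by have /tnthP[j jE] : w' \in in_tuple L by []; exists j => //; rewrite /Z /Pw -jE.
have [F2|F2] := leP (spike rho (p e0).2 0 0) 2; last first.
  apply: (@le_trans _ _ e%:E); last first.
    rewrite lee_fin lerDr !mulr_ge0// ?invr_ge0 ?exprn_ge0// ?subr_ge0 ltW// addr_gt0//.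
  apply: zone => y /(cover_ball_chain smE cov rho0 rhor th0)[l l1 ch].
  have low (x x1 t : R) : `|x - x1| <= t -> t < 1 -> 2 < x1 -> 0 < x.
    by rewrite ler_norml => /andP[h1 _] h2 h3; lra.
  exact: (in_zone _ _ ch l1 (spike_gt0 rho0 (low _ _ _ (chain_spike rho0 ch) l1 F2))).
have [_ _ /(_ (p e0))[z zs be0] _ _] := gc.
have [s [gs ls]] := piece_through smE smP cov gc zs (b_sub_Q lam0 gc be0).
pose Ne := [set e | lifted_piece p c u r (z, s) e /\ (norm2 (f (p e) - f (p e0)) < Lam^-1)%R] `&`
  p @^-1` spike_free rho.
have oN : open Ne.
  apply: openI; last by apply: preim_open; exact: spike_free_open.
  have cn : continuous (fun e => norm2 (f (p e) - f (p e0))).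
    move=> y; apply: (@continuous_comp _ _ _ (fun e => sqnorm (f (p e) - f (p e0))) Num.sqrt); last exact: sqrt_continuous.
    apply: (@continuous_comp _ _ _ (fun e => f (p e) - f (p e0)) (@sqnorm R _)); last exact: sqnorm_continuous.
    apply: continuousB; last exact: cst_continuous.
    apply: (@continuous_comp _ _ _ p f); first exact: cp.
    exact: (smooth_fun_continuous smP product_map_smooth).
  apply: openI; first exact: lifted_open.
  apply: (@open_comp _ _ (fun e => norm2 (f (p e) - f (p e0))) [set x | x < Lam^-1]).
    by move=> y _; exact: cn.
  exact: open_lt.
(* Two open sets cover the ball: the sheet through [e0] off the spike, and the union over all words
   of the parts above the spike. *)
pose Q (i : 'I_2) := if i == ord0 then Ne else \bigcup_j Z j.
have oQ i : open (Q i) by rewrite /Q; case: ifP => // _; exact: bigcup_open.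
apply: le_trans (volume_cover smE cgE oQ _) _.
  move=> y /(cover_ball_chain smE cov rho0 rhor th0)[l l1 ch].
  have [Zy|Fy] := spike_zone_or_free (p y) rho0 rhor.
    by exists (lift ord0 ord0) => //; exact: in_zone ch l1 Zy.
  have [ly ny] := chain_near smE cov rho0 gs erefl ls be0 Ll F2 ch l1.
  exists ord0 => //; split=> //; split=> //; apply: le_lt_trans ny _.
  by rewrite ltr_pdivrMr ?Lam_gt0// mulVf// gt_eqF ?Lam_gt0.
rewrite big_ord_recl big_ord1 EFinD; apply: leeD; last by apply: zone.
by apply: le_trans (near_piece_volume smE cov rho0 rhor gs erefl ls) _; rewrite wE -EFinM.
Qed.

End Estimates.

End SpikedMetric.

(** * Comparison with Euclidean space *)

Section EuclideanSpace.
Context {R : realType}.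

Local Notation gE d := (@euclidean_metric R d).
Local Notation AE d := (@euclidean_atlas R d).

Lemma straight_path_local_rep d (u : 'rV[R]_d) :
  local_rep (fun t : R => t *: u) (@line_chart R) (Chart setT id id) = mulmxr u.
Proof. by apply/funext => w /=; rewrite /local_rep /=; apply/rowP => j; rewrite !mxE big_ord1. Qed.

Lemma straight_path_smooth d (u : 'rV[R]_d) : smooth_map (@line_atlas R) (AE d) (fun t : R => t *: u).
Proof.
split=> [t _|_ _ -> -> k]; first exact: scalel_continuous.
by rewrite straight_path_local_rep; apply: Ck_linear; exact: mulmx_continuous.
Qed.

Lemma jacobian_mulmxr d (u : 'rV[R]_d) (w : 'rV[R]_1) : 'J (mulmxr u) w = u.
Proof.
rewrite -['J _ w]mul1mx mul_rV_lin1 diff_lin; last exact: mulmx_continuous.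
by rewrite /= mul1mx.
Qed.

Lemma straight_path_speed d (u : 'rV[R]_d) t : speed (AE d) (gE d) (fun t : R => t *: u) t = norm2 u.
Proof.
rewrite /speed /norm2 /sqnorm; congr Num.sqrt; congr (fun_of_matrix _ _ _).
rewrite /pullback; apply: xget_unique; last by move=> _ [_ [-> _ ->]]; rewrite straight_path_local_rep jacobian_mulmxr mulmx1.
by exists (Chart setT id id); split=> //; rewrite straight_path_local_rep jacobian_mulmxr mulmx1.
Qed.

Lemma euclidean_ball_sub_rball d : @euclidean_ball R d `<=` rball (AE d) (gE d) 0 1.
Proof.
move=> u; rewrite /euclidean_ball /= -norm2_lt1 => u1.
apply: (@le_lt_trans _ _ (norm2 u)%:E); last by rewrite lte_fin.
apply: ereal_inf_lbound; rewrite /= -{1}[u]scale1r.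
have -> : (norm2 u)%:E = (0 + length (AE d) (gE d) (fun t : R => t *: u))%E :> \bar R.
  rewrite add0e /length; under eq_integral do rewrite straight_path_speed.
  by rewrite integral_cst//= lebesgue_measure_itv/= lte_fin ltr01 oppr0 adde0 mule1.
apply: (@joined_step _ _ _ _ _ _ (fun t : R => t *: u)); last exact: straight_path_smooth.
by rewrite scale0r; exact: joined_refl.
Qed.

(** The Euclidean volume stands on the larger side of the theorem, so a lower bound is what is
    wanted; straight segments place the round ball inside the metric ball. *)
Lemma max_ball_volume_euclidean d :
  (lebesgueV d (@euclidean_ball R d) <= max_ball_volume (AE d) (gE d) 1)%E.
Proof.
apply: (@le_trans _ _ (volume (AE d) (gE d) (rball (AE d) (gE d) 0 1))); last first.
  by apply: ereal_sup_ubound; exists 0.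
apply: ereal_sup_ubound; exists 1%N, (fun _ => Chart setT id id), (fun _ => @euclidean_ball R d).
split=> //.
- split; first by apply: borel_open; exact: euclidean_ball_open.
  by move=> u ub; split=> //; exact: euclidean_ball_sub_rball.
- by move=> i j _ _ _; rewrite !ord1.
rewrite big_ord1 lebesgueVE; last by apply: measurable_open; exact: euclidean_ball_open.
rewrite /chart_volume /= image_id; congr lebesgue_int; apply/funext => u.
by rewrite det1 sqrtr1 mulr1.
Qed.

End EuclideanSpace.

(** Take [k = 1 / (8 * (d + 1))]. By Bernoulli [(1 - k)^d >= 1 - d * k >= 7/8], while
    [1 + k <= 9/8], and [9/7] is less than [4/3]. *)
Lemma distortion_constant {R : realType} d : exists k : R, [/\ 0 < k, k < 1 & (1 + k) / (1 - k) ^+ d <= 4 / 3].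
Proof.
have d1 : 0 < 8 * d.+1%:R :> R by rewrite mulr_gt0.
pose k : R := (8 * d.+1%:R)^-1; have k0 : 0 < k by rewrite invr_gt0.
have k8 : k <= 1 / 8.
  by rewrite div1r lef_pV2 ?posrE// ler_peMr// ler1n.
have dk : d%:R * k <= 1 / 8.
  rewrite /k invfM mulrCA mul1r ler_piMr// ler_pdivrMr// mul1r ler_nat.
  exact: leqnSn.
have bern j : 1 - j%:R * k <= (1 - k) ^+ j.
  elim: j => [|j IH]; first by rewrite mul0r subr0 expr0.
  have j0 : 0 <= j%:R * k * k by rewrite !mulr_ge0// ltW.
  rewrite exprS; apply: le_trans (ler_wpM2l _ IH); last by lra.
  by rewrite -natr1 mulrDl mul1r; move: (j%:R * k) j0 => x; nra.
exists k; split=> //; first by lra.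
have h := bern d; rewrite ler_pdivrMr; last by lra.
lra.
Qed.

Theorem proposition1p3 (R : realType) (n m : nat)
  (Sigma X : topologicalType)
  (A : set (chart R Sigma n)) (B : set (chart R X m)) (h : tensor2 R Sigma n)
  (hn : (0 < n)%N) (hm : (2 <= m)%N)
  (closedSigma : closed_manifold A) (hypSigma : hyperbolic A h)
  (closedX : closed_manifold B)
  (eps : R) (heps : 0 < eps) :
  exists g : tensor2 R (Sigma * X)%type (n + m),
    [/\ riemannian_metric (prod_atlas A B) g,
        (forall (E : topologicalType) (C : set (chart R E (n + m)))
                (p : E -> (Sigma * X)%type),
           universal_cover C (prod_atlas A B) p ->
           (max_ball_volume C (pullback (prod_atlas A B) g p) 1 <
            2%:E * max_ball_volume (@euclidean_atlas R (n + m))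
                     (@euclidean_metric R (n + m)) 1)%E) &
        (exists (x : X) (e : Sigma -> (Sigma * X)%type),
           isotopic A (prod_atlas A B) (fun s => (s, x)) e /\
           (volume A (pullback (prod_atlas A B) g e) setT < eps%:E)%E)].
Proof.
have [smA cA _ _] := closedSigma; have [smB cB _ [x0 _]] := closedX.
have [N1 [fS [sfS ifS mfS]]] := compact_embedding smA cA.
have [N2 [fX [sfX ifX mfX]]] := compact_embedding smB cB.
have [c0 [r0 [Bc0 cx0 r00 rc0]]] := chart_ball smB x0.
have smP := prod_smooth_manifold smA smB.
have cP : compact [set: (Sigma * X)%type] by rewrite -setXTT; exact: compact_setX.
have [k [k0 k1 kd]] := @distortion_constant R (n + m).
have [lam [sq [c [u [r [b [lam0 gc]]]]]]] := good_cover_exists smP cP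
  (product_map_smooth smA smB sfS sfX) (product_map_inj ifS ifX)
  (product_map_immersive smA smB sfS sfX mfS mfX) k0.
have [V V0 hV] : exists2 V, 0 <= V & forall N (K W : Sigma -> 'rV[R]_N) g t, smooth_fun A K ->
    smooth_fun A W -> is_wtensor A K W g -> 0 <= t ->
    (forall c u, A c -> ccod c u -> Num.sqrt (\det (g c u)) <=
      t * Num.sqrt (\det ('J (fS \o cinv c) u *m ('J (fS \o cinv c) u)^T))) ->
    (volume A g setT <= (t * V)%:E)%E.
  apply: (compact_volume smA cA (h := fun c u =>
    Num.sqrt (\det ('J (fS \o cinv c) u *m ('J (fS \o cinv c) u)^T)))) => c' v Ac cv.
  have ch : {for v, continuous (fun v => Num.sqrt (\det (wtensor fS (fun _ => const_mx 1) c' v)))}.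
    apply: (@continuous_comp _ _ _ (fun v => \det (wtensor fS (fun _ => const_mx 1) c' v)) Num.sqrt); last exact: sqrt_continuous.
    apply: continuous_det => i j; apply: continuous_coord_comp.
    have sW : smooth_fun A (fun _ : Sigma => const_mx 1 : 'rV[R]_N1) by move=> ? _ ?; exact: Ck_cst.
    by have := wtensor_smooth smA sfS sW Ac 0; apply.
  have <- : (fun v => Num.sqrt (\det (wtensor fS (fun _ => const_mx 1) c' v))) =
      (fun v => Num.sqrt (\det ('J (fS \o cinv c') v *m ('J (fS \o cinv c') v)^T))).
    by apply/funext => w; rewrite /wtensor diag_const_mx mulmx1.
  exact: ch.
have V1 : 0 < V + 1 by rewrite ltr_wpDl.
(* The slice has volume at most [del ^+ n * V]; since [n > 0] and [del <= 1], this is at most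
   [del * V], which is less than [eps]. *)
pose del := Num.min 1 (eps / (V + 1)).
have del0 : 0 < del by rewrite lt_min ltr01 divr_gt0.
have delV : del ^+ n * V < eps.
  apply: (@le_lt_trans _ _ (del * V)).
    apply: ler_wpM2r => //; rewrite -(prednK hn) exprS ler_piMr ?(ltW del0)//.
    by apply: exprn_ile1; [exact: ltW|rewrite ge_min lexx].
  apply: (@lt_le_trans _ _ (del * (V + 1))); first by rewrite ltr_pM2l// ltrDl.
  by rewrite -ler_pdivlMr// ge_min lexx orbT.
(* [Lam >= 1 / lam] keeps a unit ball centered low in one chart ball, and [Lam >= del] places the
   slice weight between [del ^+ 2] and [Lam ^+ 2]. *)
clearbody del; pose Lam := Num.max del lam^-1.
have delLam : del <= Lam by rewrite le_max lexx.
have Ll : Lam^-1 <= lam.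
  by rewrite -[leRHS]invrK lef_pV2 ?posrE ?invr_gt0 ?lt_max ?del0// le_max lexx orbT.
have [w w0 wE] := @euclidean_ball_volume R (n + m).
have w4 : 0 < w / 4 by rewrite divr_gt0.
have [rho [rho0 rhor ball]] := unit_ball_volume smA smB sfS sfX mfS mfX Bc0 r00 rc0 del0 delLam
  k0 k1 lam0 gc hm wE w0 w4 Ll.
have chA : forall c, A c -> is_chart c by have [_ _ hA _ _] := smA.
exists (spiked_metric fS fX c0 (cmap c0 x0) del Lam rho); split.
- exact: (spiked_metric_riemannian smA smB sfS sfX mfS mfX Bc0 rc0 del0 delLam rho0 rhor).
- move=> E C p [smE _ cov].
  (* [4/3 * 9/8 = 3/2] for the part off the spike, plus [1/4] for the part over it. *)
  apply: (@le_lt_trans _ _ (7 / 4 * w)%:E).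
    apply: ge_ereal_sup => _ [e0 _ <-]; apply: le_trans (ball E C p e0 smE cov) _.
    rewrite lee_fin; have : (1 + k) / (1 - k) ^+ (n + m) * w <= 4 / 3 * w by rewrite ler_wpM2r// ltW.
    by move: ((1 + k) / _) => y; lra.
  apply: (@lt_le_trans _ _ (2 * w)%:E); first by rewrite lte_fin ltr_pM2r//; lra.
  by rewrite EFinM; apply: lee_wpmul2l; rewrite ?lee_fin// -wE; exact: max_ball_volume_euclidean.
exists (cinv c0 (cmap c0 x0)), (fun s => (s, cinv c0 (cmap c0 x0))); split.
  exact: slice_isotopic.
have sl := slice_smooth B smA c0 (cmap c0 x0).
have sK := spiked_map_smooth smA smB sfS sfX Bc0 rc0 rho0 rhor.
have sW := @spiked_weight_smooth R Sigma X n m N1 N2 A B smA smB c0 _ r0 Bc0 rc0 del Lam rho rho0 rhor.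
apply: (@le_lt_trans _ _ (del ^+ n * V)%:E); last by rewrite lte_fin.
apply: hV.
- exact: (smooth_fun_comp smP chA sl sK).
- exact: (smooth_fun_comp smP chA sl sW).
- by apply: (is_wtensor_pullback smP chA sl sK); exact: is_wtensor_refl.
- by rewrite exprn_ge0// ltW.
- by move=> c' v Ac cv; rewrite (slice_density smA smB sfS sfX Bc0 r00 rc0 Lam del0 rho0 rhor Ac cv).
Qed.
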